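(* Suppose that the behavior policy $\pi_b$ satisfies $\pi_b(a|s)>0$ for all $(s,a)$ and that the Markov chain $\{S_k\}$ induced by $\pi_b$ is irreducible and aperiodic. Let $\pi$ be the target policy, let $\gamma_c\in(0,1)$ be a tunable constant, and let $n$ be a positive integer with $$n\geq \frac{2\log(\gamma_c)+\log(\kappa_{b,\min})}{2\log(\gamma)}.$$ Let $\{w_k\}_{k\ge 0}$ be the iterates of off-policy $n$-step TD-learning with linear function approximation (defined in the context), started from $w_0\in\mathbb{R}^d$. (i) If a constant stepsize $\alpha>0$ is used, chosen such that $\alpha (t_\alpha+n+1)\leq \frac{1-\gamma_c}{456 f(\gamma\zeta_\pi)^2}$, then for all $k\geq t_\alpha+n+1$: $$\mathbb{E}[\|w_k-w_\pi\|_2^2]\leq c_1\bigl(1-(1-\gamma_c)\lambda_{\min}\alpha\bigr)^{k-(t_\alpha+n+1)}+c_2\frac{\alpha (t_\alpha+n+1)}{(1-\gamma_c)\lambda_{\min}},$$ where $c_1=(\|w_0\|_2+\|w_0-w_\pi\|_2+1)^2$ and $c_2=114f(\gamma\zeta_\pi)^2(\|w_\pi\|_2+1)^2$. (ii) Moreover, when stepsizes $\alpha_k$ (used in place of $\alpha$ at iteration $k$) satisfy $\sum_{k=0}^\infty\alpha_k=\infty$ and $\sum_{k=0}^\infty\alpha_k^2<\infty$, we have $\lim_{k\rightarrow\infty}w_k=w_\pi$ almost surely.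
   Context: MDP: finite state space $\mathcal{S}$, finite action space $\mathcal{A}$, transition matrices $\{P_a\}_{a\in\mathcal{A}}$ on $\mathcal{S}$, reward $\mathcal{R}:\mathcal{S}\times\mathcal{A}\to\mathbb{R}$ with $\max_{s,a}|\mathcal{R}(s,a)|\le 1$, discount factor $\gamma\in(0,1)$. A policy $\pi$ assigns to each $s$ a probability distribution $\pi(\cdot|s)$ on $\mathcal{A}$. Features: $\phi_1,\dots,\phi_d\in\mathbb{R}^{|\mathcal{S}||\mathcal{A}|}$ are linearly independent, $\phi(s,a)=(\phi_1(s,a),\dots,\phi_d(s,a))^\top\in\mathbb{R}^d$ satisfies $\|\phi(s,a)\|_1\le 1$ for all $(s,a)$, and $\Phi=[\phi_1,\dots,\phi_d]$. Behavior policy: $\{(S_k,A_k)\}_{k\ge0}$ is a single trajectory generated by $\pi_b$ (that is, $A_k\sim\pi_b(\cdot|S_k)$, $S_{k+1}\sim P_{A_k}(S_k,\cdot)$). $P$ denotes the transition matrix of $\{S_k\}$ under $\pi_b$, $\mu_b$ its unique stationary distribution, $\kappa_b(s,a)=\mu_b(s)\pi_b(a|s)$ the stationary distribution of $\{(S_k,A_k)\}$, $\kappa_{b,\min}=\min_{s,a}\kappa_b(s,a)$, $\mathcal{K}=\mathrm{diag}(\kappa_b)$, and $\lambda_{\min}$ is the smallest eigenvalue of the positive definite matrix $\Phi^\top\mathcal{K}\Phi$. For $\alpha>0$, $t_\alpha=\min\{k\ge0:\max_{s\in\mathcal{S}}\|P^k(s,\cdot)-\mu_b(\cdot)\|_{\mathrm{TV}}\le\alpha\}$,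 where $\|\cdot\|_{\mathrm{TV}}$ is the total variation distance (half the $\ell_1$ distance). For a target policy $\pi$: $\rho(s,a)=\pi(a|s)/\pi_b(a|s)$, $\zeta_\pi=\max_{s,a}\rho(s,a)$, and $f(x)=n+1$ if $x=1$, $f(x)=\frac{1-x^{n+1}}{1-x}$ if $x\ne1$. Algorithm (off-policy $n$-step TD with linear function approximation, constant stepsize $\alpha$): for $k=0,1,\dots$, with $$\delta_{k,i}=\mathcal{R}(S_i,A_i)+\gamma\rho(S_{i+1},A_{i+1})\phi(S_{i+1},A_{i+1})^\top w_k-\phi(S_i,A_i)^\top w_k,$$ $$\Delta_{k,n}=\sum_{i=k}^{k+n-1}\gamma^{i-k}\Bigl(\prod_{j=k+1}^{i}\rho(S_j,A_j)\Bigr)\delta_{k,i},$$ set $w_{k+1}=w_k+\alpha\,\phi(S_k,A_k)\Delta_{k,n}$. Bellman operator: $(\mathcal{T}_\pi Q)(s,a)=\mathcal{R}(s,a)+\gamma\sum_{s',a'}P_a(s,s')\pi(a'|s')Q(s',a')$, and $\mathcal{T}_\pi^n$ is its $n$-fold composition. $\Pi_{\kappa_b}=\Phi(\Phi^\top\mathcal{K}\Phi)^{-1}\Phi^\top\mathcal{K}$ is the projection onto the column span of $\Phi$ in the $\kappa_b$-weighted $\ell_2$-norm. $w_\pi\in\mathbb{R}^d$ is the unique solution (it exists and is unique under the stated condition on $n$) of the projected Bellman equation $\Phi w=\Pi_{\kappa_b}\mathcal{T}_\pi^n(\Phi w)$. *)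

(* Defs.v *)
From HB Require Import structures.
From mathcomp Require Import all_boot all_order all_algebra.
From mathcomp Require Import all_classical all_reals all_analysis.

Set Implicit Arguments.
Unset Strict Implicit.
Unset Printing Implicit Defensive.

Import Order.TTheory GRing.Theory Num.Theory.
Import numFieldNormedType.Exports.

Local Open Scope classical_set_scope.
Local Open Scope ring_scope.

Definition is_pmf (R : realType) (T : finType) (p : T -> R) : Prop :=
  (forall x, 0 <= p x) /\ \sum_x p x = 1.

(* Used both for a transition matrix [P_a : S -> S -> R] and for a policy
   [pi : S -> A -> R], where [pi s a] is pi(a|s). *)
Definition is_stochastic (R : realType) (T U : finType) (K : T -> U -> R) : Prop :=
  forall x, is_pmf (K x).

Fixpoint kernel_pow (R : realType) (S : finType) (P : S -> S -> R) (k : nat)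
    (s s' : S) : R :=
  if k is k'.+1 then \sum_u P s u * kernel_pow P k' u s' else (s == s')%:R.

Definition irreducible (R : realType) (S : finType) (P : S -> S -> R) : Prop :=
  forall s s', exists k, 0 < kernel_pow P k s s'.

(* The gcd of the return times {k >= 1 : P^k(s,s) > 0} is 1, for every s. *)
Definition aperiodic (R : realType) (S : finType) (P : S -> S -> R) : Prop :=
  forall (s : S) (m : nat),
    (forall k, (0 < k)%N -> 0 < kernel_pow P k s s -> (m %| k)%N) -> m = 1%N.

Definition stationary (R : realType) (S : finType) (P : S -> S -> R)
    (mu : S -> R) : Prop :=
  is_pmf mu /\ forall s', \sum_s mu s * P s s' = mu s'.

Definition tv_dist (R : realType) (S : finType) (p q : S -> R) : R :=
  2^-1 * \sum_s `|p s - q s|.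

(* The maximum over a finite type of nonnegative numbers, so the default value
   0 of the iterated maximum is harmless. *)
Definition max_tv (R : realType) (S : finType) (P : S -> S -> R) (mu : S -> R)
    (k : nat) : R :=
  \big[Num.max/0]_(s : S) tv_dist (kernel_pow P k s) mu.

(* The least k with [max_tv P mu k <= alpha]; the junk value 0 is only taken
   when there is no such k. *)
Definition mixing_time (R : realType) (S : finType) (P : S -> S -> R)
    (mu : S -> R) (alpha : R) : nat :=
  match pselect (exists k, max_tv P mu k <= alpha) with
  | left ex => ex_minn ex
  | right _ => 0%N
  end.

Definition induced_kernel (R : realType) (S A : finType) (P : A -> S -> S -> R)
    (pi : S -> A -> R) (s s' : S) : R :=
  \sum_a pi s a * P a s s'.

(* The trajectory generated by [pib], from an arbitrary initial law: given the
   history, A_k is drawn from pib(.|S_k) and S_{k+1} from P_{A_k}(S_k, .).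
   The conditional laws are multiplied out so that histories of probability 0
   need no special treatment. *)
Definition history (T S A : Type) (St : nat -> T -> S) (Ac : nat -> T -> A)
    (k : nat) (s : nat -> S) (a : nat -> A) : set T :=
  [set o | forall i, (i < k)%N -> St i o = s i /\ Ac i o = a i].

Definition is_trajectory (R : realType) (S A : finType) (P : A -> S -> S -> R)
    (pib : S -> A -> R) (d : measure_display) (T : measurableType d)
    (Pr : probability T R) (St : nat -> T -> S) (Ac : nat -> T -> A) : Prop :=
  [/\ forall k s, measurable (St k @^-1` [set s]),
      forall k a, measurable (Ac k @^-1` [set a]),
      forall k (s : nat -> S) (a : nat -> A),
        Pr (history St Ac k s a `&` St k @^-1` [set s k] `&` Ac k @^-1` [set a k])
        = (Pr (history St Ac k s a `&` St k @^-1` [set s k])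
           * (pib (s k) (a k))%:E)%E &
      forall k (s : nat -> S) (a : nat -> A),
        Pr (history St Ac k.+1 s a `&` St k.+1 @^-1` [set s k.+1])
        = (Pr (history St Ac k.+1 s a) * (P (a k) (s k) (s k.+1))%:E)%E].

Definition kappa (R : realType) (S A : finType) (mu : S -> R) (pib : S -> A -> R)
    (x : S * A) : R :=
  mu x.1 * pib x.1 x.2.

(* Since kappa <= 1 pointwise, the default value 1 of the iterated minimum is
   harmless. *)
Definition kappa_min (R : realType) (S A : finType) (mu : S -> R)
    (pib : S -> A -> R) : R :=
  \big[Num.min/1]_(x : S * A) kappa mu pib x.

(* Vectors and matrices indexed by S * A use the enumeration of that type. *)
Definition vec_of_fun (R : realType) (T : finType) (Q : T -> R) : 'cV[R]_#|T| :=
  \col_i Q (enum_val i).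

Definition fun_of_vec (R : realType) (T : finType) (v : 'cV[R]_#|T|) (x : T) : R :=
  v (enum_rank x) ord0.

(* Column j is the basis function phi_j, row i is phi(s,a)^T. *)
Definition feature_mx (R : realType) (S A : finType) (d : nat)
    (phi : S * A -> 'cV[R]_d) : 'M[R]_(#|{: S * A}|, d) :=
  \matrix_(i, j) phi (enum_val i) j ord0.

Definition kappa_mx (R : realType) (S A : finType) (mu : S -> R)
    (pib : S -> A -> R) : 'M[R]_#|{: S * A}| :=
  diag_mx (\row_i kappa mu pib (enum_val i)).

Definition gram_mx (R : realType) (S A : finType) (d : nat)
    (phi : S * A -> 'cV[R]_d) (mu : S -> R) (pib : S -> A -> R) : 'M[R]_d :=
  (feature_mx phi)^T *m kappa_mx mu pib *m feature_mx phi.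

Definition proj_mx_kappa (R : realType) (S A : finType) (d : nat)
    (phi : S * A -> 'cV[R]_d) (mu : S -> R) (pib : S -> A -> R) :
    'M[R]_#|{: S * A}| :=
  feature_mx phi *m invmx (gram_mx phi mu pib)
  *m (feature_mx phi)^T *m kappa_mx mu pib.

(* The set of eigenvalues is finite, and nonempty for a real symmetric matrix
   of positive size, so the infimum is a minimum in the case of interest. *)
Definition min_eigenvalue (R : realType) (d : nat) (M : 'M[R]_d) : R :=
  inf [set x : R | eigenvalue M x].

Definition bellman (R : realType) (S A : finType) (P : A -> S -> S -> R)
    (r : S -> A -> R) (gamma : R) (pi : S -> A -> R) (Q : S * A -> R)
    (x : S * A) : R :=
  r x.1 x.2
  + gamma * \sum_s' \sum_a' P x.2 x.1 s' * pi s' a' * Q (s', a').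

Definition projected_bellman (R : realType) (S A : finType) (d : nat)
    (P : A -> S -> S -> R) (r : S -> A -> R) (gamma : R) (pi pib : S -> A -> R)
    (mu : S -> R) (phi : S * A -> 'cV[R]_d) (n : nat) (w : 'cV[R]_d) : Prop :=
  let Phi := feature_mx phi in
  Phi *m w = proj_mx_kappa phi mu pib
    *m vec_of_fun (iter n (bellman P r gamma pi) (fun_of_vec (Phi *m w))).

Definition is_ratio (R : realType) (S A : finType) (pi pib : S -> A -> R)
    (x : S * A) : R :=
  pi x.1 x.2 / pib x.1 x.2.

(* Importance ratios are nonnegative, so the default value 0 is harmless. *)
Definition max_ratio (R : realType) (S A : finType) (pi pib : S -> A -> R) : R :=
  \big[Num.max/0]_(x : S * A) is_ratio pi pib x.

Definition geom (R : realType) (n : nat) (x : R) : R :=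
  if x == 1 then n.+1%:R else (1 - x ^+ n.+1) / (1 - x).

Definition dotp (R : realType) (d : nat) (u v : 'cV[R]_d) : R :=
  \sum_i u i ord0 * v i ord0.

Definition norm1 (R : realType) (d : nat) (v : 'cV[R]_d) : R :=
  \sum_i `|v i ord0|.

(* The library norm on matrices is the sup norm. *)
Definition norm2 (R : realType) (d : nat) (v : 'cV[R]_d) : R :=
  Num.sqrt (\sum_i v i ord0 ^+ 2).

Definition td_error (R : realType) (S A : finType) (d : nat) (r : S -> A -> R)
    (gamma : R) (pi pib : S -> A -> R) (phi : S * A -> 'cV[R]_d)
    (x : nat -> S * A) (w : 'cV[R]_d) (i : nat) : R :=
  r (x i).1 (x i).2
  + gamma * is_ratio pi pib (x i.+1) * dotp (phi (x i.+1)) w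
  - dotp (phi (x i)) w.

Definition nstep_td_error (R : realType) (S A : finType) (d : nat)
    (r : S -> A -> R) (gamma : R) (pi pib : S -> A -> R)
    (phi : S * A -> 'cV[R]_d) (n : nat) (x : nat -> S * A) (w : 'cV[R]_d)
    (k : nat) : R :=
  \sum_(k <= i < k + n)
    gamma ^+ (i - k) * (\prod_(k.+1 <= j < i.+1) is_ratio pi pib (x j))
    * td_error r gamma pi pib phi x w i.

Fixpoint td_iter (R : realType) (S A : finType) (d : nat)
    (r : S -> A -> R) (gamma : R) (pi pib : S -> A -> R)
    (phi : S * A -> 'cV[R]_d) (n : nat) (alpha : nat -> R) (w0 : 'cV[R]_d)
    (x : nat -> S * A) (k : nat) : 'cV[R]_d :=
  if k is k'.+1 then
    let w := td_iter r gamma pi pib phi n alpha w0 x k' in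
    w + (alpha k' * nstep_td_error r gamma pi pib phi n x w k') *: phi (x k')
  else w0.

(* Main.v *)
Require Import Defs.
From HB Require Import structures.
From mathcomp Require Import all_boot all_order all_algebra.
From mathcomp Require Import all_classical all_reals all_analysis.
From mathcomp Require Import measurable_realfun ring lra zify.

Set Implicit Arguments.
Unset Strict Implicit.
Unset Printing Implicit Defensive.

Import Order.TTheory GRing.Theory Num.Theory.
Import numFieldNormedType.Exports.

Local Open Scope classical_set_scope.
Local Open Scope ring_scope.

(** All expectations are finite sums over histories, since the iterate at time
    [k] is a function of the first [k + n] state-action pairs.  Write the update
    of [x = w - wpi] as a rank-one step along the current feature vector, of
    scalar size [err], and let [g x] be the stationary mean of [<phi, x>^2]; the
    projected Bellman equation and the condition on [n] give a mean drift of at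
    most [-(1 - gammac) g x].

    The stepsize condition of part (i) does not involve the smallest eigenvalue
    [lam] of the Gram matrix, so the Markovian noise has to be bounded by [g],
    not by the squared norm.  For a function [Q] of the iterate and the window,
    the difference between its true mean and the mean with the window drawn from
    its stationary law is telescoped over all past updates; each increment is
    bounded, by AM-GM against the square root of the total variation distance,
    by second moments of [<phi, x>] along the chain.  These are themselves
    controlled by [g] plus an exponentially weighted memory [mem] of the past,
    and [|x|^2 + eta * mem] is a Lyapunov function that decreases at rate
    [(1 - gammac) lam].

    For part (ii) the squared norm is corrected by its pairing with the expected
    future noise up to a finite horizon, which makes it almost a supermartingale
    even when the stepsizes are not monotone; the maximal inequality, started at
    a time where the mean square is small, gives almost sure convergence. *)

(** The square root of the total variation is forced: [|L - kz|] has small mass but meets unbounded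
    slopes, whose squares are controlled in mean only under [L] and under [kz]. Against the size of
    the update it is bounded by its mass, against the slope by [L + kz], and the balance leaves one
    factor [om]. The estimates look circular, since comparing [<phi, x>^2] at a positive lag with
    [g] is itself a deviation bound. They close because the deviation at time [j] involves only
    times before [j], and [mem] re-enters with a factor [al]. No burn-in is waited for: the initial
    value of [mem] pays for the initial law. As to constants, the Lyapunov recursion produces a
    noise term [71] and the initial memory costs another [43], hence [114]; the threshold [456]
    keeps [32 + (71 * 16 + 70) / 456] below the [35] that the memory loses. In part (ii) the
    corrector weighs future noise with the stepsizes that will really be used, so no difference of
    consecutive stepsizes appears, and the horizon makes it a finite sum; the bounds must then be
    uniform in the horizon. *)

Section DotProduct.
Variables (R : realType) (d : nat).
Implicit Types u v w : 'cV[R]_d.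

Lemma dotpC u v : dotp u v = dotp v u.
Proof. by apply: eq_bigr => i _; rewrite mulrC. Qed.

Lemma dotpDr u v w : dotp u (v + w) = dotp u v + dotp u w.
Proof. by rewrite /dotp -big_split; apply: eq_bigr => i _; rewrite !mxE mulrDr. Qed.

Lemma dotpZr a u v : dotp u (a *: v) = a * dotp u v.
Proof. by rewrite /dotp mulr_sumr; apply: eq_bigr => i _; rewrite !mxE mulrCA. Qed.

Lemma dotpDl u v w : dotp (v + w) u = dotp v u + dotp w u.
Proof. by rewrite dotpC dotpDr !(dotpC u). Qed.

Lemma dotpZl a u v : dotp (a *: v) u = a * dotp v u.
Proof. by rewrite dotpC dotpZr (dotpC u). Qed.

Lemma dotp0r u : dotp u 0 = 0.
Proof. by rewrite /dotp big1 // => i _; rewrite mxE mulr0. Qed.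

Lemma dotpNr u v : dotp u (- v) = - dotp u v.
Proof. by rewrite -scaleN1r dotpZr mulN1r. Qed.

Lemma dotpNl u v : dotp (- v) u = - dotp v u.
Proof. by rewrite dotpC dotpNr (dotpC u). Qed.

Lemma dotpBr u v w : dotp u (v - w) = dotp u v - dotp u w.
Proof. by rewrite dotpDr dotpNr. Qed.

Lemma dotp_ge0 u : 0 <= dotp u u.
Proof. by apply: sumr_ge0 => i _; rewrite -expr2 sqr_ge0. Qed.

Lemma dotp_eq0 u : (dotp u u == 0) = (u == 0).
Proof.
apply/idP/eqP => [|->]; last by rewrite dotp0r.
rewrite psumr_eq0 => [/allP h|i _]; last by rewrite -expr2 sqr_ge0.
apply/matrixP => i j; rewrite mxE (ord1 j).
by have /eqP := h i (mem_index_enum i); rewrite -expr2 => /eqP; rewrite sqrf_eq0 => /eqP.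
Qed.

Lemma dotp_CS u v : dotp u v ^+ 2 <= dotp u u * dotp v v.
Proof.
have [v0|v0] := eqVneq v 0; first by rewrite v0 !dotp0r expr0n mulr0.
have vv : 0 < dotp v v by rewrite lt_def dotp_eq0 v0 dotp_ge0.
have := dotp_ge0 (dotp v v *: u - dotp u v *: v).
rewrite !(dotpDl, dotpDr, dotpNl, dotpNr, dotpZl, dotpZr) (dotpC v u) => h.
rewrite -subr_ge0 -(pmulr_rge0 _ vv); apply: le_trans h _.
by rewrite le_eqVlt; apply/orP; left; apply/eqP; ring.
Qed.

Lemma norm2_sqr u : norm2 u ^+ 2 = dotp u u.
Proof.
rewrite /norm2 sqr_sqrtr; last by apply: sumr_ge0 => i _; exact: sqr_ge0.
by apply: eq_bigr => i _; rewrite expr2.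
Qed.

Lemma norm2_ge0 u : 0 <= norm2 u.
Proof. exact: sqrtr_ge0. Qed.

Lemma dotp_norm2 u v : `|dotp u v| <= norm2 u * norm2 v.
Proof.
rewrite -(@ler_sqr _ `|_|) ?nnegrE ?mulr_ge0 ?norm2_ge0 //.
by rewrite real_normK ?num_real// exprMn !norm2_sqr dotp_CS.
Qed.

Lemma norm2D u v : norm2 (u + v) <= norm2 u + norm2 v.
Proof.
rewrite -ler_sqr ?nnegrE ?addr_ge0 ?norm2_ge0 //.
rewrite norm2_sqr sqrrD !norm2_sqr dotpDr !dotpDl (dotpC v u).
have := le_trans (ler_norm _) (dotp_norm2 u v).
rewrite mulr2n; set a := dotp u v; set b := _ * _; lra.
Qed.

Lemma norm2N u : norm2 (- u) = norm2 u.
Proof. by congr Num.sqrt; apply: eq_bigr => i _; rewrite mxE sqrrN. Qed.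

Lemma norm2_le1 u : norm1 u <= 1 -> norm2 u <= 1.
Proof.
move=> h1; rewrite -(@ler_sqr _ _ 1) ?nnegrE ?norm2_ge0 // expr1n norm2_sqr.
apply: (le_trans _ h1); apply: ler_sum => i _.
rewrite -expr2 -real_normK ?num_real // expr2 ler_piMl //.
apply: (le_trans _ h1); rewrite /norm1 (bigD1 i) //= lerDl; exact: sumr_ge0.
Qed.

Lemma dotp_le_norm2 u v : norm2 u <= 1 -> `|dotp u v| <= norm2 v.
Proof.
by move=> h; apply: le_trans (dotp_norm2 u v) _; rewrite ler_piMl ?norm2_ge0.
Qed.

End DotProduct.

(** * Conditional expectations along finite histories *)

Section HistoryExpectation.
Variables (R : realType) (X : finType) (K : seq X -> X -> R).

(* Histories are listed most recent letter first, and [K h] is the conditional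
   law of the next letter. *)
Definition cstep (G : seq X -> R) (h : seq X) : R := \sum_y K h y * G (y :: h).

Definition cexp (m : nat) (G : seq X -> R) (h : seq X) : R := iter m cstep G h.

Lemma cexp0 G h : cexp 0 G h = G h. Proof. by []. Qed.

Lemma cexpS m G h : cexp m.+1 G h = \sum_y K h y * cexp m G (y :: h).
Proof. by []. Qed.

Lemma cexpSr m G h : cexp m.+1 G h = cexp m (cstep G) h.
Proof. by rewrite /cexp iterSr. Qed.

Lemma cexp_add m1 m2 G h : cexp (m1 + m2) G h = cexp m1 (cexp m2 G) h.
Proof. by rewrite /cexp iterD. Qed.

Lemma eq_cexp m G1 G2 h :
  (forall p, size p = m -> G1 (p ++ h) = G2 (p ++ h)) ->
  cexp m G1 h = cexp m G2 h.
Proof.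
elim: m h => [|m IH] h H; first exact: (H [::]).
rewrite !cexpS; apply: eq_bigr => y _; congr (_ * _); apply: IH => p sp.
by rewrite -cat_rcons; apply: H; rewrite size_rcons sp.
Qed.

Lemma cexpZ m a G h : cexp m (fun h => a * G h) h = a * cexp m G h.
Proof.
elim: m h => // m IH h; rewrite !cexpS mulr_sumr.
by apply: eq_bigr => y _; rewrite IH mulrCA.
Qed.

Lemma cexpD m G1 G2 h :
  cexp m (fun h => G1 h + G2 h) h = cexp m G1 h + cexp m G2 h.
Proof.
elim: m h => // m IH h; rewrite !cexpS -big_split.
by apply: eq_bigr => y _; rewrite IH mulrDr.
Qed.

Lemma cexpB m G1 G2 h :
  cexp m (fun h => G1 h - G2 h) h = cexp m G1 h - cexp m G2 h.
Proof.
elim: m h => // m IH h; rewrite !cexpS -sumrB.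
by apply: eq_bigr => y _; rewrite IH mulrBr.
Qed.

Lemma cexp_sum (I : finType) m (G : I -> seq X -> R) h :
  cexp m (fun h => \sum_i G i h) h = \sum_i cexp m (G i) h.
Proof.
elim: m h => // m IH h; rewrite !cexpS exchange_big /=.
by apply: eq_bigr => y _; rewrite IH mulr_sumr.
Qed.

Definition cprob (Z : finType) (win : seq X -> Z) m h z : R :=
  cexp m (fun h' => (win h' == z)%:R) h.

Lemma cexp_win (Z : finType) (win : seq X -> Z) (g : Z -> R) m h :
  cexp m (fun h' => g (win h')) h = \sum_z cprob win m h z * g z.
Proof.
transitivity (cexp m (fun h' => \sum_z g z * (win h' == z)%:R) h).
  apply: eq_cexp => p _; rewrite (bigD1 (win (p ++ h))) //= eqxx mulr1.
  by rewrite big1 ?addr0 // => z /negbTE; rewrite eq_sym => ->; rewrite mulr0.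
by rewrite cexp_sum; apply: eq_bigr => z _; rewrite cexpZ mulrC.
Qed.

Hypothesis K_pmf : forall h, is_pmf (K h).

Lemma K_ge0 h y : 0 <= K h y. Proof. by case: (K_pmf h). Qed.

Lemma K_sum1 h : \sum_y K h y = 1. Proof. by case: (K_pmf h). Qed.

Lemma le_cexp m G1 G2 h :
  (forall p, size p = m -> G1 (p ++ h) <= G2 (p ++ h)) ->
  cexp m G1 h <= cexp m G2 h.
Proof.
elim: m h => [|m IH] h H; first exact: (H [::]).
rewrite !cexpS; apply: ler_sum => y _; rewrite ler_wpM2l ?K_ge0 //; apply: IH => p sp.
by rewrite -cat_rcons; apply: H; rewrite size_rcons sp.
Qed.

Lemma cexp_cst m a h : cexp m (fun=> a) h = a.
Proof.
elim: m h => // m IH h; rewrite cexpS -[RHS]mul1r -(K_sum1 h) mulr_suml.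
by apply: eq_bigr => y _; rewrite IH.
Qed.

Lemma cexp_ge0 m G h : (forall h, 0 <= G h) -> 0 <= cexp m G h.
Proof. by move=> G0; rewrite -(cexp_cst m 0 h); apply: le_cexp => p _. Qed.

Lemma cexp_norm m G h : `|cexp m G h| <= cexp m (fun h => `|G h|) h.
Proof.
rewrite ler_norml; apply/andP; split.
  rewrite -mulN1r -cexpZ; apply: le_cexp => p _; rewrite mulN1r.
  by rewrite lerNl -normrN ler_norm.
by apply: le_cexp => p _; rewrite ler_norm.
Qed.

Lemma cprob_ge0 (Z : finType) (win : seq X -> Z) m h z : 0 <= cprob win m h z.
Proof. by apply: cexp_ge0 => h'; rewrite ler0n. Qed.

Lemma cprob_sum1 (Z : finType) (win : seq X -> Z) m h : \sum_z cprob win m h z = 1.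
Proof.
have := cexp_win win (fun=> 1) m h; rewrite cexp_cst => ->.
by apply: eq_bigr => z _; rewrite mulr1.
Qed.

Lemma cprob_step (Z : finType) (win : seq X -> Z) m h z :
  cprob win m.+1 h z = \sum_y K h y * cprob win m (y :: h) z.
Proof. by []. Qed.

End HistoryExpectation.

(** * Pointwise estimates for one step of linear stochastic approximation *)

Section LinearStochasticApproximation.
Variables (R : realType) (d : nat) (Z : finType).
Variables (p0 pn : Z -> 'cV[R]_d) (cz xi : Z -> R) (kz : Z -> R) (f B : R).

(** The form that the n-step error takes after telescoping, with [x = w - wpi]: [p0] and [pn] are
    the features of the oldest and newest pair of the window, [cz] is the discounted product of
    ratios, and [xi] is the error at [wpi]. *)
Definition lsa_err (x : 'cV[R]_d) (z : Z) : R :=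
  cz z * dotp (pn z) x - dotp (p0 z) x + xi z.

Definition lsa_corr (x : 'cV[R]_d) (z : Z) : R := dotp (p0 z) x * lsa_err x z.

Definition sqdot (p : Z -> 'cV[R]_d) (x : 'cV[R]_d) (z : Z) : R := dotp (p z) x ^+ 2.

Definition seminorm2 (x : 'cV[R]_d) : R := \sum_z kz z * sqdot p0 x z.

Hypothesis kz_pmf : is_pmf kz.
Hypothesis p0_le1 : forall z, norm2 (p0 z) <= 1.
Hypothesis pn_le1 : forall z, norm2 (pn z) <= 1.
Hypothesis cz_ge0 : forall z, 0 <= cz z.
Hypothesis cz_le : forall z, 1 + cz z <= f.
Hypothesis xi_le : forall z, `|xi z| <= f * B.
Hypothesis B_ge0 : 0 <= B.
Hypothesis seminorm_pn : forall x, \sum_z kz z * sqdot pn x z = seminorm2 x.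

Let kz_ge0 z : 0 <= kz z. Proof. by case: kz_pmf. Qed.
Let kz_sum1 : \sum_z kz z = 1. Proof. by case: kz_pmf. Qed.

Lemma f_ge1 (z : Z) : 1 <= f.
Proof. by have := cz_ge0 z; have := cz_le z; lra. Qed.

(** Cauchy-Schwarz with weights [1], [cz z], [f] on the values [-u], [v], [y / f]; the total weight
    is at most [2 * f]. The identity in the proof is Lagrange's, whose defect terms are dropped.
    Keeping [p0] and [pn] apart matters because only their mean squares, not [norm2 x], may enter
    later. *)
Lemma lsa_err_sqr x z :
  lsa_err x z ^+ 2 <= 2 * f * (sqdot p0 x z + (f - 1) * sqdot pn x z + f * B ^+ 2).
Proof.
rewrite /lsa_err /sqdot; set u := dotp (p0 z) x; set v := dotp (pn z) x.
have f1 := f_ge1 z; have c0 := cz_ge0 z; have cf := cz_le z.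
have xB : xi z ^+ 2 <= (f * B) ^+ 2.
  by rewrite -real_normK ?num_real// ler_sqr ?nnegrE ?mulr_ge0 ?xi_le//; lra.
set c := cz z in c0 cf *; set y := xi z in xB *.
have f0 : f != 0 by apply/eqP; lra.
have -> : (c * v - u + y) ^+ 2 = (1 + c + f) * (u ^+ 2 + c * v ^+ 2 + y ^+ 2 / f)
   - (c * (u + v) ^+ 2 + f * (u + y / f) ^+ 2 + c * f * (v - y / f) ^+ 2).
  by field.
have h1 : 0 <= c * (u + v) ^+ 2 by rewrite mulr_ge0 ?sqr_ge0.
have h2 : 0 <= f * (u + y / f) ^+ 2 by rewrite mulr_ge0 ?sqr_ge0//; lra.
have h3 : 0 <= c * f * (v - y / f) ^+ 2 by rewrite mulr_ge0 ?sqr_ge0// mulr_ge0//; lra.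
have h4 : y ^+ 2 / f <= f * B ^+ 2.
  rewrite ler_pdivrMr; last lra.
  by apply: le_trans xB _; rewrite exprMn expr2 mulrAC.
have h5 : c * v ^+ 2 <= (f - 1) * v ^+ 2 by rewrite ler_wpM2r ?sqr_ge0//; lra.
have h6 : 0 <= u ^+ 2 + c * v ^+ 2 + y ^+ 2 / f.
  have a1 := sqr_ge0 u; have a2 : 0 <= c * v ^+ 2 by rewrite mulr_ge0 ?sqr_ge0.
  have : 0 <= y ^+ 2 / f by rewrite divr_ge0 ?sqr_ge0//; lra.
  lra.
have h7 : (1 + c + f) * (u ^+ 2 + c * v ^+ 2 + y ^+ 2 / f)
   <= (2 * f) * (u ^+ 2 + c * v ^+ 2 + y ^+ 2 / f) by rewrite ler_wpM2r//; lra.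
have h8 : (2 * f) * (u ^+ 2 + c * v ^+ 2 + y ^+ 2 / f)
   <= (2 * f) * (u ^+ 2 + (f - 1) * v ^+ 2 + f * B ^+ 2) by rewrite ler_wpM2l//; lra.
lra.
Qed.

Lemma lsa_err_norm x z : `|lsa_err x z| <= f * (norm2 x + B).
Proof.
have c0 := cz_ge0 z; have cf := cz_le z; have n0 := norm2_ge0 x.
rewrite /lsa_err; apply: le_trans (ler_normD _ _) _.
rewrite mulrDr lerD ?xi_le //; apply: le_trans (ler_normB _ _) _.
rewrite normrM (ger0_norm c0).
have := dotp_le_norm2 x (pn_le1 z); have := dotp_le_norm2 x (p0_le1 z).
set a := `|_|; set b := `|_| => ha hb.
have : cz z * b <= cz z * norm2 x by rewrite ler_wpM2l.
have : (1 + cz z) * norm2 x <= f * norm2 x by rewrite ler_wpM2r.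
lra.
Qed.

Lemma lsa_corr_norm x z : `|lsa_corr x z| <= norm2 x * (f * (norm2 x + B)).
Proof.
by rewrite normrM; apply: ler_pM => //; [exact: dotp_le_norm2|exact: lsa_err_norm].
Qed.

Lemma lsa_errD x t z' z :
  lsa_err (x + t *: p0 z') z =
  lsa_err x z + t * (cz z * dotp (pn z) (p0 z') - dotp (p0 z) (p0 z')).
Proof. by rewrite /lsa_err !dotpDr !dotpZr; ring. Qed.

Lemma dotp_le1 (u v : 'cV[R]_d) : norm2 u <= 1 -> norm2 v <= 1 -> `|dotp u v| <= 1.
Proof. by move=> hu hv; apply: le_trans (dotp_le_norm2 v hu) hv. Qed.

(** The update moves [x] along a vector of norm at most one, so the slope at [x] consists of scalars
    whose mean squares are comparable to the seminorm. No factor [norm2 x] appears, which keeps the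
    smallest eigenvalue out of the noise bound. *)
Lemma lsa_corr_incr x t z' z :
  `|lsa_corr (x + t *: p0 z') z - lsa_corr x z| <=
  `|t| * ((`|lsa_err x z| + f * `|dotp (p0 z) x|) + f * `|t|).
Proof.
rewrite /lsa_corr lsa_errD dotpDr dotpZr.
set u := dotp (p0 z) x; set p := dotp (p0 z) (p0 z'); set E := lsa_err x z.
set ze := (_ - p).
have hp : `|p| <= 1 by exact: dotp_le1.
have c0 := cz_ge0 z; have cf := cz_le z; have f1 := f_ge1 z.
have hz : `|ze| <= f.
  apply: le_trans (ler_normB _ _) _; rewrite normrM (ger0_norm c0).
  have h : `|dotp (pn z) (p0 z')| <= 1 by exact: dotp_le1.
  have : cz z * `|dotp (pn z) (p0 z')| <= cz z * 1 by rewrite ler_wpM2l.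
  lra.
have -> : (u + t * p) * (E + t * ze) - u * E = t * (p * E + u * ze + t * p * ze) by ring.
rewrite normrM ler_wpM2l //.
apply: le_trans (ler_normD _ _) _; rewrite lerD //; last first.
  by rewrite !normrM -mulrA [leRHS]mulrC ler_wpM2l // -[leRHS]mul1r ler_pM.
apply: le_trans (ler_normD _ _) _; rewrite !normrM lerD //.
  by rewrite -[leRHS]mul1r ler_wpM2r.
by rewrite mulrC ler_wpM2r.
Qed.

Lemma sqdot_incr (p : Z -> 'cV[R]_d) x t z' z : (forall z, norm2 (p z) <= 1) ->
  `|sqdot p (x + t *: p0 z') z - sqdot p x z| <=
  `|t| * (2 * `|dotp (p z) x| + `|t|).
Proof.
move=> p1; rewrite /sqdot dotpDr dotpZr.
set u := dotp (p z) x; set q := dotp (p z) (p0 z').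
have hp : `|q| <= 1 by exact: dotp_le1.
have -> : (u + t * q) ^+ 2 - u ^+ 2 = t * (q * (2 * u + t * q)) by ring.
rewrite normrM ler_wpM2l // normrM -[leRHS]mul1r ler_pM //.
apply: le_trans (ler_normD _ _) _; rewrite !normrM lerD //.
  by rewrite ger0_norm.
by rewrite -[leRHS]mulr1 ler_wpM2l.
Qed.

Lemma seminorm2_ge0 x : 0 <= seminorm2 x.
Proof. by apply: sumr_ge0 => z _; rewrite mulr_ge0 ?sqr_ge0. Qed.

(* AM-GM against the square root of the total variation: the mass [w] has
   total at most [2 om^2], yet the increment [ev] is only paid with [om],
   and its second factor is measured in mean square. *)
Lemma weighted_amgm (w b v : Z -> R) (om ev : R) :
  0 < om -> (forall z, 0 <= w z) -> (forall z, w z <= b z) ->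
  \sum_z w z <= 2 * om ^+ 2 -> 0 <= ev ->
  \sum_z w z * (ev * v z) <= om * (3 / 2 * ev ^+ 2 + 3^-1 * \sum_z b z * v z ^+ 2).
Proof.
move=> om0 w0 wb ws ev0.
have H z : w z * (ev * v z) <=
    3 / 4 * ev ^+ 2 / om * w z + 3^-1 * om * (b z * v z ^+ 2).
  have : ev * v z <= 3 / 4 * ev ^+ 2 / om + 3^-1 * om * v z ^+ 2.
    rewrite -subr_ge0.
    have -> : 3 / 4 * ev ^+ 2 / om + 3^-1 * om * v z ^+ 2 - ev * v z =
       3 / 4 / om * (ev - 2 / 3 * om * v z) ^+ 2 by field; rewrite gt_eqF.
    by rewrite mulr_ge0 ?sqr_ge0 // mulr_ge0 ?invr_ge0 ?ltW//; lra.
  move=> /(ler_wpM2l (w0 z)) /le_trans; apply.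
  rewrite mulrDr lerD //; first by rewrite mulrC.
  rewrite mulrCA; apply: ler_wpM2l; first by rewrite mulr_ge0 ?ltW.
  by rewrite ler_wpM2r ?sqr_ge0.
apply: le_trans (ler_sum _ (fun z _ => H z)) _.
rewrite big_split /= -!mulr_sumr.
have : 3 / 4 * ev ^+ 2 / om * \sum_z w z <= 3 / 4 * ev ^+ 2 / om * (2 * om ^+ 2).
  rewrite ler_wpM2l // divr_ge0 ?(ltW om0)// mulr_ge0 ?sqr_ge0//; lra.
have -> : 3 / 4 * ev ^+ 2 / om * (2 * om ^+ 2) = om * (3 / 2 * ev ^+ 2).
  by field; rewrite gt_eqF.
rewrite mulrDr; lra.
Qed.

End LinearStochasticApproximation.

(** * Finite-time mean-square bound for a constant stepsize *)

Section MeanSquareBound.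
Variables (R : realType) (X Z : finType) (K : seq X -> X -> R) (win : seq X -> Z).
Variables (d : nat) (p0 pn : Z -> 'cV[R]_d) (cz xi kz : Z -> R) (f B : R).
Variables (N : nat) (al : R) (x0 : 'cV[R]_d) (x : seq X -> 'cV[R]_d).
Variables (tau : nat) (om : nat -> R) (gc lam : R).

Let err := lsa_err p0 pn cz xi.
Let corr := lsa_corr p0 pn cz xi.
Let g := seminorm2 p0 kz.
Let L m h z := cprob K win m h z.

Hypothesis K_pmf : forall h, is_pmf (K h).
Hypothesis kz_pmf : is_pmf kz.
Hypothesis p0_le1 : forall z, norm2 (p0 z) <= 1.
Hypothesis pn_le1 : forall z, norm2 (pn z) <= 1.
Hypothesis cz_ge0 : forall z, 0 <= cz z.
Hypothesis cz_le : forall z, 1 + cz z <= f.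
Hypothesis xi_le : forall z, `|xi z| <= f * B.
Hypothesis B_ge1 : 1 <= B.
Hypothesis seminorm_pn : forall y, \sum_z kz z * sqdot pn y z = g y.
Hypothesis x_init : forall h, size h = N -> x h = x0.
Hypothesis x_step : forall y h, (N <= size h)%N ->
  x (y :: h) = x h + (al * err (x h) (win (y :: h))) *: p0 (win (y :: h)).
Hypothesis al_gt0 : 0 < al.
Hypothesis tau_ge2 : (2 <= tau)%N.

(** A geometric rate that loses at most half over [tau] steps, so that a halving of [om] per block
    of length [tau] fits under [2 * rho ^+ m]; [1 - rho] is also the rate at which [mem] forgets. *)
Let rho : R := 1 - (2 * tau%:R)^-1.

Hypothesis om_gt0 : forall m, 0 < om m.
Hypothesis om_le1 : forall m, om m <= 1.
Hypothesis om_rho : forall m, om m <= 2 * rho ^+ m.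
Hypothesis mixing : forall h m, (0 < size h)%N -> (0 < m)%N ->
  \sum_z `|L m h z - kz z| <= 2 * om m ^+ 2.
Hypothesis mixing_init : forall m,
  \sum_z `|L (N + m.+1) [::] z - kz z| <= 2 * om m ^+ 2.
Hypothesis gc_bnd : 0 < gc < 1.
Hypothesis drift : forall y, \sum_z kz z * corr y z <= - (1 - gc) * g y.
Hypothesis lam_gt0 : 0 < lam.
Hypothesis lam_le1 : lam <= 1.
Hypothesis lam_le : forall y, lam * norm2 y ^+ 2 <= g y.
Hypothesis step_small : al * tau%:R <= (1 - gc) / (456 * f ^+ 2).

Let B_ge0 : 0 <= B. Proof. exact: le_trans B_ge1. Qed.
Let kz_ge0 z : 0 <= kz z. Proof. by case: kz_pmf. Qed.
Let kz_sum1 : \sum_z kz z = 1. Proof. by case: kz_pmf. Qed.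
Let L_ge0 m h z : 0 <= L m h z. Proof. exact: cprob_ge0. Qed.
Let L_sum1 m h : \sum_z L m h z = 1. Proof. exact: cprob_sum1. Qed.
Let f_ge1 : 1 <= f. Proof. exact: (f_ge1 cz_ge0 cz_le (win [::])). Qed.
Let f_ge0 : 0 <= f. Proof. exact: le_trans f_ge1. Qed.

Let EN j (G : seq X -> R) : R := cexp K (N + j) G [::].
(** The iterate after [j] updates meets the window seen [m] letters later; lag [1] is the window
    that the next update uses. [S] below replaces that window by an independent stationary one. *)
Let T j m (Q : 'cV[R]_d -> Z -> R) : R :=
  EN j (fun h => \sum_z L m h z * Q (x h) z).
Let S j (Q : 'cV[R]_d -> Z -> R) : R :=
  EN j (fun h => \sum_z kz z * Q (x h) z).

Let ENS j G : EN j.+1 G = EN j (cstep K G).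
Proof. by rewrite /EN addnS cexpSr. Qed.

Let le_EN j G1 G2 : (forall h, size h = (N + j)%N -> G1 h <= G2 h) ->
  EN j G1 <= EN j G2.
Proof. by move=> H; apply: le_cexp => // p sp; rewrite cats0 H. Qed.

Let eq_EN j G1 G2 : (forall h, size h = (N + j)%N -> G1 h = G2 h) ->
  EN j G1 = EN j G2.
Proof. by move=> H; apply: eq_cexp => // p sp; rewrite cats0 H. Qed.

Let T_sub_S j m Q :
  T j m Q - S j Q = EN j (fun h => \sum_z (L m h z - kz z) * Q (x h) z).
Proof.
rewrite /T /S /EN -cexpB; apply: eq_cexp => p _.
by rewrite -sumrB; apply: eq_bigr => z _; rewrite mulrBl.
Qed.

Let T_step j m Q :
  T j m.+1 Q = EN j.+1 (fun h => \sum_z L m h z * Q (x (behead h)) z).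
Proof.
rewrite ENS; apply: eq_EN => h _; rewrite /cstep /behead.
under eq_bigr do rewrite /L cprob_step mulr_suml.
rewrite exchange_big /=; apply: eq_bigr => y _.
by rewrite mulr_sumr; apply: eq_bigr => z _; rewrite mulrA.
Qed.

Let T1 j Q : T j 1 Q = EN j.+1 (fun h => Q (x (behead h)) (win h)).
Proof.
rewrite ENS; apply: eq_EN => h _.
transitivity (cexp K 1 (fun h' => Q (x h) (win h')) h); last by [].
by rewrite (cexp_win _ win (Q (x h))).
Qed.

Let S_step j Q : S j Q = EN j.+1 (fun h => \sum_z kz z * Q (x (behead h)) z).
Proof.
rewrite ENS; apply: eq_EN => h _; rewrite /cstep /= -mulr_suml.
by rewrite K_sum1 ?mul1r.
Qed.

(** One update is traded for one unit of lag: both [T] terms look at the same future window and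
    differ only in the iterate, so a single increment of [Q] pays for the exchange. *)
Let deviation_step j m Q :
  (T j.+1 m Q - S j.+1 Q) - (T j m.+1 Q - S j Q) =
  EN j.+1 (fun h => \sum_z (L m h z - kz z) * (Q (x h) z - Q (x (behead h)) z)).
Proof.
rewrite T_sub_S T_step S_step /EN -!cexpB; apply: eq_cexp => p _.
rewrite -!sumrB; apply: eq_bigr => z _; ring.
Qed.

(* The initial value lets the same deviation bound also absorb the distance of
   the initial law to stationarity. *)
Fixpoint mem (j : nat) : R :=
  if j is i.+1 then
    rho * (mem i + (EN i (fun h => g (x h)) + 16 * al * f ^+ 2 * mem i + B ^+ 2))
  else norm2 x0 * (norm2 x0 + B) / (4 * al * f).

Let gm j : R := EN j (fun h => g (x h)).
Let mass j : R := gm j + 16 * al * f ^+ 2 * mem j + B ^+ 2.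

Let memS j : mem j.+1 = rho * (mem j + mass j). Proof. by []. Qed.

Let tau_gt0 : 0 < tau%:R :> R. Proof. by rewrite ltr0n; apply: leq_trans tau_ge2. Qed.

Let rho_bnd : 0 <= rho <= 1.
Proof.
have tau2 : (2 : R) <= tau%:R by rewrite ler_nat.
have : (2 * tau%:R)^-1 <= (1 : R) by rewrite invf_le1; lra.
have : 0 <= (2 * tau%:R : R)^-1 by rewrite invr_ge0 mulr_ge0 ?ltW.
rewrite /rho; lra.
Qed.

Let gm_ge0 j : 0 <= gm j.
Proof. by apply: cexp_ge0 => // h; exact: seminorm2_ge0. Qed.

Let mem_ge0 j : 0 <= mem j.
Proof.
have a0 := ltW al_gt0; have n0 := norm2_ge0 x0.
elim: j => [|j IH].
  by apply: divr_ge0; rewrite !mulr_ge0 ?addr_ge0.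
case/andP: rho_bnd => r0 _; rewrite memS mulr_ge0 // addr_ge0 // /mass.
by rewrite !addr_ge0 ?sqr_ge0 // !mulr_ge0 ?exprn_ge0.
Qed.

Let al_small : al * tau%:R * f ^+ 2 <= (1 - gc) / 456.
Proof.
have f0 : 0 < f ^+ 2 by rewrite exprn_gt0 // (lt_le_trans _ f_ge1).
move: step_small; rewrite invfM mulrA ler_pdivlMr //.
Qed.

Let alf : al * f <= 4^-1.
Proof.
have tau2 : (2 : R) <= tau%:R by rewrite ler_nat.
have a0 := ltW al_gt0.
have h1 : al * f <= al * f * f.
  by rewrite ler_peMr // mulr_ge0.
have h2 : al * f * f * 2 <= al * f * f * tau%:R.
  by rewrite ler_wpM2l // !mulr_ge0.
case/andP: gc_bnd => g0 g1; have := al_small; lra.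
Qed.

Let mass_ge0 j : 0 <= mass j.
Proof.
have a0 := ltW al_gt0.
by rewrite /mass !addr_ge0 ?sqr_ge0 // !mulr_ge0 ?exprn_ge0.
Qed.

Section Deviation.
Variables (Q v : 'cV[R]_d -> Z -> R) (b : R).
Hypothesis Q_incr : forall y t z' z,
  `|Q (y + t *: p0 z') z - Q y z| <= `|t| * (v y z + b * `|t|).
Hypothesis b_le : b <= f.

(** The constant is [8 = 2 * 2 + (6 + 6) / 3]. The squared error has coefficient [2]: [3 / 2] from
    the AM-GM step and [1 / 2] from the quadratic part of the increment, where [b * al <= 4^-1] and
    the mass is at most [2 * om m]. *)
Let deviation_incr j m : (0 < m)%N ->
  T j 1 (fun y z => err y z ^+ 2) <= 2 * f ^+ 2 * mass j ->
  T j m.+1 (fun y z => v y z ^+ 2) <= 6 * f ^+ 2 * mass j ->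
  S j (fun y z => v y z ^+ 2) <= 6 * f ^+ 2 * mass j ->
  `|(T j.+1 m Q - S j.+1 Q) - (T j m.+1 Q - S j Q)| <=
  8 * al * f ^+ 2 * om m * mass j.
Proof.
move=> m0 he hT hS; rewrite deviation_step.
apply: le_trans (cexp_norm _ _ _ _) _ => //.
have o0 := om_gt0 m; have o1 := om_le1 m; have a0 := al_gt0.
pose e2 h : R := err (x (behead h)) (win h) ^+ 2.
pose vL h : R := \sum_z L m h z * v (x (behead h)) z ^+ 2.
pose vk h : R := \sum_z kz z * v (x (behead h)) z ^+ 2.
apply: le_trans (_ : EN j.+1 (fun h => al * om m *
   (2 * e2 h + (3^-1 * vL h + 3^-1 * vk h))) <= _); last first.
  rewrite /EN cexpZ !cexpD !cexpZ.
  move: he hT hS; rewrite T1 T_step S_step => he hT hS.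
  have -> : 8 * al * f ^+ 2 * om m * mass j = al * om m * (8 * f ^+ 2 * mass j).
    by ring.
  rewrite ler_wpM2l ?mulr_ge0 ?(ltW a0) ?(ltW o0) //.
  have he' : EN j.+1 e2 <= 2 * f ^+ 2 * mass j by [].
  have hT' : EN j.+1 vL <= 6 * f ^+ 2 * mass j by [].
  have hS' : EN j.+1 vk <= 6 * f ^+ 2 * mass j by [].
  change (2 * EN j.+1 e2 + (3^-1 * EN j.+1 vL + 3^-1 * EN j.+1 vk)
    <= 8 * f ^+ 2 * mass j); lra.
apply: le_EN => -[|y h]; first by rewrite addnS.
rewrite addnS => -[sh]; rewrite /e2 /vL /vk /=.
set e := err (x h) (win (y :: h)).
have xE : x (y :: h) = x h + (al * e) *: p0 (win (y :: h)).
  by rewrite x_step // sh leq_addr.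
set w := fun z => `|L m (y :: h) z - kz z|.
have w0 z : 0 <= w z by rewrite /w.
have wb z : w z <= L m (y :: h) z + kz z.
  by rewrite /w (le_trans (ler_normB _ _)) // !ger0_norm.
have ws : \sum_z w z <= 2 * om m ^+ 2 by exact: mixing.
apply: le_trans (ler_norm_sum _ _ _) _.
have H1 : \sum_z `|(L m (y :: h) z - kz z) * (Q (x (y :: h)) z - Q (x h) z)| <=
   \sum_z (al * (w z * (`|e| * v (x h) z)) + al * (b * al * `|e| ^+ 2) * w z).
  apply: ler_sum => z _; rewrite normrM -/(w z) xE.
  apply: le_trans (ler_wpM2l (w0 z) (Q_incr _ _ _ _)) _.
  rewrite normrM (gtr0_norm a0); rewrite le_eqVlt; apply/orP; left; apply/eqP; ring.
apply: le_trans H1 _; rewrite big_split /= -!mulr_sumr.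
have H2 := @weighted_amgm R Z w _ (v (x h)) (om m) `|e| o0 w0 wb ws (normr_ge0 _).
have eE : `|e| ^+ 2 = e ^+ 2 by rewrite real_normK ?num_real.
rewrite eE in H2 *.
have e0 : 0 <= e ^+ 2 by exact: sqr_ge0.
have H3 : b * al * e ^+ 2 * \sum_z w z <= 2^-1 * om m * e ^+ 2.
  have : \sum_z w z <= 2 * om m.
    by apply: le_trans ws _; rewrite ler_wpM2l // expr2 ler_piMl // ltW.
  move=> ws'; have W0 : 0 <= \sum_z w z by apply: sumr_ge0.
  have ba : b * al <= 4^-1.
    by apply: le_trans alf; rewrite mulrC ler_wpM2l // ltW.
  apply: le_trans (_ : 4^-1 * e ^+ 2 * \sum_z w z <= _).
    by rewrite ler_wpM2r // ler_wpM2r.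
  apply: le_trans (_ : 4^-1 * e ^+ 2 * (2 * om m) <= _).
    by rewrite ler_wpM2l // mulr_ge0.
  by rewrite le_eqVlt; apply/orP; left; apply/eqP; field.
have H4 := ler_wpM2l (ltW a0) (lerD H2 H3).
apply: le_trans (le_trans _ H4) _.
  by rewrite le_eqVlt; apply/orP; left; apply/eqP; ring.
rewrite -[leRHS]mulrA ler_wpM2l ?(ltW a0) //.
have -> : \sum_i (L m (y :: h) i + kz i) * v (x h) i ^+ 2 =
   \sum_z L m (y :: h) z * v (x h) z ^+ 2 + \sum_z kz z * v (x h) z ^+ 2.
  by rewrite -big_split; apply: eq_bigr => z _; rewrite mulrDl.
by rewrite le_eqVlt; apply/orP; left; apply/eqP; field.
Qed.

(** Going back one step raises the lag by one, hence gains a factor [rho], and adds one mass at rate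
    [om m <= 2 * rho ^+ m]; this is the recursion that defines [mem]. The second-moment premises
    concern only [i < j], which allows the bound to be used inside a strong induction on [j]. *)
Lemma deviation_bound j :
  (forall m, (0 < m)%N -> `|T 0 m Q - S 0 Q| <= 16 * al * f ^+ 2 * rho ^+ m.-1 * mem 0) ->
  (forall i, (i < j)%N -> [/\ T i 1 (fun y z => err y z ^+ 2) <= 2 * f ^+ 2 * mass i,
     (forall m, T i m.+1 (fun y z => v y z ^+ 2) <= 6 * f ^+ 2 * mass i) &
     S i (fun y z => v y z ^+ 2) <= 6 * f ^+ 2 * mass i]) ->
  forall m, (0 < m)%N ->
    `|T j m Q - S j Q| <= 16 * al * f ^+ 2 * rho ^+ m.-1 * mem j.
Proof.
move=> H0; elim: j => [|j IH] H m m0; first exact: H0.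
have [he hT hS] := H j (ltnSn j).
have I1 := deviation_incr m0 he (hT m) hS.
have I2 := IH (fun i ij => H i (ltnW ij)) m.+1 isT.
set t1 := T j.+1 m Q - _ in I1 *; set t2 := T j m.+1 Q - _ in I1 I2.
have -> : t1 = (t1 - t2) + t2 by ring.
apply: le_trans (ler_normD _ _) _.
apply: le_trans (lerD I1 I2) _.
rewrite memS /=.
have I3 : 8 * al * f ^+ 2 * om m * mass j <= 8 * al * f ^+ 2 * (2 * rho ^+ m) * mass j.
  rewrite ler_wpM2r // ler_wpM2l // mulr_ge0 ?sqr_ge0 // mulr_ge0 ?(ltW al_gt0)//.
apply: le_trans (lerD I3 (lexx _)) _.
have -> : rho ^+ m = rho * rho ^+ m.-1 by rewrite -exprS prednK.
rewrite le_eqVlt; apply/orP; left; apply/eqP; ring.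
Qed.

End Deviation.
Let moment j : R := gm j + 16 * al * f ^+ 2 * mem j.

Let moment_le_mass j : moment j <= mass j.
Proof. by rewrite /mass lerDl sqr_ge0. Qed.

Let gm_le_moment j : gm j <= moment j.
Proof.
have a0 := ltW al_gt0.
by rewrite /moment lerDl !mulr_ge0 ?exprn_ge0.
Qed.

Section Moments.
Variables (j : nat) (u : seq X -> Z -> R).
Hypothesis u_ge0 : forall h z, 0 <= u h z.
Hypothesis u_sum1 : forall h, \sum_z u h z = 1.

(** The weight [u] stands both for the law of the window at a given lag and for the constant [kz],
    so each moment estimate serves [T] and [S] at once. *)
Let A (Q : 'cV[R]_d -> Z -> R) : R := EN j (fun h => \sum_z u h z * Q (x h) z).

Hypothesis A_p0 : A (sqdot p0) <= moment j.
Hypothesis A_pn : A (sqdot pn) <= moment j.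

Let le_A Q1 Q2 : (forall y z, Q1 y z <= Q2 y z) -> A Q1 <= A Q2.
Proof.
by move=> H; apply: le_EN => h _; apply: ler_sum => z _; rewrite ler_wpM2l.
Qed.

Let A_lin a1 a2 Q1 Q2 :
  A (fun y z => a1 * Q1 y z + a2 * Q2 y z) = a1 * A Q1 + a2 * A Q2.
Proof.
rewrite /A /EN -!cexpZ -cexpD; apply: eq_cexp => h _.
by rewrite !mulr_sumr -big_split; apply: eq_bigr => z _; rewrite /=; ring.
Qed.

Let A_cst a : A (fun _ _ => a) = a.
Proof.
rewrite -[RHS](cexp_cst K_pmf (N + j) a [::]); apply: eq_cexp => h _.
by rewrite -mulr_suml u_sum1 mul1r.
Qed.

Let f2_ge1 : 1 <= f ^+ 2. Proof. exact: exprn_ege1. Qed.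

Lemma mean_err2 : A (fun y z => err y z ^+ 2) <= 2 * f ^+ 2 * mass j.
Proof.
have f1 := f_ge1.
apply: le_trans (le_A (lsa_err_sqr p0 pn cz_ge0 cz_le xi_le B_ge0)) _.
apply: le_trans (_ : A (fun y z => 2 * f * (1 * sqdot p0 y z +
   (f - 1) * sqdot pn y z) + 1 * (2 * f * (f * B ^+ 2))) <= _).
  by apply: le_A => y z; rewrite !mul1r; lra.
have -> : A (fun y z => 2 * f * (1 * sqdot p0 y z +
    (f - 1) * sqdot pn y z) + 1 * (2 * f * (f * B ^+ 2))) =
    2 * f * (1 * A (sqdot p0) + (f - 1) * A (sqdot pn)) + 1 * (2 * f * (f * B ^+ 2)).
  by rewrite A_lin A_lin A_cst.
have : (f - 1) * A (sqdot pn) <= (f - 1) * moment j by rewrite ler_wpM2l //; lra.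
move=> h; have h2 : 2 * f * (1 * A (sqdot p0) + (f - 1) * A (sqdot pn))
   <= 2 * f * (f * moment j).
  apply: ler_wpM2l; first by rewrite mulr_ge0.
  move: A_p0 h; move: (A (sqdot p0)) (A (sqdot pn)) (moment j) => a1 a2 a3. lra.
rewrite /mass -/(moment j); lra.
Qed.

Lemma mean_sqdot_slope p : A (sqdot p) <= moment j ->
  A (fun y z => (2 * `|dotp (p z) y|) ^+ 2) <= 6 * f ^+ 2 * mass j.
Proof.
move=> Hp; apply: le_trans (_ : A (fun y z => 4 * sqdot p y z + 0 * sqdot p y z) <= _).
  by apply: le_A => y z; rewrite exprMn real_normK ?num_real// /sqdot; lra.
have -> : A (fun y z => 4 * sqdot p y z + 0 * sqdot p y z) =
  4 * A (sqdot p) + 0 * A (sqdot p) by exact: A_lin.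
have := moment_le_mass j; have := mass_ge0 j.
move=> m0 h; have : 1 * mass j <= f ^+ 2 * mass j by rewrite ler_wpM2r.
lra.
Qed.

(** The origin of the constant [6]: twice the [2] of [mean_err2], plus [2] for the squared feature
    term. *)
Lemma mean_corr_slope :
  A (fun y z => (`|err y z| + f * `|dotp (p0 z) y|) ^+ 2) <= 6 * f ^+ 2 * mass j.
Proof.
apply: le_trans (_ : A (fun y z => 2 * err y z ^+ 2 + (2 * f ^+ 2) * sqdot p0 y z) <= _).
  apply: le_A => y z; rewrite -(real_normK (num_real (err y z))) /sqdot.
  rewrite -(real_normK (num_real (dotp _ _))); set a := `|_|; set b := `|_|.
  have := sqr_ge0 (a - f * b); lra.
have -> : A (fun y z => 2 * err y z ^+ 2 + (2 * f ^+ 2) * sqdot p0 y z) =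
  2 * A (fun y z => err y z ^+ 2) + (2 * f ^+ 2) * A (sqdot p0) by exact: A_lin.
have := mean_err2; have : f ^+ 2 * A (sqdot p0) <= f ^+ 2 * mass j.
  by rewrite ler_wpM2l ?exprn_ge0 // (le_trans A_p0).
lra.
Qed.

End Moments.

Let S_p0 j : S j (sqdot p0) = gm j. Proof. by []. Qed.

Let S_pn j : S j (sqdot pn) = gm j.
Proof. by apply: eq_EN => h _; exact: seminorm_pn. Qed.

(** Before any update the iterate is the constant [x0], so only the law of the window deviates, by
    at most [4 * rho ^+ m.-1] in mass. The denominator [4 * al * f] in [mem 0] is chosen to turn
    [16 * al * f ^+ 2] into this [4 * f]. *)
Let deviation_init Q m : (0 < m)%N ->
  (forall z, `|Q x0 z| <= f * (norm2 x0 * (norm2 x0 + B))) ->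
  `|T 0 m Q - S 0 Q| <= 16 * al * f ^+ 2 * rho ^+ m.-1 * mem 0.
Proof.
case: m => // m _ HQ.
have -> : T 0 m.+1 Q - S 0 Q = \sum_z (L (N + m.+1) [::] z - kz z) * Q x0 z.
  rewrite T_sub_S /L /cprob; under [RHS]eq_bigr do rewrite cexp_add mulrC.
  under [RHS]eq_bigr do rewrite mulrBr -cexpZ -{1}[Q x0 _ * kz _]
    (cexp_cst K_pmf N _ [::]) -cexpB.
  rewrite -cexp_sum /EN addn0; apply: eq_cexp => p sp; rewrite cats0 x_init //.
  by apply: eq_bigr => z _; ring.
apply: le_trans (ler_norm_sum _ _ _) _.
have n0 := norm2_ge0 x0; have o0 := om_gt0 m; have o1 := om_le1 m.
set q := f * _ in HQ.
have q0 : 0 <= q by rewrite !mulr_ge0 ?addr_ge0 // (le_trans _ f_ge1).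
apply: le_trans (_ : \sum_z `|L (N + m.+1) [::] z - kz z| * q <= _).
  by apply: ler_sum => z _; rewrite normrM ler_wpM2l.
rewrite -mulr_suml; apply: le_trans (ler_wpM2r q0 (mixing_init m)) _.
have oo : om m ^+ 2 <= om m by rewrite expr2 ler_piMl // ltW.
have h : 2 * om m ^+ 2 <= 4 * rho ^+ m by have := om_rho m; lra.
apply: le_trans (ler_wpM2r q0 h) _.
rewrite le_eqVlt; apply/orP; left; apply/eqP; rewrite /q /=; field.
by rewrite !gt_eqF // (lt_le_trans _ f_ge1).
Qed.

Let sqdot_bound (p : Z -> 'cV[R]_d) z : (forall z, norm2 (p z) <= 1) ->
  `|sqdot p x0 z| <= f * (norm2 x0 * (norm2 x0 + B)).
Proof.
move=> p1; have n0 := norm2_ge0 x0; rewrite ger0_norm ?sqr_ge0 //.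
apply: le_trans (_ : norm2 x0 * norm2 x0 <= _).
  rewrite /sqdot -real_normK ?num_real// expr2; have := dotp_le_norm2 x0 (p1 z).
  by move=> h; exact: ler_pM.
rewrite -[leLHS]mul1r; apply: ler_pM; rewrite ?mulr_ge0 //.
by apply: ler_wpM2l; rewrite ?lerDl.
Qed.

(** Strong induction on time, at all positive lags simultaneously: the deviation bound for [sqdot]
    at time [j] needs the same second moments at earlier times, at lag [1] for the error and at lag
    [m.+1] for the slope. *)
Let second_moment j m : (0 < m)%N ->
  T j m (sqdot p0) <= moment j /\ T j m (sqdot pn) <= moment j.
Proof.
elim/ltn_ind: j m => j IH m m0.
have r01 := rho_bnd; have r0 : 0 <= rho by case/andP: r01.
have r1 : rho <= 1 by case/andP: r01.
suff H (p : Z -> 'cV[R]_d) : (forall z, norm2 (p z) <= 1) -> (forall i, S i (sqdot p) = gm i) ->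
    (forall i, (i < j)%N -> forall m, (0 < m)%N -> T i m (sqdot p) <= moment i) ->
    T j m (sqdot p) <= moment j.
  split; apply: H => //.
  - by move=> i ij m' m'0; case: (IH i ij m' m'0).
  - by move=> i ij m' m'0; case: (IH i ij m' m'0).
move=> p1 Sp IHp.
have D : `|T j m (sqdot p) - S j (sqdot p)| <= 16 * al * f ^+ 2 * rho ^+ m.-1 * mem j.
  apply: (@deviation_bound (sqdot p) (fun y z => 2 * `|dotp (p z) y|) 1) => //.
  - by move=> y t z' z; rewrite mul1r; exact: sqdot_incr.
  - by move=> m' m'0; apply: deviation_init => // z; exact: sqdot_bound.
  move=> i ij; split.
  - by have [h1 h2] := IH i ij 1 isT; apply: mean_err2.
  - by move=> m'; apply: mean_sqdot_slope => //; exact: IHp.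
  - by apply: (@mean_sqdot_slope i (fun _ => kz)) => //; rewrite -/(S _ _) Sp.
have a0 := ltW al_gt0.
have : 16 * al * f ^+ 2 * rho ^+ m.-1 * mem j <= 16 * al * f ^+ 2 * 1 * mem j.
  by rewrite ler_wpM2r // ler_wpM2l ?exprn_ile1 // !mulr_ge0 ?exprn_ge0.
move: D; rewrite Sp /moment => D h.
have := le_trans (ler_norm _) D; lra.
Qed.

Let corr_bound j : T j 1 corr <= - (1 - gc) * gm j + 16 * al * f ^+ 2 * mem j.
Proof.
have D : `|T j 1 corr - S j corr| <= 16 * al * f ^+ 2 * rho ^+ 1.-1 * mem j.
  apply: (@deviation_bound corr
    (fun y z => `|err y z| + f * `|dotp (p0 z) y|) f) => //.
  - by move=> y t z' z; exact: (lsa_corr_incr xi p0_le1 pn_le1 cz_ge0 cz_le).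
  - move=> m m0; apply: deviation_init => // z.
    rewrite mulrCA; exact: (lsa_corr_norm p0_le1 pn_le1 cz_ge0 cz_le xi_le).
  move=> i ij; split.
  - by have [h1 h2] := second_moment i (isT : (0 < 1)%N); apply: mean_err2.
  - by move=> m; have [h1 h2] := second_moment i (isT : (0 < m.+1)%N);
      apply: mean_corr_slope.
  - by apply: (@mean_corr_slope i (fun _ => kz)) => //;
      rewrite -/(S _ _) ?S_p0 ?S_pn.
have Sb : S j corr <= - (1 - gc) * gm j.
  by rewrite /gm /EN -cexpZ; apply: le_EN => h _; exact: drift.
move: D; rewrite expr0 mulr1 => D; have := le_trans (ler_norm _) D; lra.
Qed.

Let msq j : R := EN j (fun h => norm2 (x h) ^+ 2).

Let msq_step j : msq j.+1 <=
  msq j + 2 * al * T j 1 corr + al ^+ 2 * T j 1 (fun y z => err y z ^+ 2).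
Proof.
rewrite !T1 /msq.
have -> : EN j (fun h => norm2 (x h) ^+ 2) = S j (fun y _ => norm2 y ^+ 2).
  by apply: eq_EN => h _; rewrite -mulr_suml kz_sum1 mul1r.
rewrite S_step /EN -!cexpZ -!cexpD; apply: le_EN => -[|y h]; first by rewrite addnS.
rewrite addnS => -[sh] /=; rewrite -mulr_suml kz_sum1 mul1r.
rewrite x_step ?sh ?leq_addr // !norm2_sqr.
set w := win _; set e := err _ _.
rewrite dotpDl !dotpDr !dotpZl !dotpZr (dotpC _ (p0 w)).
rewrite /corr /lsa_corr -/err -/e.
have e0 : 0 <= (al * e) ^+ 2 by exact: sqr_ge0.
have : (al * e) ^+ 2 * dotp (p0 w) (p0 w) <= (al * e) ^+ 2 * 1.
  by rewrite ler_wpM2l // -norm2_sqr expr_le1 ?norm2_ge0.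
lra.
Qed.

(* The memory loses [eta * mem / (2 * tau) = 35 * al^2 * f^2 * mem] per step,
   which has to outweigh the [32 * al^2 * f^2 * mem] brought in by [corr_bound]. *)
Let eta : R := 70 * al ^+ 2 * f ^+ 2 * tau%:R.

(** Budget in units of [al ^+ 2 * f ^+ 2]. Since [tau >= 2], the squared update costs one
    [tau * mass], which with the [70] of [eta] gives [71]. Its [gm] part is [71 / 456] of
    [al * (1 - gc) * gm], so of the two copies supplied by the drift one remains for [lam * msq].
    For [mem], the costs [32], [71 * 16 / 456] and [70 / 456] stay below the loss [35]. *)
Let lyapunov_step j : msq j.+1 + eta * mem j.+1 <=
  (1 - (1 - gc) * lam * al) * (msq j + eta * mem j) +
  71 * al ^+ 2 * f ^+ 2 * tau%:R * B ^+ 2.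
Proof.
case/andP: gc_bnd => gc0 gc1.
have a0 := al_gt0; have f1 := f_ge1; have t0 := tau_gt0.
have a0' := ltW a0; have t0' := ltW t0.
have m0 := mem_ge0 j; have M0 := mass_ge0 j; have g0 := gm_ge0 j.
have tau2 : (2 : R) <= tau%:R by rewrite ler_nat.
have f21 : 1 <= f ^+ 2 by exact: exprn_ege1.
have as_ := al_small.
have c1 := corr_bound j; have s1 := msq_step j.
have e1 : T j 1 (fun y z => err y z ^+ 2) <= 2 * f ^+ 2 * mass j.
  by have [h1 h2] := second_moment j (isT : (0 < 1)%N); apply: mean_err2.
have lg : lam * msq j <= gm j.
  by rewrite /msq /gm /EN -cexpZ; apply: le_EN => h _; exact: lam_le.
have e2 := ler_wpM2l (sqr_ge0 al) e1.
have c2 : 2 * al * T j 1 corr <=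
    2 * al * (- (1 - gc) * gm j + 16 * al * f ^+ 2 * mem j).
  by rewrite ler_wpM2l // mulr_ge0 ?(ltW a0).
have rE : rho * (mem j + mass j) <= mem j - mem j / (2 * tau%:R) + mass j.
  have r1 : rho <= 1 by case/andP: rho_bnd.
  move: (ler_wpM2r M0 r1); rewrite /rho; move: (mem j) (mass j) (_^-1) => m M r; lra.
set P := al ^+ 2 * f ^+ 2.
have P0 : 0 <= P by rewrite mulr_ge0 ?sqr_ge0.
have et0 : 0 <= eta by rewrite /eta !mulr_ge0 ?exprn_ge0.
have etE : eta * (mem j - mem j / (2 * tau%:R) + mass j) =
    eta * mem j - 35 * P * mem j + 70 * P * tau%:R * mass j.
  by rewrite /eta /P; field; rewrite gt_eqF.
have r2 := ler_wpM2l et0 rE; rewrite etE in r2.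
have P2 : 2 * P * mass j <= P * tau%:R * mass j.
  by rewrite ler_wpM2r // mulrC ler_wpM2l.
have PtE : P * tau%:R <= al * ((1 - gc) / 456).
  have -> : P * tau%:R = al * (al * tau%:R * f ^+ 2) by rewrite /P; ring.
  by rewrite ler_wpM2l ?(ltW a0).
have q1 : P * tau%:R * gm j <= al * ((1 - gc) / 456) * gm j by rewrite ler_wpM2r.
have agm0 : 0 <= al * (1 - gc) * gm j.
  by rewrite !mulr_ge0 ?(ltW a0)//; lra.
have q2 : P * tau%:R * (16 * al * f ^+ 2 * mem j) <= P * 16 / 456 * mem j.
  have -> : P * tau%:R * (16 * al * f ^+ 2 * mem j) =
     (P * mem j) * 16 * (al * tau%:R * f ^+ 2) by ring.
  have : P * mem j * 16 * (al * tau%:R * f ^+ 2) <= P * mem j * 16 * 456^-1.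
    by rewrite ler_wpM2l ?mulr_ge0//; lra.
  lra.
have q3 : al * (1 - gc) * (lam * msq j) <= al * (1 - gc) * gm j.
  by rewrite ler_wpM2l // mulr_ge0 ?(ltW a0)//; lra.
have q4 : (1 - gc) * lam * al * (eta * mem j) <= 70 / 456 * P * mem j.
  have -> : (1 - gc) * lam * al * (eta * mem j) =
     (1 - gc) * lam * (70 * P * mem j * (al * tau%:R)) by rewrite /eta /P; ring.
  have z1 : al * tau%:R <= 456^-1.
    have : al * tau%:R * 1 <= al * tau%:R * f ^+ 2.
      by rewrite ler_wpM2l // mulr_ge0 ?(ltW a0) ?(ltW t0).
    lra.
  have z2 : (1 - gc) * lam <= 1.
    by rewrite -[leRHS]mulr1 ler_pM //; [lra|exact: ltW|lra].
  have z3 : 0 <= 70 * P * mem j by rewrite !mulr_ge0.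
  have z4 : 0 <= 70 * P * mem j * (al * tau%:R).
    by rewrite mulr_ge0 // mulr_ge0 ?(ltW a0) ?(ltW t0).
  have := ler_wpM2r z4 z2; have := ler_wpM2l z3 z1; lra.
have Pm0 : 0 <= P * mem j by rewrite mulr_ge0.
have massE : P * tau%:R * mass j = P * tau%:R * gm j +
   P * tau%:R * (16 * al * f ^+ 2 * mem j) + P * tau%:R * B ^+ 2.
  by rewrite /mass; ring.
rewrite memS.
have -> : 71 * al ^+ 2 * f ^+ 2 * tau%:R * B ^+ 2 = 71 * (P * tau%:R * B ^+ 2).
  by rewrite /P; ring.
have eP : al ^+ 2 * (2 * f ^+ 2 * mass j) = 2 * P * mass j by rewrite /P; ring.
have cP : 2 * al * (- (1 - gc) * gm j + 16 * al * f ^+ 2 * mem j) =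
   - 2 * (al * (1 - gc) * gm j) + 32 * (P * mem j) by rewrite /P; ring.
rewrite eP in e2; rewrite cP in c2.
have -> : (1 - (1 - gc) * lam * al) * (msq j + eta * mem j) = msq j + eta * mem j
   - al * (1 - gc) * (lam * msq j) - (1 - gc) * lam * al * (eta * mem j) by ring.
lra.
Qed.

Lemma mean_square_bound j :
  EN j (fun h => norm2 (x h) ^+ 2) <=
  (1 - (1 - gc) * lam * al) ^+ j *
    (norm2 x0 ^+ 2 + 35 / 2 * (al * tau%:R * f) * (norm2 x0 * (norm2 x0 + B)))
  + 71 * f ^+ 2 * B ^+ 2 * (al * tau%:R / ((1 - gc) * lam)).
Proof.
case/andP: gc_bnd => gc0 gc1.
have a0 := al_gt0; have f1 := f_ge1; have t0 := tau_gt0.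
have a0' := ltW a0; have t0' := ltW t0.
set c := (1 - gc) * lam; set q := 1 - c * al.
have c0 : 0 < c by rewrite mulr_gt0//; lra.
have q0 : 0 <= q.
  have h1 : c <= 1 by rewrite /c -[leRHS]mulr1 ler_pM //; [lra|exact: ltW|lra].
  have h2 : al <= 1.
    have h : al * 1 <= al * f by rewrite ler_wpM2l // ltW.
    by have := alf; lra.
  have : c * al <= 1 * 1 by apply: ler_pM => //; exact: ltW.
  by rewrite /q; lra.
(* [V] is the Lyapunov function at time [0], with [eta * mem 0] written out; [b] is the fixed point
   of the affine recursion. *)
set V := norm2 x0 ^+ 2 + _; set b := 71 * _ * _ * _.
have et0 : 0 <= eta by rewrite /eta !mulr_ge0 ?exprn_ge0.
suff H : msq j + eta * mem j <= q ^+ j * V + b.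
  by apply: le_trans H; rewrite lerDl mulr_ge0.
elim: j => [|j IH].
  rewrite expr0 mul1r.
  have b0 : 0 <= b.
    by rewrite /b !mulr_ge0 ?exprn_ge0 ?invr_ge0 ?(ltW c0).
  have -> : msq 0 = norm2 x0 ^+ 2.
    rewrite -[RHS](cexp_cst K_pmf (N + 0) _ [::]); apply: eq_EN => h.
    by rewrite addn0 => /x_init ->.
  have -> : eta * mem 0 = 35 / 2 * (al * tau%:R * f) * (norm2 x0 * (norm2 x0 + B)).
    by rewrite /eta /=; field; rewrite !gt_eqF // (lt_le_trans _ f_ge1).
  by rewrite /V; lra.
apply: le_trans (lyapunov_step j) _; rewrite -/c -/q (exprS q j).
have := ler_wpM2l q0 IH.
have -> : 71 * al ^+ 2 * f ^+ 2 * tau%:R * B ^+ 2 = b - q * b.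
  by rewrite /b /q; field; rewrite gt_eqF.
lra.
Qed.

End MeanSquareBound.

(** * Maximal inequality for nonnegative supermartingales on histories *)

Section MaximalInequality.
Variables (R : realType) (X : finType) (K : seq X -> X -> R).
Hypothesis K_pmf : forall h, is_pmf (K h).

(** Histories list the newest letter first, so the suffixes of [h] are its own past: [hits] says
    that the event occurred at some time up to now. *)
Fixpoint hits (P : pred (seq X)) (h : seq X) : bool :=
  P h || (if h is _ :: h' then hits P h' else false).

Lemma hits_here (P : pred (seq X)) h : P h -> hits P h.
Proof. by case: h => /= [|y h] ->. Qed.

(** Optional stopping: the process that is frozen at [1] from the first hit on still decreases in
    mean, and it dominates the indicator of a hit at the end. *)
Lemma maximal_inequality (P : pred (seq X)) (V : seq X -> R) (M k : nat) :
  (forall h, P h -> (M <= size h)%N) ->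
  (forall h, (size h <= M + k)%N -> P h -> 1 <= V h) ->
  (forall h, (M <= size h <= M + k)%N -> 0 <= V h) ->
  (forall h, (M <= size h < M + k)%N -> cstep K V h <= V h) ->
  cexp K (M + k) (fun h => (hits P h)%:R) [::] <= cexp K M V [::].
Proof.
move=> PM PV V0 Vs.
pose v h := if hits P h then 1 else V h.
have hitsM h : hits P h -> (M <= size h)%N.
  elim: h => [|y h IH] /=; first by rewrite orbF => /PM.
  by case/orP => [/PM //|/IH /leqW].
suff H j : (j <= k)%N -> cexp K (M + j) v [::] <= cexp K M V [::].
  apply: le_trans (H k (leqnn k)); apply: le_cexp => // p sp.
  rewrite cats0 /v; case: ifP => // _; apply: V0.
  by rewrite sp leq_addr leqnn.
elim: j => [|j IH] jk.
  (* At time [M] a hit can only be the current history, because [P] rejects shorter ones. *)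
  rewrite addn0; apply: le_cexp => // p sp; rewrite cats0 /v.
  case: ifP => // hp; apply: PV; first by rewrite sp leq_addr.
  case: p sp hp => [|y p] /= sp; first by rewrite orbF.
  case/orP => // /hitsM; by rewrite -sp ltnn.
apply: le_trans (IH (ltnW jk)); rewrite addnS cexpSr.
apply: le_cexp => // p sp; rewrite cats0 {2}/v.
case: ifP => hp.
  rewrite /cstep (eq_bigr (fun y => K p y)) ?(K_sum1 K_pmf) // => y _.
  by rewrite /v /= hp orbT mulr1.
apply: le_trans (Vs p _); last by rewrite sp leq_addr ltn_add2l jk.
apply: ler_sum => y _; rewrite ler_wpM2l ?(K_ge0 K_pmf) // /v.
case: ifP => //=; rewrite hp orbF => hy; apply: PV => //=.
by rewrite sp -addnS leq_add2l.
Qed.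

End MaximalInequality.

(** * Rare excursions for square-summable stepsizes *)

Section AlmostSureConvergence.
Variables (R : realType) (X Z : finType) (K : seq X -> X -> R) (win : seq X -> Z).
Variables (d : nat) (p0 pn : Z -> 'cV[R]_d) (cz xi kz : Z -> R) (f B : R).
Variables (N : nat) (al : nat -> R) (x : seq X -> 'cV[R]_d).
Variables (rho C0 c : R).

Let err := lsa_err p0 pn cz xi.
Let corr := lsa_corr p0 pn cz xi.
Let L m h z := cprob K win m h z.

Hypothesis K_pmf : forall h, is_pmf (K h).
Hypothesis kz_pmf : is_pmf kz.
Hypothesis p0_le1 : forall z, norm2 (p0 z) <= 1.
Hypothesis pn_le1 : forall z, norm2 (pn z) <= 1.
Hypothesis cz_ge0 : forall z, 0 <= cz z.
Hypothesis cz_le : forall z, 1 + cz z <= f.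
Hypothesis xi_le : forall z, `|xi z| <= f * B.
Hypothesis B_ge1 : 1 <= B.
Hypothesis N_gt0 : (0 < N)%N.
Hypothesis x_step : forall y h, (N <= size h)%N ->
  x (y :: h) = x h + (al (size h - N)%N * err (x h) (win (y :: h))) *: p0 (win (y :: h)).
Hypothesis rho_bnd : 0 <= rho < 1.
Hypothesis C0_ge0 : 0 <= C0.
Hypothesis mixing : forall h m, (0 < size h)%N -> (0 < m)%N ->
  \sum_z `|L m h z - kz z| <= C0 * rho ^+ m.
Hypothesis c_gt0 : 0 < c.
Hypothesis drift : forall y, \sum_z kz z * corr y z <= - c * norm2 y ^+ 2.

Variable sig : nat -> R.
Hypothesis al_gt0 : forall k, 0 < al k.
Hypothesis al_div : forall A : R, exists n, A <= \sum_(i < n) al i.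
Hypothesis al_sqr : forall k r, \sum_(i < r) al (k + i)%N ^+ 2 <= sig k.
Hypothesis sig0 : forall e, 0 < e -> exists M, forall m, (M <= m)%N -> sig m <= e.

Let B_ge0 : 0 <= B. Proof. exact: le_trans B_ge1. Qed.
Let kz_ge0 z : 0 <= kz z. Proof. by case: kz_pmf. Qed.
Let kz_sum1 : \sum_z kz z = 1. Proof. by case: kz_pmf. Qed.
Let L_ge0 m h z : 0 <= L m h z. Proof. exact: cprob_ge0. Qed.
Let L_sum1 m h : \sum_z L m h z = 1. Proof. exact: cprob_sum1. Qed.
Let f_ge1 : 1 <= f. Proof. exact: (f_ge1 cz_ge0 cz_le (win [::])). Qed.
Let f_ge0 : 0 <= f. Proof. exact: le_trans f_ge1. Qed.
Let rho_ge0 : 0 <= rho. Proof. by case/andP: rho_bnd. Qed.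
Let rho_lt1 : rho < 1. Proof. by case/andP: rho_bnd. Qed.

(** The future stepsizes discounted at the mixing rate; up to the factor [C0] this bounds the total
    mass of the corrector. *)
Fixpoint beta (r k : nat) : R :=
  if r is r'.+1 then al k + rho * beta r' k.+1 else 0.

(* The expected future noise over the remaining [r] steps, started from the
   history [h] of length [N + k] and with the iterate frozen; adding its pairing
   with the iterate to the squared norm turns the Markovian noise into a
   martingale difference plus second-order terms. *)
Definition corrector (r k : nat) (h : seq X) (z : Z) : R :=
  \sum_(j < r) al (k + j)%N * (L j.+1 h z - kz z).

Let betaE r k : beta r k = \sum_(j < r) al (k + j)%N * rho ^+ j.
Proof.
elim: r k => [|r IH] k /=; first by rewrite big_ord0.
rewrite big_ord_recl addn0 expr0 mulr1 IH mulr_sumr; congr (_ + _).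
by apply: eq_bigr => i _; rewrite lift0 exprS mulrCA addSnnS.
Qed.

Let beta_ge0 r k : 0 <= beta r k.
Proof.
rewrite betaE; apply: sumr_ge0 => i _.
by rewrite mulr_ge0 ?exprn_ge0 // ltW.
Qed.

(** A finite-horizon Poisson equation. The weight of each future term is attached to its own date,
    so advancing one step removes exactly the first term of the sum. *)
Let corrector_step r k h z :
  \sum_y K h y * corrector r k.+1 (y :: h) z =
  corrector r.+1 k h z - al k * (L 1 h z - kz z).
Proof.
rewrite /corrector big_ord_recl addn0 addrAC subrr add0r.
under eq_bigr do rewrite mulr_sumr.
rewrite exchange_big; apply: eq_bigr => j _.
rewrite lift0 addSnnS /L cprob_step -[kz z in RHS]mul1r -(K_sum1 K_pmf h).
rewrite mulr_suml -sumrB mulr_sumr; apply: eq_bigr => y _; ring.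
Qed.

Let corrector_norm r k h : (0 < size h)%N ->
  \sum_z `|corrector r k h z| <= C0 * beta r k.
Proof.
move=> sh; apply: le_trans (_ : \sum_z \sum_(j < r) al (k + j)%N * `|L j.+1 h z - kz z| <= _).
  apply: ler_sum => z _; apply: le_trans (ler_norm_sum _ _ _) _.
  by apply: ler_sum => j _; rewrite normrM gtr0_norm.
rewrite exchange_big betaE mulr_sumr; apply: ler_sum => j _.
rewrite -mulr_sumr mulrCA ler_wpM2l ?(ltW (al_gt0 _)) //.
apply: le_trans (mixing sh _) _ => //.
by rewrite ler_wpM2l // exprS ler_piMl ?exprn_ge0 // ltW.
Qed.

Let U r k h : R := norm2 (x h) ^+ 2 + 2 * \sum_z corrector r k h z * corr (x h) z.

Let C2 : R := 2 * f ^+ 2 * (1 + 3 * C0).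

Let corr_sum_norm (w : Z -> R) y b : \sum_z `|w z| <= b ->
  `|\sum_z w z * corr y z| <= b * (norm2 y * (f * (norm2 y + B))).
Proof.
move=> wb; apply: le_trans (ler_norm_sum _ _ _) _.
have n0 := norm2_ge0 y.
have H : 0 <= norm2 y * (f * (norm2 y + B)) by rewrite !mulr_ge0 ?addr_ge0.
apply: le_trans (ler_wpM2r H wb); rewrite mulr_suml; apply: ler_sum => z _.
rewrite normrM ler_wpM2l //; exact: (lsa_corr_norm p0_le1 pn_le1 cz_ge0 cz_le xi_le).
Qed.

Let K_affine h a1 a2 a3 a4 (F1 F2 : X -> R) :
  \sum_y K h y * (a1 + a2 * F1 y + a3 * F2 y + a4) =
  a1 + a2 * (\sum_y K h y * F1 y) + a3 * (\sum_y K h y * F2 y) + a4.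
Proof.
transitivity (a1 * (\sum_y K h y) + a2 * (\sum_y K h y * F1 y) +
    a3 * (\sum_y K h y * F2 y) + a4 * (\sum_y K h y)).
  by rewrite !mulr_sumr -!big_split /=; apply: eq_bigr => y _; ring.
by rewrite (K_sum1 K_pmf) !mulr1.
Qed.

(** The mean noise [al k * L 1] of the update cancels against what the corrector loses, leaving
    [al k] times the stationary drift. The rest is of second order: the squared update, and the
    corrector paired with the change of [corr], where [al k * beta] is split by AM-GM. *)
Let U_step r k h : size h = (N + k)%N -> al k * f <= 1 ->
  cstep K (U r k.+1) h <= U r.+1 k h - 2 * c * al k * norm2 (x h) ^+ 2
   + C2 * (beta r.+1 k ^+ 2 + beta r k.+1 ^+ 2) * (norm2 (x h) ^+ 2 + B ^+ 2).
Proof.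
move=> sh af; have n0 := norm2_ge0 (x h); set n := norm2 (x h) in n0 *.
have a0 := ltW (al_gt0 k); have b0 := beta_ge0 r k.+1.
set a := al k in af a0 *; set b' := beta r k.+1 in b0 *.
pose e y : R := err (x h) (win (y :: h)).
have eb y : `|e y| <= f * (n + B).
  exact: (lsa_err_norm p0_le1 pn_le1 cz_ge0 cz_le xi_le).
have nB0 : 0 <= f * (n + B) by rewrite mulr_ge0 ?addr_ge0.
have xE y : x (y :: h) = x h + (a * e y) *: p0 (win (y :: h)).
  by rewrite x_step ?sh ?leq_addr // addKn.
pose D := f ^+ 2 * (a ^+ 2 + 6 * C0 * a * b') * (n + B) ^+ 2.
have H y : U r k.+1 (y :: h) <= n ^+ 2 + 2 * a * corr (x h) (win (y :: h)) +
   2 * (\sum_z corrector r k.+1 (y :: h) z * corr (x h) z) + D.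
  have I1 : norm2 (x (y :: h)) ^+ 2 <= n ^+ 2 + 2 * a * corr (x h) (win (y :: h))
      + a ^+ 2 * (f ^+ 2 * (n + B) ^+ 2).
    rewrite xE /n !norm2_sqr; set w := win _.
    rewrite dotpDl !dotpDr !dotpZl !dotpZr (dotpC _ (p0 w)).
    rewrite -/n /corr /lsa_corr -/err -/w -/(e y).
    have ee : e y ^+ 2 <= f ^+ 2 * (n + B) ^+ 2.
      rewrite -exprMn -real_normK ?num_real// ler_sqr ?nnegrE //.
    have p1 : dotp (p0 w) (p0 w) <= 1 by rewrite -norm2_sqr expr_le1 ?norm2_ge0.
    have : (a ^+ 2 * e y ^+ 2) * dotp (p0 w) (p0 w) <= (a ^+ 2 * e y ^+ 2) * 1.
      by rewrite ler_wpM2l // mulr_ge0 ?sqr_ge0.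
    have := ler_wpM2l (sqr_ge0 a) ee.
    rewrite -/(err (x h) w) -/(e y); lra.
  have I2 : \sum_z corrector r k.+1 (y :: h) z * corr (x (y :: h)) z <=
      \sum_z corrector r k.+1 (y :: h) z * corr (x h) z +
      C0 * b' * (3 * a * f ^+ 2 * (n + B) ^+ 2).
    rewrite -lerBlDl -sumrB; apply: le_trans (ler_norm _) _.
    apply: le_trans (ler_norm_sum _ _ _) _.
    have q0 : 0 <= 3 * a * f ^+ 2 * (n + B) ^+ 2.
      by rewrite !mulr_ge0 ?exprn_ge0 ?addr_ge0.
    apply: le_trans (ler_wpM2r q0 (corrector_norm r k.+1 (isT : 0 < size (y :: h))%N)).
    rewrite mulr_suml; apply: ler_sum => z _; rewrite -mulrBr normrM ler_wpM2l // xE.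
    apply: le_trans (lsa_corr_incr xi p0_le1 pn_le1 cz_ge0 cz_le _ _ _ _) _.
    rewrite normrM (ger0_norm a0).
    have aeb : a * `|e y| <= a * (f * (n + B)) by rewrite ler_wpM2l.
    have h1 : `|err (x h) z| <= f * (n + B).
      exact: (lsa_err_norm p0_le1 pn_le1 cz_ge0 cz_le xi_le).
    have h2 : f * `|dotp (p0 z) (x h)| <= f * (n + B).
      rewrite ler_wpM2l // (le_trans (dotp_le_norm2 (x h) (p0_le1 z))) //.
      by rewrite lerDl.
    have h3 : f * (a * `|e y|) <= f * (n + B).
      apply: le_trans (ler_wpM2l f_ge0 aeb) _.
      have -> : f * (a * (f * (n + B))) = (a * f) * (f * (n + B)) by ring.
      by rewrite ler_piMl.
    have h4 := lerD (lerD h1 h2) h3.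
    apply: le_trans (ler_pM _ _ aeb h4) _; rewrite ?mulr_ge0 ?addr_ge0 ?mulr_ge0 //.
    by rewrite le_eqVlt; apply/orP; left; apply/eqP; ring.
  have DE : D = a ^+ 2 * (f ^+ 2 * (n + B) ^+ 2) +
     2 * (C0 * b' * (3 * a * f ^+ 2 * (n + B) ^+ 2)) by rewrite /D; ring.
  rewrite /U DE; move: I1 I2; lra.
have S1 : cstep K (U r k.+1) h <= n ^+ 2 + 2 * a * (\sum_z L 1 h z * corr (x h) z) +
   2 * (\sum_z (corrector r.+1 k h z - a * (L 1 h z - kz z)) * corr (x h) z) + D.
  apply: le_trans (_ : \sum_y K h y * (n ^+ 2 + 2 * a * corr (x h) (win (y :: h)) +
     2 * (\sum_z corrector r k.+1 (y :: h) z * corr (x h) z) + D) <= _).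
    by apply: ler_sum => y _; rewrite ler_wpM2l ?(K_ge0 K_pmf).
  have -> : \sum_z L 1 h z * corr (x h) z = \sum_y K h y * corr (x h) (win (y :: h)).
    by rewrite -(cexp_win K win (corr (x h)) 1 h).
  have -> : \sum_z (corrector r.+1 k h z - a * (L 1 h z - kz z)) * corr (x h) z =
     \sum_y K h y * \sum_z corrector r k.+1 (y :: h) z * corr (x h) z.
    under eq_bigr do rewrite -corrector_step mulr_suml.
    rewrite exchange_big; apply: eq_bigr => y _; rewrite mulr_sumr.
    by apply: eq_bigr => z _; rewrite mulrA.
  by rewrite K_affine.
apply: le_trans S1 _.
have -> : \sum_z (corrector r.+1 k h z - a * (L 1 h z - kz z)) * corr (x h) z =
  \sum_z corrector r.+1 k h z * corr (x h) z - a * (\sum_z L 1 h z * corr (x h) z)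
   + a * (\sum_z kz z * corr (x h) z).
  rewrite !mulr_sumr -sumrB -big_split; apply: eq_bigr => z _ /=; ring.
have Dr : a * (\sum_z kz z * corr (x h) z) <= a * (- c * n ^+ 2) by rewrite ler_wpM2l.
have DC : D <= C2 * (beta r.+1 k ^+ 2 + b' ^+ 2) * (n ^+ 2 + B ^+ 2).
  have ab : a <= beta r.+1 k by rewrite /= lerDl mulr_ge0.
  have i1 : a ^+ 2 <= beta r.+1 k ^+ 2 by rewrite ler_sqr ?nnegrE.
  have i2 : a * b' <= 2^-1 * (beta r.+1 k ^+ 2 + b' ^+ 2).
    by have := sqr_ge0 (a - b'); lra.
  have i3 : (n + B) ^+ 2 <= 2 * (n ^+ 2 + B ^+ 2) by have := sqr_ge0 (n - B); lra.
  have i4 : a ^+ 2 + 6 * C0 * a * b' <=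
     (1 + 3 * C0) * (beta r.+1 k ^+ 2 + b' ^+ 2).
    have := ler_wpM2l C0_ge0 i2; have := sqr_ge0 b'; lra.
  have i5 : 0 <= a ^+ 2 + 6 * C0 * a * b' by rewrite addr_ge0 ?exprn_ge0 // !mulr_ge0.
  rewrite /D -mulrA.
  apply: le_trans (ler_wpM2l (sqr_ge0 f) (ler_pM i5 (sqr_ge0 _) i4 i3)) _.
  by rewrite /C2 le_eqVlt; apply/orP; left; apply/eqP; ring.
by rewrite /U -/n; lra.
Qed.

Let C1 : R := 4 * (C0 * f * B) ^+ 2.
Let C4 : R := C1 + 2 * C2.

Let C1_ge0 : 0 <= C1. Proof. by rewrite mulr_ge0 ?sqr_ge0. Qed.
Let C2_ge0 : 0 <= C2.
Proof. by rewrite /C2 !mulr_ge0 ?exprn_ge0 // addr_ge0 // mulr_ge0. Qed.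
Let C4_ge0 : 0 <= C4. Proof. by rewrite addr_ge0 // mulr_ge0. Qed.

Let G r k h : R := U r k h + C1 * beta r k ^+ 2.

Let small k : Prop := al k * f <= 1 /\ forall r, 2 * C0 * f * beta r k <= 4^-1.

(** Twice the pairing has a part quadratic in the norm, at most a quarter of its square by [small],
    and a linear part, at most another quarter plus [C1 * beta r k ^+ 2] by AM-GM. Adding
    [C1 * beta r k ^+ 2] therefore restores positivity. *)
Let G_bounds r k h : small k -> (0 < size h)%N ->
  2^-1 * norm2 (x h) ^+ 2 <= G r k h <= 2 * norm2 (x h) ^+ 2 + 2 * C1 * beta r k ^+ 2.
Proof.
move=> [_ bs] sh; have b0 := beta_ge0 r k.
have := corr_sum_norm (x h) (corrector_norm r k sh).
have n0 := norm2_ge0 (x h); have := bs r; rewrite /G /U /C1.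
set n := norm2 (x h) in n0 *; set b := beta r k in b0 *; set s := \sum_z _.
move=> bb; rewrite ler_norml => /andP[s1 s2].
have h1 : C0 * b * (n * (f * (n + B))) <= 4^-1 * n ^+ 2 + 2 * (C0 * f * B * b) ^+ 2.
  have j1 := ler_wpM2r (sqr_ge0 n) bb.
  have := sqr_ge0 (n / 2 - 2 * (C0 * f * B * b)); lra.
rewrite exprMn in h1; have := sqr_ge0 n.
have : 0 <= (C0 * f * B) ^+ 2 * b ^+ 2 by rewrite mulr_ge0 ?sqr_ge0.
move=> z1 z2; apply/andP; split; lra.
Qed.

Let b r k : R := C4 * (beta r.+1 k ^+ 2 + beta r k.+1 ^+ 2).

Fixpoint growth (r k : nat) : R :=
  if r is r'.+1 then
    C4 * (beta r'.+1 k ^+ 2 + beta r' k.+1 ^+ 2) + growth r' k.+1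
  else 0.

Let growth_ge0 r k : 0 <= growth r k.
Proof.
elim: r k => //= r IH k; rewrite addr_ge0 // mulr_ge0 // addr_ge0 ?exprn_ge0 //.
exact: (beta_ge0 r.+1 k).
Qed.

(** One step multiplies the mean of [G + B ^+ 2] by at most [1 + b r k], hence by at most
    [expR (b r k)], which is exactly what the exponential of the remaining growth gives up. The
    energy thus decreases in mean. *)
Let energy r k h : R := expR (growth r k) * (G r k h + B ^+ 2).

Let energy_step r k h : size h = (N + k)%N -> small k ->
  cstep K (energy r k.+1) h <= energy r.+1 k h - 2 * c * al k * norm2 (x h) ^+ 2.
Proof.
move=> sh sk; have n0 := norm2_ge0 (x h).
have sh0 : (0 < size h)%N by rewrite sh addn_gt0 N_gt0.
have /andP[g1 g2] := G_bounds r.+1 sk sh0.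
have a0 := ltW (al_gt0 k).
have := U_step r sh (proj1 sk).
set n := norm2 (x h) in n0 g1 g2 *; set u := cstep K _ h.
set be := beta r.+1 k; set b' := beta r k.+1 => Hu.
have n2 := sqr_ge0 n.
have G0 : 0 <= G r.+1 k h by apply: le_trans g1; rewrite mulr_ge0.
have uE : cstep K (energy r k.+1) h =
  expR (growth r k.+1) * (u + C1 * b' ^+ 2 + B ^+ 2).
  have := K_affine h 0 (expR (growth r k.+1)) 0 
    (expR (growth r k.+1) * (C1 * b' ^+ 2 + B ^+ 2))
    (fun y => U r k.+1 (y :: h)) (fun=> 0).
  rewrite -/(cstep _ _ _) -/u => E; rewrite -addrA [RHS]mulrDr.
  transitivity (0 + expR (growth r k.+1) * u + 0 * (\sum_y K h y * 0) +
      expR (growth r k.+1) * (C1 * b' ^+ 2 + B ^+ 2)); last by ring.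
  rewrite -E.
  by apply: eq_bigr => y _; rewrite /energy /G -/b'; ring.
have B1 : 1 <= B ^+ 2 by exact: exprn_ege1.
have be0 : 0 <= be := beta_ge0 r.+1 k; have b'0 : 0 <= b' := beta_ge0 r k.+1.
have be2 := sqr_ge0 be; have b2 := sqr_ge0 b'.
have Hs : u + C1 * b' ^+ 2 + B ^+ 2 <= (1 + b r k) * (G r.+1 k h + B ^+ 2)
   - 2 * c * al k * n ^+ 2.
  have e1 : C2 * (be ^+ 2 + b' ^+ 2) * (n ^+ 2 + B ^+ 2) <=
     C2 * (be ^+ 2 + b' ^+ 2) * (2 * (G r.+1 k h + B ^+ 2)).
    apply: ler_wpM2l; first by rewrite mulr_ge0 ?addr_ge0.
    by move: g1; move: (G r.+1 k h) => gg; lra.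
  (* Since [1 <= B ^+ 2], the additive term becomes a multiple of [G + B ^+ 2], so that only a
     multiplicative error is left. *)
  have e2 : C1 * b' ^+ 2 * 1 <= C1 * (be ^+ 2 + b' ^+ 2) * (G r.+1 k h + B ^+ 2).
    apply: ler_pM; rewrite ?mulr_ge0 //.
      by rewrite ler_wpM2l // lerDr.
    by move: G0; move: (G r.+1 k h) => gg; lra.
  have e3 : 0 <= C1 * be ^+ 2 by rewrite mulr_ge0.
  have e4 : U r.+1 k h = G r.+1 k h - C1 * be ^+ 2 by rewrite /G addrK.
  rewrite e4 in Hu; rewrite /b /C4 -/be -/b'.
  move: Hu e1 e2 e3; move: (G r.+1 k h) (C1) (C2) (u) => gg c1 c2 uu; lra.
rewrite uE; apply: le_trans (ler_wpM2l (expR_ge0 _) Hs) _.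
rewrite mulrBr; apply: lerB; last first.
  rewrite ler_peMl //; last by rewrite -expR0 ler_expR growth_ge0.
  by rewrite !mulr_ge0 ?exprn_ge0 ?(ltW c_gt0).
rewrite /energy mulrA; apply: ler_wpM2r; first exact: addr_ge0 G0 (sqr_ge0 B).
have -> : growth r.+1 k = b r k + growth r k.+1 by [].
by rewrite expRD mulrC ler_wpM2r ?expR_ge0 ?expR_ge1Dx.
Qed.

(** Convexity of the square: [beta r.+1 k] is the average of [al k / (1 - rho)] and [beta r k.+1]
    with weights [1 - rho] and [rho]. *)
Let beta_sqr_step r k :
  beta r.+1 k ^+ 2 <= al k ^+ 2 / (1 - rho) + rho * beta r k.+1 ^+ 2.
Proof.
have r1 : 0 < 1 - rho by rewrite subr_gt0.
have -> : al k ^+ 2 / (1 - rho) + rho * beta r k.+1 ^+ 2 = beta r.+1 k ^+ 2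
   + rho / (1 - rho) * (al k - (1 - rho) * beta r k.+1) ^+ 2.
  by rewrite /=; field; rewrite gt_eqF.
by rewrite lerDl mulr_ge0 ?sqr_ge0 // divr_ge0 // ltW.
Qed.

Let al_sqrS r k : \sum_(i < r.+1) al (k + i)%N ^+ 2 =
  al k ^+ 2 + \sum_(i < r) al (k.+1 + i)%N ^+ 2.
Proof.
rewrite big_ord_recl addn0; congr (_ + _).
by apply: eq_bigr => i _; rewrite lift0 addSnnS.
Qed.

Let beta_sqr r k : beta r k ^+ 2 <= sig k / (1 - rho).
Proof.
have r1 : 0 < 1 - rho by rewrite subr_gt0.
apply: le_trans (_ : (\sum_(i < r) al (k + i)%N ^+ 2) / (1 - rho) <= _); last first.
  by rewrite ler_wpM2r ?invr_ge0 ?(ltW r1).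
elim: r k => [|r IH] k; first by rewrite big_ord0 mul0r /= expr0n.
rewrite al_sqrS mulrDl; apply: le_trans (beta_sqr_step r k) _.
rewrite lerD2l; apply: le_trans (IH k.+1).
by rewrite ler_piMl ?sqr_ge0 // ltW.
Qed.

Let C5 : R := C4 * (2 / (1 - rho) ^+ 2).

Let C5_ge0 : 0 <= C5.
Proof. by rewrite mulr_ge0 // divr_ge0 ?sqr_ge0. Qed.

Let growth_le r k : growth r k <= C5 * sig k.
Proof.
have r1 : 0 < 1 - rho by rewrite subr_gt0.
apply: le_trans (_ : C5 * \sum_(i < r) al (k + i)%N ^+ 2 <= _); last first.
  by rewrite ler_wpM2l.
(* The induction carries a multiple of the current [beta r k ^+ 2]; [a] is the solution of
   [1 + rho * (1 + a) = a], which makes the term in [beta r k.+1] reproduce itself. *)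
pose a := (1 + rho) / (1 - rho).
have a0 : 0 <= a by exact: divr_ge0 (addr_ge0 ler01 rho_ge0) (ltW r1).
suff H : growth r k + C4 * (a * beta r k ^+ 2) <=
    C5 * \sum_(i < r) al (k + i)%N ^+ 2.
  apply: le_trans H; rewrite lerDl.
  exact: mulr_ge0 C4_ge0 (mulr_ge0 a0 (sqr_ge0 _)).
elim: r k => [|r IH] k; first by rewrite big_ord0 /= expr0n !mulr0 addr0.
rewrite al_sqrS; have := IH k.+1; set s := \sum_(i < r) _ => H.
have -> : growth r.+1 k = C4 * (beta r.+1 k ^+ 2 + beta r k.+1 ^+ 2) + growth r k.+1.
  by [].
have h := ler_wpM2l (addr_ge0 ler01 a0) (beta_sqr_step r k).
have e : (1 + a) * (al k ^+ 2 / (1 - rho) + rho * beta r k.+1 ^+ 2) =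
   2 / (1 - rho) ^+ 2 * al k ^+ 2 + (a - 1) * beta r k.+1 ^+ 2.
  by rewrite /a; field; rewrite gt_eqF.
rewrite e in h; have := ler_wpM2l C4_ge0 h.
rewrite /C5 in H *; lra.
Qed.

Let small_eventually : exists k0, forall k, (k0 <= k)%N -> small k.
Proof.
have r1 : 0 < 1 - rho by rewrite subr_gt0.
have f0 : 0 < f by rewrite (lt_le_trans _ f_ge1).
pose D := (8 * C0 * f) ^+ 2 + 1.
have D0 : 0 < D by rewrite ltr_wpDl // sqr_ge0.
have fi : 0 < f ^- 2 by rewrite invr_gt0 exprn_gt0.
have di : 0 < (1 - rho) / D by rewrite divr_gt0.
have [[M1 H1] [M2 H2]] := (sig0 fi, sig0 di).
exists (maxn M1 M2) => k; rewrite geq_max => /andP[k1 k2]; split.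
  have a0 := ltW (al_gt0 k).
  rewrite -(@ler_sqr _ _ 1) ?nnegrE ?mulr_ge0 // expr1n exprMn.
  rewrite -ler_pdivlMr ?exprn_gt0 // mul1r; apply: le_trans (H1 _ k1).
  by have := al_sqr k 1; rewrite big_ord1 addn0.
move=> r; have b0 := beta_ge0 r k.
suff : 8 * C0 * f * beta r k <= 1 by lra.
rewrite -(@ler_sqr _ _ 1) ?nnegrE ?mulr_ge0 // expr1n exprMn.
have ri : 0 <= (1 - rho)^-1 by rewrite invr_ge0 ltW.
have := le_trans (beta_sqr r k) (ler_wpM2r ri (H2 _ k2)).
have -> : (1 - rho) / D * (1 - rho)^-1 = D^-1.
  by field; rewrite !gt_eqF.
move=> h; apply: le_trans (ler_wpM2l (sqr_ge0 _) h) _.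
by rewrite ler_pdivrMr // mul1r lerDl.
Qed.

Let EN k (F : seq X -> R) : R := cexp K (N + k) F [::].
Let msq k : R := EN k (fun h => norm2 (x h) ^+ 2).

Let msq_ge0 k : 0 <= msq k.
Proof. by apply: cexp_ge0 => // h; exact: sqr_ge0. Qed.

Let G_ge0 r k h : small k -> (0 < size h)%N -> 0 <= G r k h.
Proof.
move=> sk sh; have /andP[g _] := G_bounds r sk sh.
by apply: le_trans g; rewrite mulr_ge0 ?sqr_ge0.
Qed.

Let energy_ge r k h : small k -> (0 < size h)%N -> G r k h + B ^+ 2 <= energy r k h.
Proof.
move=> sk sh; apply: ler_peMl; first exact: addr_ge0 (G_ge0 r sk sh) (sqr_ge0 B).
by rewrite -expR0 ler_expR growth_ge0.
Qed.

(** A bound on the mean energy in which the horizon [r] does not occur; this uniformity lets the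
    horizon tend to infinity afterwards. *)
Let bnd k : R := expR (C5 * sig k) *
  (2 * msq k + 2 * C1 * (sig k / (1 - rho)) + B ^+ 2).

Let mean_energy_le r k : small k -> EN k (energy r k) <= bnd k.
Proof.
move=> sk.
apply: le_trans (_ : EN k (fun h => expR (C5 * sig k) *
    (2 * norm2 (x h) ^+ 2 + (2 * C1 * (sig k / (1 - rho)) + B ^+ 2))) <= _); last first.
  by rewrite /EN cexpZ cexpD cexpZ (cexp_cst K_pmf) /bnd addrA.
apply: le_cexp => // p sp; rewrite cats0.
have sp0 : (0 < size p)%N by rewrite sp addn_gt0 N_gt0.
have g0 := G_ge0 r sk sp0.
have /andP[_ g2] := G_bounds r sk sp0.
apply: ler_pM; [exact: expR_ge0|exact: addr_ge0 g0 (sqr_ge0 B)| |].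
  by rewrite ler_expR growth_le.
have : 2 * C1 * beta r k ^+ 2 <= 2 * C1 * (sig k / (1 - rho)).
  by apply: ler_wpM2l; rewrite ?mulr_ge0.
by move: g2; move: (G r k p) (C1) => g c1; lra.
Qed.

Let weighted_sum_le r k : (forall j, (k <= j)%N -> small j) ->
  2 * c * \sum_(i < r) al (k + i)%N * msq (k + i)%N <= EN k (energy r k).
Proof.
elim: r k => [|r IH] k sk.
  rewrite big_ord0 mulr0; have ks := sk k (leqnn k).
  rewrite -(cexp_cst K_pmf (N + k) 0 [::]); apply: le_cexp => // p sp.
  have sp0 : (0 < size (p ++ [::]))%N by rewrite cats0 sp addn_gt0 N_gt0.
  apply: le_trans (energy_ge 0 ks sp0).
  exact: addr_ge0 (G_ge0 0 ks sp0) (sqr_ge0 B).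
have := IH k.+1 (fun j kj => sk j (ltnW kj)).
have : EN k.+1 (energy r k.+1) <= EN k (energy r.+1 k) - 2 * c * al k * msq k.
  rewrite /EN addnS cexpSr /msq -cexpZ -cexpB; apply: le_cexp => // p sp.
  by rewrite cats0; apply: energy_step; rewrite ?sp //; exact: sk.
rewrite big_ord_recl addn0.
have -> : \sum_(i < r) al (k + lift ord0 i)%N * msq (k + lift ord0 i)%N =
    \sum_(i < r) al (k.+1 + i)%N * msq (k.+1 + i)%N.
  by apply: eq_bigr => i _; rewrite lift0 addSnnS.
lra.
Qed.

(** If the mean square stayed above [e] from some time on, the drift summed along the energy would
    bound the partial sums of the stepsizes, which diverge. *)
Let msq_liminf e M : 0 < e -> exists2 m, (M <= m)%N & msq m <= e.
Proof.
move=> e0; have [k0 sk] := small_eventually.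
apply: contrapT => nex; pose k := maxn M k0.
have [n An] := al_div (\sum_(i < k) al i + bnd k / (2 * c * e) + 1).
have big m : (k <= m)%N -> e <= msq m.
  move=> km; rewrite leNgt; apply/negP => /ltW lt; apply: nex; exists m => //.
  by apply: leq_trans km; exact: leq_maxl.
have skk j : (k <= j)%N -> small j.
  by move=> kj; apply: sk; apply: leq_trans kj; exact: leq_maxr.
have := le_trans (weighted_sum_le n skk) (mean_energy_le n (skk k (leqnn k))).
have s1 : \sum_(i < n) al (k + i)%N * e <= \sum_(i < n) al (k + i)%N * msq (k + i)%N.
  by apply: ler_sum => i _; rewrite ler_wpM2l ?(ltW (al_gt0 _)) // big ?leq_addr.
have s2 : \sum_(i < n) al i <= \sum_(i < k) al i + \sum_(i < n) al (k + i)%N.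
  have -> : \sum_(i < k) al i + \sum_(i < n) al (k + i)%N = \sum_(i < n + k) al i.
    by rewrite addnC big_split_ord.
  by rewrite big_split_ord lerDl; apply: sumr_ge0 => i _; exact: ltW.
rewrite -mulr_suml in s1.
have ce : 0 < 2 * c * e by rewrite !mulr_gt0.
have s3 := ler_wpM2l (ltW c_gt0) s1.
have s4 : 2 * c * e * (bnd k / (2 * c * e) + 1) <=
    2 * c * e * (\sum_(i < n) al (k + i)%N) by rewrite ler_wpM2l ?(ltW ce)//; lra.
have -> : bnd k = 2 * c * e * (bnd k / (2 * c * e)) by rewrite mulrC divfK ?gt_eqF.
lra.
Qed.

Let expR_le (u : R) : 0 <= u -> u <= 2^-1 -> expR u <= 1 + 2 * u.
Proof.
move=> u0 u1; have h := @expR_ge1Dx R (- u).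
have u2 : 0 < 1 - u by lra.
rewrite -[u in expR u]opprK expRN; apply: le_trans (_ : (1 - u)^-1 <= _).
  by rewrite lef_pV2 ?posrE ?expR_gt0.
rewrite -[leLHS]mul1r ler_pdivrMr // -subr_ge0.
have -> : (1 + 2 * u) * (1 - u) - 1 = u * (1 - 2 * u) by ring.
by rewrite mulr_ge0//; lra.
Qed.

(** The starting time [m] is chosen so that both the tail [sig m] and the mean square are small. The
    energy then starts close to its floor [B ^+ 2], and the maximal inequality bounds the
    probability of any later excursion by a quantity free of [r]. *)
Lemma hits_eventually_rare (e del : R) : 0 < e -> 0 < del ->
  exists m, forall r, cexp K (N + m + r) (fun h =>
    (hits (fun h => (N + m <= size h)%N && (e <= norm2 (x h) ^+ 2)) h)%:R) [::] <= del.
Proof.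
move=> e0 del0; have [k0 sk] := small_eventually.
have r1 : 0 < 1 - rho by rewrite subr_gt0.
pose C6 := 2 * C5 * B ^+ 2 + 2 * (2 + 2 * C1 / (1 - rho)).
have C60 : 0 <= C6.
  have h1 : 0 <= C5 * B ^+ 2 by rewrite mulr_ge0 ?sqr_ge0.
  have h2 : 0 <= C1 / (1 - rho) by rewrite divr_ge0 // ltW.
  rewrite /C6; lra.
(* The first entry keeps the exponent [C5 * sig m] below [1 / 2], where the exponential is at most
   [1 + 2 * u]; the second makes [2 / e * (C6 * eta)] at most [del]. *)
pose eta := Num.min (2 * C5 + 1)^-1 (del * e / (2 * (C6 + 1))).
have C5' : 0 < 2 * C5 + 1 by rewrite ltr_wpDl // mulr_ge0.
have C6' : 0 < C6 + 1 by rewrite ltr_wpDl.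
have eta0 : 0 < eta by rewrite lt_min invr_gt0 C5' divr_gt0 ?mulr_gt0.
have [M HM] := sig0 eta0.
have [m Mm Em] := msq_liminf (maxn M k0) eta0.
have sm : sig m <= eta by apply: HM; apply: leq_trans Mm; exact: leq_maxl.
have skm j : (m <= j)%N -> small j.
  by move=> mj; apply: sk; apply: leq_trans mj; apply: leq_trans Mm; exact: leq_maxr.
exists m => r.
(* The end of the horizon is fixed at time [m + r], so the remaining length shrinks as the history
   grows. The factor [2 / e] makes an excursion give [V h >= 1], and removing [B ^+ 2] makes the
   initial mean small. *)
pose V h := 2 / e * (energy (m + r + N - size h) (size h - N) h - B ^+ 2).
have e2 : 0 <= 2 / e by rewrite divr_ge0 // ltW.
have sizeE (h : seq X) : (N + m <= size h)%N -> exists i, size h = (N + (m + i))%N.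
  by move=> hs; exists (size h - (N + m))%N; rewrite addnA subnKC.
have pos (h : seq X) : (N + m <= size h)%N -> (0 < size h)%N.
  by move=> hs; apply: leq_trans hs; rewrite addn_gt0 N_gt0.
have VG h : (N + m <= size h)%N -> 2 / e * (2^-1 * norm2 (x h) ^+ 2) <= V h.
  move=> hs; have [i si] := sizeE h hs; apply: ler_wpM2l => //.
  have sj : small (size h - N) by rewrite si addKn; apply: skm; exact: leq_addr.
  have := energy_ge (m + r + N - size h) sj (pos h hs).
  have /andP[g _] := G_bounds (m + r + N - size h) sj (pos h hs).
  by move: g; move: (G _ _ _) (energy _ _ _) => g1 g2; lra.
have MI : cexp K (N + m + r) (fun h =>
    (hits (fun h => (N + m <= size h)%N && (e <= norm2 (x h) ^+ 2)) h)%:R) [::]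
    <= cexp K (N + m) V [::].
  apply: maximal_inequality => //.
  - by move=> h /andP[].
  - move=> h _ /andP[hs he]; apply: le_trans (VG h hs).
    have -> : 2 / e * (2^-1 * norm2 (x h) ^+ 2) = norm2 (x h) ^+ 2 / e.
      by field; rewrite gt_eqF.
    by rewrite ler_pdivlMr // mul1r.
  - move=> h /andP[hs _]; apply: le_trans (VG h hs).
    by apply: mulr_ge0 => //; apply: mulr_ge0; rewrite ?sqr_ge0.
  - move=> h /andP[hs hlt]; have [i si] := sizeE h hs.
    have ir : (i < r)%N by move: hlt; rewrite si addnA ltn_add2l.
    have E1 : (m + r + N - size h = (r - i.+1).+1)%N.
      by rewrite si -subSn // subSS [(m + r + N)%N]addnC subnDl subnDl.
    have -> : V h = 2 / e * (energy (r - i.+1).+1 (m + i) h - B ^+ 2).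
      by rewrite /V E1 si addKn.
    have -> : cstep K V h =
        2 / e * (cstep K (energy (r - i.+1) (m + i).+1) h - B ^+ 2).
      rewrite /cstep -[B ^+ 2]mul1r -(K_sum1 K_pmf h) mulr_suml -sumrB mulr_sumr.
      apply: eq_bigr => y _; rewrite /V /= si subSn ?leq_addr // addKn.
      have -> : (m + r + N - (N + (m + i)).+1 = r - i.+1)%N.
        by rewrite [(m + r + N)%N]addnC -addnS -addnS subnDl subnDl.
      by rewrite K_sum1 ?mul1r //; ring.
    apply: ler_wpM2l => //; rewrite lerB //.
    apply: le_trans (energy_step (r - i.+1) si (skm _ (leq_addr i m))) _.
    rewrite gerBl mulr_ge0 ?sqr_ge0 // mulr_ge0 ?(ltW (al_gt0 _)) //.
    by rewrite mulr_ge0 ?(ltW c_gt0).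
apply: le_trans MI _.
have -> : cexp K (N + m) V [::] = 2 / e * (EN m (energy r m) - B ^+ 2).
  rewrite -[B ^+ 2 in RHS](cexp_cst K_pmf (N + m) _ [::]) -cexpB -cexpZ.
  apply: eq_cexp => p sp; rewrite cats0 /V sp addKn.
  by have -> : (m + r + N - (N + m) = r)%N by rewrite [(m + r + N)%N]addnC addnA addKn.
have h1 := mean_energy_le r (skm m (leqnn m)).
have s0 : 0 <= sig m by have := al_sqr m 0; rewrite big_ord0.
have u0 : 0 <= C5 * sig m by rewrite mulr_ge0.
have ue : C5 * sig m <= C5 * eta by rewrite ler_wpM2l.
have u1 : C5 * eta <= 2^-1.
  have : eta <= (2 * C5 + 1)^-1 by rewrite ge_min lexx.
  move=> /(ler_wpM2l C5_ge0) /le_trans; apply.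
  by rewrite ler_pdivrMr //; lra.
have ex := expR_le u0 (le_trans ue u1).
set v := 2 * msq m + 2 * C1 * (sig m / (1 - rho)).
have v0 : 0 <= v.
  by rewrite /v addr_ge0 // !mulr_ge0 // ?invr_ge0 ?(ltW r1).
have vb : v <= (2 + 2 * C1 / (1 - rho)) * eta.
  have : 2 * C1 / (1 - rho) * sig m <= 2 * C1 / (1 - rho) * eta.
    by rewrite ler_wpM2l // divr_ge0 ?mulr_ge0 // ltW.
  by rewrite /v; lra.
have bE : bnd m <= (1 + 2 * (C5 * sig m)) * (v + B ^+ 2).
  by rewrite /bnd -/v ler_wpM2r // addr_ge0 ?sqr_ge0.
have bb : bnd m - B ^+ 2 <= C6 * eta.
  have w1 : (1 + 2 * (C5 * sig m)) * v <= 2 * ((2 + 2 * C1 / (1 - rho)) * eta).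
    by apply: ler_pM => //; lra.
  have w2 : C5 * sig m * B ^+ 2 <= C5 * eta * B ^+ 2 by rewrite ler_wpM2r ?sqr_ge0.
  rewrite /C6; lra.
apply: le_trans (_ : 2 / e * (C6 * eta) <= _).
  by apply: ler_wpM2l => //; apply: le_trans bb; rewrite lerB.
have : eta <= del * e / (2 * (C6 + 1)) by rewrite ge_min lexx orbT.
move=> /(ler_wpM2l C60) /(ler_wpM2l e2) /le_trans; apply.
have -> : 2 / e * (C6 * (del * e / (2 * (C6 + 1)))) = del * (C6 / (C6 + 1)).
  by field; rewrite !gt_eqF.
by rewrite ler_piMr ?(ltW del0) // ler_pdivrMr // mul1r lerDl.
Qed.

End AlmostSureConvergence.

(** Applied to the return times of a state. The least gap [g] between two members divides every
    member, so it is [1] by the gcd hypothesis; two consecutive members then generate every large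
    integer. *)
Lemma additive_semigroup_cofinite (A : nat -> Prop) :
  (forall a b, A a -> A b -> A (a + b)%N) ->
  (forall m, (forall k, (0 < k)%N -> A k -> (m %| k)%N) -> m = 1%N) ->
  exists N, forall n, (N <= n)%N -> A n.
Proof.
move=> AD Agcd.
have Amul a i : A a -> A (i.+1 * a)%N.
  by move=> Aa; elim: i => [|i IH]; rewrite ?mul1n // mulSn; apply: AD.
have [k k0 Ak] : exists2 k, (0 < k)%N & A k.
  apply: contrapT => nex; suff : 2%N = 1%N by [].
  by apply: Agcd => k k0 Ak; exfalso; apply: nex; exists k.
pose D g := `[< (0 < g)%N /\ exists a, [/\ (0 < a)%N, A a & A (a + g)%N] >].
have exD : exists g, D g.
  by exists k; apply/asboolP; split => //; exists k; split => //; apply: AD.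
case: (ex_minnP exD) => g /asboolP [g0 [a [a0 Aa Aag]]] gmin.
have g1 : g = 1%N.
  apply: Agcd => j j0 Aj; apply: contraT => ndvd.
  have r0 : (0 < j %% g)%N by rewrite lt0n.
  have rg : (j %% g < g)%N by rewrite ltn_mod.
  suff /gmin : D (j %% g)%N by rewrite leqNgt rg.
  apply/asboolP; split => //.
  have jE := divn_eq j g; case q : (j %/ g)%N jE => [|p] jE.
    by exists j; split => //; rewrite mul0n add0n in jE; rewrite -jE; apply: AD.
  exists (p.+1 * (a + g))%N; split; [by rewrite muln_gt0 /= addn_gt0 a0|exact: Amul|].
  (* With [j = p.+1 * g + j %% g], the members [p.+1 * (a + g)] and [j + p.+1 * a] differ by
     [j %% g], a gap smaller than [g]. *)
  have -> : (p.+1 * (a + g) + j %% g = j + p.+1 * a)%N by lia.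
  by apply: AD => //; exact: Amul.
rewrite {}g1 addn1 in Aag; exists (a * a)%N => n an.
have nE := divn_eq n a; have ra : (n %% a < a)%N by rewrite ltn_mod.
have qa : (a <= n %/ a)%N by rewrite leq_divRL.
(* Writing [n = q * a + s] gives [n = (q - s) * a + s * a.+1], where [q - s] is positive since
   [q >= a > s]. *)
have -> : n = (((n %/ a - n %% a).-1).+1 * a + n %% a * a.+1)%N by nia.
case: (n %% a)%N => [|r]; first by rewrite mul0n addn0; exact: Amul.
by apply: AD; exact: Amul.
Qed.

(** * Convergence to stationarity of a finite Markov chain *)

Section MarkovChain.
Variables (R : realType) (S : finType) (P : S -> S -> R).
Hypothesis P_stoch : is_stochastic P.

Let P_ge0 s s' : 0 <= P s s'. Proof. by case: (P_stoch s). Qed.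
Let P_sum1 s : \sum_s' P s s' = 1. Proof. by case: (P_stoch s). Qed.

Lemma kernel_pow_ge0 k s s' : 0 <= kernel_pow P k s s'.
Proof.
elim: k s => [|k IH] s /=; first by rewrite ler0n.
by apply: sumr_ge0 => u _; rewrite mulr_ge0.
Qed.

Lemma kernel_pow_sum1 k s : \sum_s' kernel_pow P k s s' = 1.
Proof.
elim: k s => [|k IH] s /=.
  rewrite (bigD1 s) //= eqxx big1 ?addr0 // => s' /negbTE.
  by rewrite eq_sym => ->.
rewrite exchange_big -(P_sum1 s); apply: eq_bigr => u _.
by rewrite -mulr_sumr IH mulr1.
Qed.

Lemma kernel_powD a b s s' :
  kernel_pow P (a + b) s s' = \sum_u kernel_pow P a s u * kernel_pow P b u s'.
Proof.
elim: a s => [|a IH] s /=.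
  rewrite (bigD1 s) //= eqxx mul1r big1 ?addr0 // => u /negbTE.
  by rewrite eq_sym => ->; rewrite mul0r.
under eq_bigr do rewrite IH mulr_sumr.
rewrite exchange_big /=; apply: eq_bigr => u _; rewrite mulr_suml.
by apply: eq_bigr => v _; rewrite mulrA.
Qed.

Lemma kernel_powD_gt0 a b s u s' : 0 < kernel_pow P a s u ->
  0 < kernel_pow P b u s' -> 0 < kernel_pow P (a + b) s s'.
Proof.
move=> pa pb; rewrite kernel_powD (bigD1 u) //=.
apply: ltr_wpDr; last exact: mulr_gt0.
by apply: sumr_ge0 => v _; rewrite mulr_ge0 ?kernel_pow_ge0.
Qed.

Lemma irreducible_aperiodic_positive : irreducible P -> aperiodic P ->
  exists m, forall s s', 0 < kernel_pow P m s s'.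
Proof.
move=> irr aper.
have H (x : S * S) : exists N, forall n, (N <= n)%N -> 0 < kernel_pow P n x.1 x.2.
  case: x => s s' /=; have [k pk] := irr s s'.
  have [N HN] := @additive_semigroup_cofinite (fun k => 0 < kernel_pow P k s s)
    (fun a b => @kernel_powD_gt0 a b s s s) (aper s).
  exists (N + k)%N => n Nn; rewrite -[n](@subnK k) ?(leq_trans _ Nn) ?leq_addl //.
  by apply: kernel_powD_gt0 pk; apply: HN; rewrite leq_subRL ?(leq_trans _ Nn) ?leq_addl // addnC.
have [N HN] := choice H; exists (\max_x N x)%N => s s'.
by apply: (HN (s, s')); exact: leq_bigmax.
Qed.

Variable mu : S -> R.
Hypothesis mu_stat : stationary P mu.

Let mu_ge0 s : 0 <= mu s. Proof. by case: mu_stat => -[]. Qed.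
Let mu_sum1 : \sum_s mu s = 1. Proof. by case: mu_stat => -[]. Qed.

Lemma stationary_pow k s' : \sum_s mu s * kernel_pow P k s s' = mu s'.
Proof.
elim: k s' => [|k IH] s' /=.
  rewrite (bigD1 s') //= eqxx mulr1 big1 ?addr0 // => s /negbTE ->.
  by rewrite mulr0.
under eq_bigr do rewrite mulr_sumr.
rewrite exchange_big -[RHS]IH; apply: eq_bigr => u _.
rewrite -(proj2 mu_stat u) mulr_suml; apply: eq_bigr => v _; exact: mulrA.
Qed.

Definition rowdist (k : nat) (s : S) : R := \sum_s' `|kernel_pow P k s s' - mu s'|.

Lemma rowdist_tv k s : rowdist k s = 2 * tv_dist (kernel_pow P k s) mu.
Proof. by rewrite /tv_dist mulrA divff ?mul1r. Qed.

Lemma rowdist_le_max k s : rowdist k s <= 2 * max_tv P mu k.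
Proof.
by rewrite rowdist_tv ler_wpM2l // /max_tv; exact: (le_bigmax _ (fun s => tv_dist _ _)).
Qed.

Lemma rowdist_le2 k s : rowdist k s <= 2.
Proof.
have -> : (2 : R) = \sum_s' (kernel_pow P k s s' + mu s').
  by rewrite big_split /= kernel_pow_sum1 mu_sum1.
apply: ler_sum => s' _; rewrite (le_trans (ler_normB _ _)) //.
by rewrite !ger0_norm ?kernel_pow_ge0.
Qed.

Lemma rowdist_mono a r s : rowdist (a + r) s <= rowdist a s.
Proof.
rewrite /rowdist; apply: le_trans (_ : \sum_s' \sum_u
   `|kernel_pow P a s u - mu u| * kernel_pow P r u s' <= _).
  apply: ler_sum => s' _; rewrite kernel_powD -(stationary_pow r s') -sumrB.
  apply: le_trans (ler_norm_sum _ _ _) _; apply: ler_sum => u _.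
  by rewrite -mulrBl normrM (ger0_norm (kernel_pow_ge0 _ _ _)).
rewrite exchange_big le_eqVlt; apply/orP; left; apply/eqP; apply: eq_bigr => u _.
by rewrite -mulr_sumr kernel_pow_sum1 mulr1.
Qed.

(** The rows of the difference sum to zero, so [mu] may be subtracted inside the second factor.
    Submultiplicativity without a factor [2] is the reason for working with the l1 distance, twice
    the total variation. *)
Lemma rowdist_mul a b A B : 0 <= B -> (forall s, rowdist a s <= A) ->
  (forall s, rowdist b s <= B) -> forall s, rowdist (a + b) s <= A * B.
Proof.
move=> B0 HA HB s; rewrite /rowdist; apply: le_trans (_ : \sum_s' \sum_u
   `|kernel_pow P a s u - mu u| * `|kernel_pow P b u s' - mu s'| <= _).
  apply: ler_sum => s' _.
  have -> : kernel_pow P (a + b) s s' - mu s' =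
      \sum_u (kernel_pow P a s u - mu u) * (kernel_pow P b u s' - mu s').
    under [RHS]eq_bigr do rewrite mulrBr.
    rewrite sumrB -mulr_suml sumrB kernel_pow_sum1 mu_sum1 subrr mul0r subr0.
    under [RHS]eq_bigr do rewrite mulrBl.
    by rewrite sumrB stationary_pow kernel_powD.
  by apply: le_trans (ler_norm_sum _ _ _) _; apply: ler_sum => u _; rewrite normrM.
rewrite exchange_big; apply: le_trans (ler_wpM2r B0 (HA s)).
rewrite /rowdist mulr_suml; apply: ler_sum => u _.
by rewrite -mulr_sumr ler_wpM2l //; exact: HB.
Qed.

Lemma rowdist_exp t A : 0 <= A -> (forall s, rowdist t s <= A) ->
  forall j k s, (j.+1 * t <= k)%N -> rowdist k s <= A ^+ j.+1.
Proof.
move=> A0 HA j k s jk; rewrite -(subnKC jk); apply: le_trans (rowdist_mono _ _ _) _.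
elim: j s {jk} => [|j IH] s; first by rewrite mul1n expr1.
by rewrite mulSn exprS; apply: rowdist_mul; rewrite ?exprn_ge0.
Qed.

(** Doeblin's argument: some power of the kernel is entrywise positive, hence dominates [eta * mu];
    the remainder has rows of mass [1 - eta], and each further block of [m] steps contracts the
    distance by that factor. *)
Lemma max_tv_cvg0 : irreducible P -> aperiodic P ->
  forall a, 0 < a -> exists k, max_tv P mu k <= a.
Proof.
move=> irr aper a a0; have [m Hm] := irreducible_aperiodic_positive irr aper.
have [eta [eta0 Heta]] : exists eta : R, 0 < eta /\
    forall s s', eta * mu s' <= kernel_pow P m s s'.
  exists (\big[Num.min/1]_(x : S * S) kernel_pow P m x.1 x.2); split.
    by apply: lt_bigmin => // x _; exact: Hm.
  move=> s s'; apply: le_trans (_ : kernel_pow P m s s' * 1 <= _); last by rewrite mulr1.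
  apply: ler_pM => //.
  - by apply: le_bigmin => [|x _]; rewrite ?kernel_pow_ge0.
  - exact: (bigmin_le_cond _ (fun x : S * S => kernel_pow P m x.1 x.2) (j := (s, s'))).
  - by rewrite -mu_sum1 (bigD1 s') //= lerDl sumr_ge0.
have eta1 : eta <= 1.
  have [s _|S0] := pickP (pred_of_simpl (@predT S)); last first.
    by move: mu_sum1; rewrite big_pred0 // => /eqP; rewrite eq_sym oner_eq0.
  have : \sum_s' eta * mu s' <= \sum_s' kernel_pow P m s s' by exact: ler_sum.
  by rewrite -mulr_sumr mu_sum1 mulr1 kernel_pow_sum1.
have q0 : 0 <= 1 - eta by rewrite subr_ge0.
have Hj j s : rowdist (j * m) s <= 2 * (1 - eta) ^+ j.
  elim: j s => [|j IH] s; first by rewrite mulr1 rowdist_le2.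
  rewrite mulSn addnC exprS mulrCA; apply: le_trans (ler_wpM2l q0 (IH s)).
  rewrite /rowdist mulr_sumr; apply: le_trans (_ : \sum_s' \sum_u
    `|kernel_pow P (j * m) s u - mu u| * (kernel_pow P m u s' - eta * mu s') <= _).
    apply: ler_sum => s' _.
    have -> : kernel_pow P (j * m + m) s s' - mu s' = \sum_u
       (kernel_pow P (j * m) s u - mu u) * (kernel_pow P m u s' - eta * mu s').
      under [RHS]eq_bigr do rewrite mulrBr.
      rewrite sumrB -mulr_suml sumrB kernel_pow_sum1 mu_sum1 subrr mul0r subr0.
      under [RHS]eq_bigr do rewrite mulrBl.
      by rewrite sumrB stationary_pow kernel_powD.
    apply: le_trans (ler_norm_sum _ _ _) _; apply: ler_sum => u _.
    by rewrite normrM (@ger0_norm _ (_ - eta * _)) // subr_ge0.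
  rewrite exchange_big le_eqVlt; apply/orP; left; apply/eqP; apply: eq_bigr => u _.
  by rewrite -mulr_sumr sumrB -mulr_sumr kernel_pow_sum1 mu_sum1 mulr1 mulrC.
have q1 : `|1 - eta| < 1 by rewrite ger0_norm //; lra.
have [j _ Hja] : exists2 j, True & (1 - eta) ^+ j <= a.
  have /cvgrPdist_le /(_ _ a0) [N _ HN] := cvg_expr q1.
  exists N => //; have := HN N (leqnn N); rewrite sub0r normrN ger0_norm //.
  exact: exprn_ge0.
exists (j * m)%N; apply: bigmax_le => [|s _]; first exact: ltW.
have := Hj j s; rewrite rowdist_tv; lra.
Qed.

Lemma stationary_gt0 : irreducible P -> forall s, 0 < mu s.
Proof.
move=> irr s'.
have [s ms] : exists s, 0 < mu s.
  apply: contrapT => nex.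
  have : \sum_s mu s <= \sum_(s : S) 0.
    by apply: ler_sum => s _; rewrite leNgt; apply/negP => ?; apply: nex; exists s.
  by rewrite mu_sum1 big1 // ler10.
have [k pk] := irr s s'; rewrite -(stationary_pow k s') (bigD1 s) //=.
apply: ltr_wpDr; last exact: mulr_gt0.
by apply: sumr_ge0 => v _; rewrite mulr_ge0 ?kernel_pow_ge0.
Qed.

Lemma mixing_timeP a : irreducible P -> aperiodic P -> 0 < a ->
  forall s, rowdist (mixing_time P mu a) s <= 2 * a.
Proof.
move=> irr aper a0 s; apply: le_trans (rowdist_le_max _ _) _.
rewrite ler_wpM2l // /mixing_time; case: pselect => [ex|nex].
  by case: ex_minnP.
by case: nex; exact: max_tv_cvg0.
Qed.

End MarkovChain.

(** * Variational characterization of the smallest eigenvalue *)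

Section SmallestEigenvalue.
Variables (R : realType) (d : nat).
Implicit Types (M N : 'M[R]_d) (x y : 'cV[R]_d).

Lemma dotp_mx m (u v : 'cV[R]_m) : dotp u v = (u^T *m v) ord0 ord0.
Proof. by rewrite mxE; apply: eq_bigr => i _; rewrite mxE. Qed.

Lemma dotp_adj m (A : 'M[R]_(m, d)) x (y : 'cV[R]_m) :
  dotp (A *m x) y = dotp x (A^T *m y).
Proof. by rewrite !dotp_mx trmx_mul mulmxA. Qed.

Lemma mulmx_bounded M : exists2 C, 0 < C &
  forall x, dotp (M *m x) (M *m x) <= C * dotp x x.
Proof.
exists (\sum_i dotp (row i M)^T (row i M)^T + 1).
  by rewrite ltr_wpDl // sumr_ge0 // => i _; exact: dotp_ge0.
move=> x; rewrite mulrDl mul1r mulr_suml.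
apply: ler_wpDr; first exact: dotp_ge0.
apply: ler_sum => i _; rewrite -expr2.
have -> : (M *m x) i ord0 = dotp (row i M)^T x.
  by rewrite mxE; apply: eq_bigr => j _; rewrite !mxE.
exact: dotp_CS.
Qed.

(** The form is tested on [x - D^-1 *: N x], a gradient step. With [D] bounding the form on [N x],
    nonnegativity yields [dotp (N x) (N x) / D] as a lower bound, and invertibility bounds [x] by
    [N x]. *)
Lemma psd_unit_coercive N : N^T = N -> (forall x, 0 <= dotp x (N *m x)) ->
  N \in unitmx -> exists2 e, 0 < e & forall x, e * dotp x x <= dotp x (N *m x).
Proof.
move=> Nsym Npsd Nu.
have [C C0 HC] := mulmx_bounded N; have [C' C'0 HC'] := mulmx_bounded (invmx N).
pose D := (1 + C) / 2; have D0 : 0 < D by rewrite /D; lra.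
exists (D * C')^-1; first by rewrite invr_gt0 mulr_gt0.
move=> x; pose y := N *m x.
have hx : dotp x x <= C' * dotp y y.
  by have := HC' y; rewrite /y mulmxA mulVmx // mul1mx.
have hy : dotp y (N *m y) <= D * dotp y y.
  have := dotp_ge0 (y - N *m y); have := HC y.
  rewrite !(dotpDl, dotpDr, dotpNl, dotpNr) (dotpC (N *m y) y) /D; lra.
have xy : dotp x (N *m y) = dotp y y by rewrite -{1}Nsym -dotp_adj.
have := Npsd (x - D^-1 *: y).
rewrite mulmxBr -scalemxAr.
rewrite !(dotpDl, dotpDr, dotpNl, dotpNr, dotpZl, dotpZr) -/y xy.
have : D^-1 * (D^-1 * dotp y (N *m y)) <= D^-1 * dotp y y.
  rewrite ler_wpM2l ?invr_ge0 ?(ltW D0) //.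
  by rewrite mulrC ler_pdivrMr // mulrC.
move=> h1 h2; rewrite invfM -mulrA mulrCA mulrC ler_pdivrMr //.
have : D^-1 * dotp x x <= D^-1 * (C' * dotp y y).
  by rewrite ler_wpM2l ?invr_ge0 ?(ltW D0).
have : D^-1 * dotp y y * C' <= dotp x (N *m x) * C'.
  rewrite ler_wpM2r ?(ltW C'0) //; lra.
lra.
Qed.

(** The supremum [m0] of the constants below the quadratic form is attained. If [M - m0] were
    invertible it would be coercive and [m0] could be raised; so [m0] is an eigenvalue, and testing
    the form on eigenvectors shows that none is smaller. *)
Lemma min_eigenvalueP M : (0 < d)%N -> M^T = M ->
  (forall x, 0 <= dotp x (M *m x)) ->
  eigenvalue M (min_eigenvalue M) /\
  forall x, min_eigenvalue M * dotp x x <= dotp x (M *m x).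
Proof.
move=> d0 Msym Mpsd.
pose E := [set a : R | forall x, a * dotp x x <= dotp x (M *m x)].
have E0 : E 0 by move=> x; rewrite mul0r.
pose e0 : 'cV[R]_d := \col_i (i == Ordinal d0)%:R.
have e0n : e0 != 0.
  apply/eqP => /matrixP /(_ (Ordinal d0) ord0); rewrite !mxE eqxx => /eqP.
  by rewrite oner_eq0.
have pos x : x != 0 -> 0 < dotp x x by move=> xn; rewrite lt_def dotp_eq0 xn dotp_ge0.
have ub x : x != 0 -> ubound E (dotp x (M *m x) / dotp x x).
  by move=> xn a Ea; rewrite ler_pdivlMr ?pos.
have supE : has_sup E by split; [exists 0|exists (dotp e0 (M *m e0) / dotp e0 e0); exact: ub].
pose m0 := sup E.
have Em0 : E m0.
  move=> x; have [->|xn] := eqVneq x 0; first by rewrite !dotp0r mulr0 mulmx0 dotp0r.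
  rewrite -ler_pdivlMr ?pos //; apply: ge_sup; [by exists 0|exact: ub].
pose N := M - m0%:M.
have NE x : dotp x (N *m x) = dotp x (M *m x) - m0 * dotp x x.
  by rewrite mulmxBl mul_scalar_mx dotpBr dotpZr.
have eig : eigenvalue M m0.
  rewrite /eigenvalue kermx_eq0 -/N row_free_unit; apply/negP => Nu.
  have Nsym : N^T = N by rewrite /N linearB /= tr_scalar_mx Msym.
  have Npsd x : 0 <= dotp x (N *m x) by rewrite NE subr_ge0; exact: Em0.
  have [e e_gt0 He] := psd_unit_coercive Nsym Npsd Nu.
  have : E (m0 + e) by move=> x; have := He x; rewrite NE; lra.
  by move=> /(ub_le_sup (proj2 supE)); rewrite -/m0; lra.
suff -> : min_eigenvalue M = m0 by split.
have lb : lbound [set a : R | eigenvalue M a] m0.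
  move=> a /= /eigenvalueP [v vM vn].
  have vTn : v^T != 0 by rewrite trmx_eq0.
  have := Em0 v^T.
  have -> : M *m v^T = a *: v^T by rewrite -{1}Msym -trmx_mul vM linearZ.
  by rewrite dotpZr ler_pM2r // pos.
apply/eqP; rewrite eq_le; apply/andP; split.
- by apply: ge_inf => //; exists m0.
- by apply: lb_le_inf => //; exists m0.
Qed.

End SmallestEigenvalue.

(** * The Gram matrix of the features and the weighted projection *)

Section FeatureGram.
Variables (R : realType) (S A : finType) (d : nat) (phi : S * A -> 'cV[R]_d).
Variables (mu : S -> R) (pib : S -> A -> R).

Let Phi := feature_mx phi.
Let G := gram_mx phi mu pib.
Let k := kappa mu pib.

Lemma feature_mxE w i : (Phi *m w) i ord0 = dotp (phi (enum_val i)) w.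
Proof. by rewrite mxE; apply: eq_bigr => j _; rewrite mxE. Qed.

Lemma kappa_mxE (v : 'cV[R]_#|{: S * A}|) i :
  (kappa_mx mu pib *m v) i ord0 = k (enum_val i) * v i ord0.
Proof. by rewrite mul_diag_mx !mxE. Qed.

Lemma sum_enum_val (T : finType) (F : T -> R) :
  \sum_(i < #|T|) F (enum_val i) = \sum_x F x.
Proof.
by rewrite [RHS](reindex (@enum_val T predT)) //; apply: onW_bij; exact: enum_val_bij.
Qed.

Lemma feature_kappa_dotp x (v : 'cV[R]_#|{: S * A}|) :
  dotp x (Phi^T *m (kappa_mx mu pib *m v)) =
  \sum_z k z * dotp (phi z) x * fun_of_vec v z.
Proof.
rewrite -dotp_adj -sum_enum_val; apply: eq_bigr => i _.
by rewrite feature_mxE kappa_mxE /fun_of_vec enum_valK; ring.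
Qed.

Lemma fun_of_vec_feature w : fun_of_vec (Phi *m w) = fun z => dotp (phi z) w.
Proof. by apply/funext => z; rewrite /fun_of_vec feature_mxE enum_rankK. Qed.

Lemma fun_of_vecK (Q : S * A -> R) : fun_of_vec (vec_of_fun Q) = Q.
Proof. by apply/funext => z; rewrite /fun_of_vec mxE enum_rankK. Qed.

Lemma gram_quad x : dotp x (G *m x) = \sum_z k z * dotp (phi z) x ^+ 2.
Proof.
rewrite /G /gram_mx -!mulmxA feature_kappa_dotp.
by apply: eq_bigr => z _; rewrite fun_of_vec_feature expr2 mulrA.
Qed.

Lemma gram_sym : G^T = G.
Proof. by rewrite /G /gram_mx !trmx_mul trmxK tr_diag_mx mulmxA. Qed.

Hypothesis d_gt0 : (0 < d)%N.
Hypothesis phi_free : row_free Phi^T.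
Hypothesis k_gt0 : forall z, 0 < k z.

Lemma gram_quad_gt0 x : x != 0 -> 0 < dotp x (G *m x).
Proof.
move=> xn; rewrite gram_quad lt_def andbC sumr_ge0 /= => [|z _]; last first.
  by rewrite mulr_ge0 ?sqr_ge0 ?(ltW (k_gt0 _)).
apply: contra xn; rewrite psumr_eq0 => [|z _]; last first.
  by rewrite mulr_ge0 ?sqr_ge0 ?(ltW (k_gt0 _)).
move=> /allP h; have : x^T *m Phi^T == 0.
  rewrite -trmx_mul trmx_eq0; apply/eqP/matrixP => i j; rewrite (ord1 j) feature_mxE mxE.
  have := h (enum_val i) (mem_index_enum _).
  by rewrite mulf_eq0 gt_eqF //= sqrf_eq0 => /eqP.
by rewrite mulmx_free_eq0 // trmx_eq0.
Qed.

Lemma gram_unit : G \in unitmx.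
Proof.
rewrite -row_free_unit -kermx_eq0; apply: contraT => /rowV0Pn[v /sub_kermxP vG vn].
have /gram_quad_gt0 : v^T != 0 by rewrite trmx_eq0.
by rewrite -{1}gram_sym -trmx_mul vG trmx0 dotp0r ltxx.
Qed.

(** The normal equations: multiplying the fixed-point equation by [Phi^T *m kappa_mx] cancels the
    inverse Gram matrix, so the residual is orthogonal to the feature span. *)
Lemma projection_orthogonal (Q : S * A -> R) w x :
  Phi *m w = proj_mx_kappa phi mu pib *m vec_of_fun Q ->
  \sum_z k z * dotp (phi z) x * (Q z - dotp (phi z) w) = 0.
Proof.
move=> Hw.
have H : G *m w = Phi^T *m (kappa_mx mu pib *m vec_of_fun Q).
  have -> : G *m w = Phi^T *m (kappa_mx mu pib *m (Phi *m w)).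
    by rewrite /G /gram_mx !mulmxA.
  rewrite Hw /proj_mx_kappa -/Phi -/G !mulmxA -[Phi^T *m _ *m Phi]/G mulmxV ?gram_unit //.
  by rewrite mul1mx.
under eq_bigr do rewrite mulrBr.
rewrite sumrB -[X in X - _](_ : dotp x (G *m w) = _); last first.
  rewrite H feature_kappa_dotp fun_of_vecK //.
rewrite /G /gram_mx -!mulmxA feature_kappa_dotp fun_of_vec_feature subrr //.
Qed.

Lemma min_eigenvalue_gram_gt0 : 0 < min_eigenvalue G.
Proof.
have psd x : 0 <= dotp x (G *m x).
  have [->|/gram_quad_gt0/ltW //] := eqVneq x 0.
  by rewrite mulmx0 dotp0r.
have [/eigenvalueP[v vG vn] _] := min_eigenvalueP d_gt0 gram_sym psd.
have vTn : v^T != 0 by rewrite trmx_eq0.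
have := gram_quad_gt0 vTn.
rewrite -{1}gram_sym -trmx_mul vG linearZ dotpZr pmulr_lgt0 //.
by rewrite lt_def dotp_eq0 vTn dotp_ge0.
Qed.

Lemma min_eigenvalue_gram_le x :
  min_eigenvalue G * norm2 x ^+ 2 <= \sum_z k z * dotp (phi z) x ^+ 2.
Proof.
have psd y : 0 <= dotp y (G *m y).
  have [->|/gram_quad_gt0/ltW //] := eqVneq y 0.
  by rewrite mulmx0 dotp0r.
by rewrite norm2_sqr -gram_quad; case: (min_eigenvalueP d_gt0 gram_sym psd).
Qed.

Lemma min_eigenvalue_gram_le1 : is_pmf k -> (forall z, norm2 (phi z) <= 1) ->
  min_eigenvalue G <= 1.
Proof.
move=> [k0 k1] phi1; pose e : 'cV[R]_d := \col_i (i == Ordinal d_gt0)%:R.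
have en : 0 < norm2 e ^+ 2.
  rewrite norm2_sqr lt_def dotp_eq0 dotp_ge0 andbT.
  apply/eqP => /matrixP /(_ (Ordinal d_gt0) ord0); rewrite !mxE eqxx => /eqP.
  by rewrite oner_eq0.
rewrite -(ler_pM2r en); apply: le_trans (min_eigenvalue_gram_le e) _.
rewrite -k1 mulr_suml; apply: ler_sum => z _; rewrite ler_wpM2l //.
rewrite -real_normK ?num_real // ler_sqr ?nnegrE ?norm2_ge0 //.
exact: dotp_le_norm2.
Qed.

End FeatureGram.

(** * The chain of state-action pairs and its windows *)

Section SlidingWindow.
Variables (R : realType) (S A : finType).
Variables (P : A -> S -> S -> R) (pib : S -> A -> R) (mu : S -> R).
Variables (p : S * A -> R) (n : nat) (y0 : S * A).
Hypothesis P_stoch : forall a, is_stochastic (P a).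
Hypothesis pib_stoch : is_stochastic pib.
Hypothesis p_pmf : is_pmf p.
Hypothesis mu_stat : stationary (induced_kernel P pib) mu.

Let X : finType := (S * A)%type.
Let Z : finType := {ffun 'I_n.+1 -> X}.
Let Pb := induced_kernel P pib.

Definition pair_kernel (x y : S * A) : R := P x.2 x.1 y.1 * pib y.1 y.2.

Definition next_law (h : seq (S * A)) (y : S * A) : R :=
  if h is x :: _ then pair_kernel x y else p y.

(** Index [0] is the newest pair and [ord_max] the oldest, the one at which the update is made; [y0]
    only pads histories that are too short. *)
Definition window (h : seq (S * A)) : {ffun 'I_n.+1 -> S * A} :=
  [ffun i : 'I_n.+1 => nth y0 h i].

Definition window_law (x : S * A) (z : {ffun 'I_n.+1 -> S * A}) : R :=
  cprob next_law window n [:: x] z.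

Definition stat_window (z : {ffun 'I_n.+1 -> S * A}) : R :=
  \sum_x kappa mu pib x * window_law x z.

Lemma sum_pair (F : S -> A -> R) : \sum_(x : S * A) F x.1 x.2 = \sum_s \sum_a F s a.
Proof. by rewrite pair_bigA. Qed.

Lemma pair_kernel_stoch : is_stochastic pair_kernel.
Proof.
move=> x; split=> [y|].
  by rewrite mulr_ge0 //; [case: (P_stoch x.2 x.1)|case: (pib_stoch y.1)].
rewrite (sum_pair (fun s a => P x.2 x.1 s * pib s a)).
rewrite -(proj2 (P_stoch x.2 x.1)); apply: eq_bigr => s _.
by rewrite -mulr_sumr (proj2 (pib_stoch s)) mulr1.
Qed.

Lemma induced_kernel_stoch : is_stochastic (induced_kernel P pib).
Proof.
move=> s; split=> [s'|].
  apply: sumr_ge0 => a _.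
  by rewrite mulr_ge0 //; [case: (pib_stoch s)|case: (P_stoch a s)].
rewrite exchange_big -(proj2 (pib_stoch s)); apply: eq_bigr => a _.
by rewrite -mulr_sumr (proj2 (P_stoch a s)) mulr1.
Qed.

Lemma next_law_pmf h : is_pmf (next_law h).
Proof. by case: h => [|x h] //; exact: pair_kernel_stoch. Qed.

Lemma kappa_pmf : is_pmf (kappa mu pib).
Proof.
split=> [x|].
  by rewrite mulr_ge0 //; [case: mu_stat => -[]|case: (pib_stoch x.1)].
rewrite (sum_pair (fun s a => mu s * pib s a)) -(proj2 (proj1 mu_stat)).
by apply: eq_bigr => s _; rewrite -mulr_sumr (proj2 (pib_stoch s)) mulr1.
Qed.

Lemma kappa_stationary : stationary pair_kernel (kappa mu pib).
Proof.
split; first exact: kappa_pmf.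
move=> y; rewrite /kappa /pair_kernel.
rewrite (sum_pair (fun s a => mu s * pib s a * (P a s y.1 * pib y.1 y.2))).
rewrite -(proj2 mu_stat y.1) mulr_suml; apply: eq_bigr => s _.
rewrite /induced_kernel mulr_sumr mulr_suml; apply: eq_bigr => a _; ring.
Qed.

(** The first action is already fixed and the last is drawn afresh, so [l.+1] steps of the pair
    chain contain [l] free steps of the state chain. This is the source of one of the units added to
    the mixing time. *)
Lemma pair_kernel_pow l x y : kernel_pow pair_kernel l.+1 x y =
  \sum_s P x.2 x.1 s * kernel_pow Pb l s y.1 * pib y.1 y.2.
Proof.
elim: l x => [|l IH] x.
  rewrite /= (bigD1 y) //= eqxx mulr1 big1 ?addr0 => [|u /negbTE ->]; last by rewrite mulr0.
  rewrite (bigD1 y.1) //= eqxx mulr1 big1 ?addr0 => [//|s /negbTE ->].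
  by rewrite mulr0 mul0r.
transitivity (\sum_u pair_kernel x u * kernel_pow pair_kernel l.+1 u y); first by [].
under eq_bigr do rewrite IH.
rewrite (sum_pair (fun s a => P x.2 x.1 s * pib s a *
   \sum_s1 P a s s1 * kernel_pow Pb l s1 y.1 * pib y.1 y.2)).
apply: eq_bigr => s _ /=; under eq_bigr do rewrite mulr_sumr.
rewrite exchange_big mulr_sumr mulr_suml; apply: eq_bigr => s1 _.
rewrite /Pb /induced_kernel mulr_suml mulr_sumr mulr_suml.
by apply: eq_bigr => a _; rewrite /=; ring.
Qed.

Lemma pair_kernel_dist l x b : (forall s, rowdist Pb mu l s <= b) ->
  \sum_y `|kernel_pow pair_kernel l.+1 x y - kappa mu pib y| <= b.
Proof.
move=> Hb.
apply: le_trans (_ : \sum_y \sum_s P x.2 x.1 s *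
   (`|kernel_pow Pb l s y.1 - mu y.1| * pib y.1 y.2) <= _).
  apply: ler_sum => y _; rewrite pair_kernel_pow /kappa.
  rewrite -[mu y.1 * _]mul1r -(proj2 (P_stoch x.2 x.1)) mulr_suml -sumrB.
  apply: le_trans (ler_norm_sum _ _ _) _; apply: ler_sum => s _.
  rewrite -mulrA -mulrBr -mulrBl !normrM (@ger0_norm _ (P _ _ _)).
    by rewrite (@ger0_norm _ (pib _ _)) //; case: (pib_stoch y.1).
  by case: (P_stoch x.2 x.1).
rewrite exchange_big /=.
apply: le_trans (_ : \sum_s P x.2 x.1 s * b <= _); last first.
  by rewrite -mulr_suml (proj2 (P_stoch x.2 x.1)) mul1r.
apply: ler_sum => s _; rewrite -mulr_sumr ler_wpM2l //.
  by case: (P_stoch x.2 x.1).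
apply: le_trans (Hb s).
rewrite (sum_pair (fun s' a => `|kernel_pow Pb l s s' - mu s'| * pib s' a)).
apply: ler_sum => s' _.
by rewrite -mulr_sumr (proj2 (pib_stoch s')) mulr1.
Qed.

Lemma cexp_markov m G G' x h h' :
  (forall q, size q = m -> G (q ++ x :: h) = G' (q ++ x :: h')) ->
  cexp next_law m G (x :: h) = cexp next_law m G' (x :: h').
Proof.
elim: m x h h' => [|m IH] x h h' H; first exact: (H [::]).
rewrite !cexpS; apply: eq_bigr => y _; congr (_ * _); apply: IH => q sq.
by rewrite -!(cat_rcons y); apply: H; rewrite size_rcons sq.
Qed.

Lemma cexp_head l (F : S * A -> R) x h :
  cexp next_law l (fun h' => F (head y0 h')) (x :: h) =
  \sum_y kernel_pow pair_kernel l x y * F y.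
Proof.
elim: l x h => [|l IH] x h.
  rewrite /= (bigD1 x) //= eqxx mul1r big1 ?addr0 // => y /negbTE.
  by rewrite eq_sym => ->; rewrite mul0r.
rewrite cexpS /=; under [RHS]eq_bigr do rewrite mulr_suml.
rewrite exchange_big; apply: eq_bigr => u _; rewrite IH mulr_sumr.
by apply: eq_bigr => y _; rewrite mulrA.
Qed.

Lemma window_cat q x h i : size q = n ->
  window (q ++ x :: h) i = nth y0 (rcons q x) i.
Proof.
move=> sq; rewrite ffunE nth_rcons nth_cat sq.
case: ltngtP => // [ni|->]; last by rewrite subnn.
by have := ltn_ord i; rewrite ltnS leqNgt ni.
Qed.

Lemma cexp_window g x h :
  cexp next_law n (fun h' => g (window h')) (x :: h) =
  \sum_z window_law x z * g z.
Proof.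
rewrite -cexp_win; apply: cexp_markov => q sq; congr g.
by apply/ffunP => i; rewrite !window_cat.
Qed.

Lemma cprob_window l x h z : cprob next_law window (n + l) (x :: h) z =
  \sum_y kernel_pow pair_kernel l x y * window_law y z.
Proof.
rewrite /cprob addnC cexp_add -(cexp_head l (window_law^~ z) x h).
apply: eq_cexp => q _; rewrite (_ : q ++ x :: h = head x (q ++ x :: h) :: behead (q ++ x :: h)).
  by apply: cexp_markov => u su; congr (_ == z)%:R; apply/ffunP => i; rewrite !window_cat.
by case: q.
Qed.

Lemma window_law_ge0 x z : 0 <= window_law x z.
Proof. exact: (cprob_ge0 next_law_pmf). Qed.

Lemma window_law_sum1 x : \sum_z window_law x z = 1.
Proof. exact: (cprob_sum1 next_law_pmf). Qed.

Lemma stat_window_sum (F : {ffun 'I_n.+1 -> S * A} -> R) :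
  \sum_z stat_window z * F z =
  \sum_x kappa mu pib x * cexp next_law n (fun h => F (window h)) [:: x].
Proof.
under [RHS]eq_bigr do rewrite cexp_window mulr_sumr.
rewrite exchange_big; apply: eq_bigr => z _; rewrite mulr_suml.
by apply: eq_bigr => x _; rewrite mulrA.
Qed.

Lemma stat_window_pmf : is_pmf stat_window.
Proof.
split=> [z|].
  apply: sumr_ge0 => x _; rewrite mulr_ge0 ?window_law_ge0 //.
  by case: kappa_pmf.
rewrite exchange_big -(proj2 kappa_pmf); apply: eq_bigr => x _.
by rewrite -mulr_sumr window_law_sum1 mulr1.
Qed.

Lemma window_mixing2 m h : \sum_z `|cprob next_law window m h z - stat_window z| <= 2.
Proof.
have -> : (2 : R) = \sum_z (cprob next_law window m h z + stat_window z).
  by rewrite big_split /= (cprob_sum1 next_law_pmf) (proj2 stat_window_pmf).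
apply: ler_sum => z _; rewrite (le_trans (ler_normB _ _)) //.
by rewrite !ger0_norm ?(cprob_ge0 next_law_pmf) //; case: stat_window_pmf.
Qed.

(** The pair reached after [l.+1] steps becomes the oldest of the window, and the last [n] letters
    complete the window by a kernel depending on that pair alone; such a kernel cannot increase the
    distance. *)
Lemma window_mixing l h b : (0 < size h)%N -> (forall s, rowdist Pb mu l s <= b) ->
  \sum_z `|cprob next_law window (n + l.+1) h z - stat_window z| <= b.
Proof.
case: h => // x h _ Hb.
apply: le_trans (pair_kernel_dist x Hb).
apply: le_trans (_ : \sum_z \sum_y
   `|kernel_pow pair_kernel l.+1 x y - kappa mu pib y| * window_law y z <= _).
  apply: ler_sum => z _; rewrite cprob_window /stat_window -sumrB.
  apply: le_trans (ler_norm_sum _ _ _) _; apply: ler_sum => y _.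
  by rewrite -mulrBl normrM (ger0_norm (window_law_ge0 _ _)).
rewrite exchange_big le_eqVlt; apply/orP; left; apply/eqP; apply: eq_bigr => y _.
by rewrite -mulr_sumr window_law_sum1 mulr1.
Qed.

(** From the empty history one more letter is spent on the first pair, drawn from [p]; averaging
    over it preserves the bound. *)
Lemma window_mixing_init l b : (forall s, rowdist Pb mu l s <= b) ->
  \sum_z `|cprob next_law window (n + l.+2) [::] z - stat_window z| <= b.
Proof.
move=> Hb; apply: le_trans (_ : \sum_y p y * b <= _); last first.
  by rewrite -mulr_suml (proj2 p_pmf) mul1r.
apply: le_trans (_ : \sum_y p y *
   \sum_z `|cprob next_law window (n + l.+1) [:: y] z - stat_window z| <= _); last first.
  apply: ler_sum => y _; rewrite ler_wpM2l //; first by case: p_pmf.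
  exact: window_mixing.
under [leRHS]eq_bigr do rewrite mulr_sumr.
rewrite exchange_big /=; apply: ler_sum => z _.
rewrite addnS cprob_step.
have E : stat_window z = \sum_y p y * stat_window z.
  by rewrite -mulr_suml (proj2 p_pmf) mul1r.
rewrite [X in `|_ - X| <= _]E -sumrB; apply: le_trans (ler_norm_sum _ _ _) _.
apply: ler_sum => y _; rewrite -mulrBr normrM (@ger0_norm _ (p y)) //.
by case: p_pmf.
Qed.

Lemma window_last q x h : size q = n -> window (q ++ x :: h) ord_max = x.
Proof. by move=> sq; rewrite window_cat // -[nat_of_ord _]sq nth_rcons ltnn eqxx. Qed.

Lemma window_head h : window h ord0 = head y0 h.
Proof. by rewrite ffunE /= nth0. Qed.

Lemma stat_window_last (F : S * A -> R) :
  \sum_z stat_window z * F (z ord_max) = \sum_x kappa mu pib x * F x.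
Proof.
rewrite (stat_window_sum (fun z => F (z ord_max))); apply: eq_bigr => x _.
congr (_ * _); rewrite -[RHS](cexp_cst next_law_pmf n _ [:: x]).
by apply: eq_cexp => q sq; rewrite window_last.
Qed.

(** The newest pair of a stationary window again has law [kappa], by stationarity over [n] steps.
    Hence the features at both ends define the same seminorm. *)
Lemma stat_window_head (F : S * A -> R) :
  \sum_z stat_window z * F (z ord0) = \sum_x kappa mu pib x * F x.
Proof.
rewrite (stat_window_sum (fun z => F (z ord0))).
under eq_bigr => x _.
  have -> : cexp next_law n (fun h => F (window h ord0)) [:: x] =
    \sum_y kernel_pow pair_kernel n x y * F y.
    rewrite -(cexp_head n F x [::]); apply: eq_cexp => q _; congr F.
    exact: window_head.
  rewrite mulr_sumr; over.
rewrite exchange_big /=; apply: eq_bigr => y _.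
rewrite -(stationary_pow kappa_stationary n y) mulr_suml.
by apply: eq_bigr => x _; rewrite mulrA.
Qed.

End SlidingWindow.

(** * The n-step temporal difference error *)

Section TDError.
Variables (R : realType) (S A : finType) (d : nat).
Variables (r : S -> A -> R) (gamma : R) (pi pib : S -> A -> R).
Variable (phi : S * A -> 'cV[R]_d).

Local Notation rho := (is_ratio pi pib).

Definition trace_coef (x : nat -> S * A) (i : nat) : R :=
  gamma ^+ i * \prod_(1 <= j < i.+1) rho (x j).

Lemma nstep_td_error_shift n x w k :
  nstep_td_error r gamma pi pib phi n x w k =
  nstep_td_error r gamma pi pib phi n (fun i => x (k + i)%N) w 0.
Proof.
rewrite /nstep_td_error add0n -{1}[k]add0n [(k + n)%N]addnC big_addn addnK.
apply: eq_big_nat => i _; rewrite addnK subn0.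
congr (_ * _ * _); last by rewrite /td_error addnC addnS.
have -> : \prod_(k.+1 <= j < (i + k).+1) rho (x j) =
    \prod_(1 + k <= j < i.+1 + k) rho (x j) by [].
by rewrite big_addn addnK; apply: eq_bigr => j _; rewrite addnC.
Qed.

Lemma eq_nstep_td_error n x x' w : (forall i, (i <= n)%N -> x i = x' i) ->
  nstep_td_error r gamma pi pib phi n x w 0 =
  nstep_td_error r gamma pi pib phi n x' w 0.
Proof.
move=> H; apply: eq_big_nat => i /andP[_]; rewrite add0n => ni.
congr (_ * _ * _); last by rewrite /td_error !H // ltnW.
apply: eq_big_nat => j /andP[_ ji]; rewrite H //.
by rewrite -ltnS (leq_trans ji) // ltnW.
Qed.

(** The discounted ratio carried by the bootstrap term of step [i] is the trace coefficient of step
    [i.+1], so all intermediate values cancel. The sum of all coefficients is then bounded by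
    [geom], the origin of [f]. *)
Lemma nstep_td_error_telescope n x w :
  nstep_td_error r gamma pi pib phi n x w 0 =
  trace_coef x n * dotp (phi (x n)) w - dotp (phi (x 0%N)) w +
  \sum_(0 <= i < n) trace_coef x i * r (x i).1 (x i).2.
Proof.
have -> : trace_coef x n * dotp (phi (x n)) w - dotp (phi (x 0%N)) w =
    \sum_(0 <= i < n) (trace_coef x i.+1 * dotp (phi (x i.+1)) w -
                       trace_coef x i * dotp (phi (x i)) w).
  rewrite telescope_sumr // {3}/trace_coef expr0 big_geq // !mul1r.
  by [].
rewrite -big_split /nstep_td_error add0n; apply: eq_bigr => i _ /=.
rewrite subn0 -/(trace_coef x i) /td_error {2}/trace_coef exprS big_nat_recr //=.
rewrite [trace_coef x i]/trace_coef; ring.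
Qed.

Lemma nstep_td_errorS n x w :
  nstep_td_error r gamma pi pib phi n.+1 x w 0 =
  td_error r gamma pi pib phi x w 0 +
  gamma * rho (x 1%N) *
    nstep_td_error r gamma pi pib phi n (fun i => x i.+1) w 0.
Proof.
rewrite /nstep_td_error !add0n big_nat_recl // big_geq // subn0 expr0 !mul1r.
congr (_ + _); rewrite mulr_sumr; apply: eq_bigr => i _.
rewrite !subn0 exprS big_nat_recl // -/(td_error _ _ _ _ _ _ _ _).
by rewrite /td_error; ring.
Qed.

Variables (P : A -> S -> S -> R).

Lemma bellman_lip Q1 Q2 M : is_stochastic pi -> (forall a, is_stochastic (P a)) ->
  0 <= gamma -> (forall x, `|Q1 x - Q2 x| <= M) ->
  forall x, `|bellman P r gamma pi Q1 x - bellman P r gamma pi Q2 x| <= gamma * M.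
Proof.
move=> pi_st P_st g0 HM x; rewrite /bellman opprD addrACA subrr add0r -mulrBr.
rewrite normrM (ger0_norm g0) ler_wpM2l //.
have E : \sum_s' \sum_a' P x.2 x.1 s' * pi s' a' * M = M.
  under eq_bigr do rewrite -mulr_suml -mulr_sumr (proj2 (pi_st _)) mulr1.
  by rewrite -mulr_suml (proj2 (P_st _ _)) mul1r.
rewrite -[leRHS]E -sumrB; apply: le_trans (ler_norm_sum _ _ _) _.
apply: ler_sum => s _; rewrite -sumrB; apply: le_trans (ler_norm_sum _ _ _) _.
apply: ler_sum => a _; rewrite -mulrBr normrM.
have w0 : 0 <= P x.2 x.1 s * pi s a.
  by rewrite mulr_ge0 //; [case: (P_st x.2 x.1)|case: (pi_st s)].
by rewrite (ger0_norm w0) ler_wpM2l.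
Qed.

Lemma bellman_iter_lip n Q1 Q2 M : is_stochastic pi -> (forall a, is_stochastic (P a)) ->
  0 <= gamma -> (forall x, `|Q1 x - Q2 x| <= M) ->
  forall x, `|iter n (bellman P r gamma pi) Q1 x - iter n (bellman P r gamma pi) Q2 x|
    <= gamma ^+ n * M.
Proof.
move=> pi_st P_st g0 HM; elim: n => [|n IH] x; first by rewrite expr0 mul1r; exact: HM.
by rewrite exprS -mulrA; apply: bellman_lip.
Qed.

(* Importance sampling: the ratios turn the expectation under the behavior
   policy into the target Bellman operator, one letter at a time. *)
Lemma cexp_nstep_td_error (p : S * A -> R) (y0 : S * A) n w y h :
  is_pmf p -> is_stochastic pib -> (forall a, is_stochastic (P a)) ->
  (forall s a, 0 < pib s a) ->
  cexp (next_law P pib p) n (fun h' =>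
    nstep_td_error r gamma pi pib phi n (fun i => nth y0 h' (n - i)) w 0) (y :: h) =
  iter n (bellman P r gamma pi) (fun x => dotp (phi x) w) y - dotp (phi y) w.
Proof.
move=> p_pmf pib_st P_st pib0.
have Kp := next_law_pmf P_st pib_st p_pmf.
elim: n y h => [|n IH] y h.
  by rewrite cexp0 subrr /nstep_td_error big_geq.
pose Qn := iter n (bellman P r gamma pi) (fun x => dotp (phi x) w).
have step y1 : cexp (next_law P pib p) n (fun h' =>
    nstep_td_error r gamma pi pib phi n.+1 (fun i => nth y0 h' (n.+1 - i)) w 0)
      [:: y1, y & h] =
    r y.1 y.2 - dotp (phi y) w + gamma * rho y1 * Qn y1.
  pose a := r y.1 y.2 + gamma * rho y1 * dotp (phi y1) w - dotp (phi y) w.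
  transitivity (cexp (next_law P pib p) n (fun h' => a + gamma * rho y1 *
      nstep_td_error r gamma pi pib phi n (fun i => nth y0 h' (n - i)) w 0)
      [:: y1, y & h]).
    apply: eq_cexp => q sq; rewrite nstep_td_errorS.
    have e1 : nth y0 (q ++ [:: y1, y & h]) n = y1 by rewrite nth_cat sq ltnn subnn.
    have e0 : nth y0 (q ++ [:: y1, y & h]) n.+1 = y.
      by rewrite nth_cat sq ltnNge leqnSn subSnn.
    by rewrite /td_error subn0 subSS subn0 e1 e0.
  by rewrite cexpD (cexp_cst Kp) cexpZ IH /a -/Qn; ring.
rewrite cexpS; under eq_bigr do rewrite step.
under eq_bigr do rewrite mulrDr.
rewrite big_split /= -mulr_suml (proj2 (Kp (y :: h))) mul1r.
have -> : \sum_y1 pair_kernel P pib y y1 * (gamma * rho y1 * Qn y1) =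
    gamma * \sum_s' \sum_a' P y.2 y.1 s' * pi s' a' * Qn (s', a').
  rewrite -(sum_pair (fun s' a' => P y.2 y.1 s' * pi s' a' * Qn (s', a'))) mulr_sumr.
  apply: eq_bigr => -[s a] _; rewrite /pair_kernel /is_ratio /=; field.
  by rewrite gt_eqF.
by rewrite /bellman -/Qn; ring.
Qed.

Lemma geomE n x : geom n x = \sum_(0 <= i < n.+1) x ^+ i :> R.
Proof.
rewrite /geom; case: eqVneq => [->|x1].
  by under eq_bigr do rewrite expr1n; rewrite big_const_nat subn0 iter_addr addr0.
have x0 : 1 - x != 0 by rewrite subr_eq0 eq_sym.
apply: (mulIf x0); rewrite mulfVK // -[1 - _]opprB subrX1 big_mkord.
by rewrite -mulNr opprB mulrC.
Qed.

Lemma is_ratio_bnd x : (forall s a, 0 < pib s a) -> is_stochastic pi ->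
  0 <= rho x <= max_ratio pi pib.
Proof.
move=> pib0 pi_st; apply/andP; split.
  by rewrite divr_ge0 ?(ltW (pib0 _ _)) //; case: (pi_st x.1).
exact: (le_bigmax _ rho).
Qed.

Lemma trace_coef_bnd x i : 0 <= gamma -> (forall s a, 0 < pib s a) ->
  is_stochastic pi -> 0 <= trace_coef x i <= (gamma * max_ratio pi pib) ^+ i.
Proof.
move=> g0 pib0 pi_st.
have H : 0 <= \prod_(1 <= j < i.+1) rho (x j) <= max_ratio pi pib ^+ i.
  elim: i => [|i /andP[h0 h1]]; first by rewrite big_geq // expr0 ler01 lexx.
  rewrite big_nat_recr //= exprSr.
  have /andP[r0 r1] := is_ratio_bnd (x i.+1) pib0 pi_st.
  by rewrite mulr_ge0 //= ler_pM.
case/andP: H => h0 h1; rewrite /trace_coef exprMn mulr_ge0 ?exprn_ge0 //=.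
by rewrite ler_wpM2l ?exprn_ge0.
Qed.

End TDError.

(** * From the probability space to finite sums over histories *)

Section TrajectoryLaw.
Variables (R : realType) (S A : finType) (P : A -> S -> S -> R) (pib : S -> A -> R).
Variables (disp : measure_display) (T : measurableType disp) (Pr : probability T R).
Variables (St : nat -> T -> S) (Ac : nat -> T -> A) (y0 : S * A).
Hypothesis traj : is_trajectory P pib Pr St Ac.

Definition past (k : nat) (o : T) : seq (S * A) :=
  [seq (St i o, Ac i o) | i <- rev (iota 0 k)].

Lemma pastS k o : past k.+1 o = (St k o, Ac k o) :: past k o.
Proof. by rewrite /past -addn1 iotaD rev_cat. Qed.

Lemma size_past k o : size (past k o) = k.
Proof. by rewrite size_map size_rev size_iota. Qed.

Lemma nth_past k o i : (i < k)%N -> nth y0 (past k o) i = (St (k - i.+1) o, Ac (k - i.+1) o).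
Proof.
move=> ik; rewrite (nth_map 0%N) ?size_rev ?size_iota // nth_rev ?size_iota //.
by rewrite nth_iota // ltn_subrL (leq_ltn_trans _ ik).
Qed.

Definition past_event (q : seq (S * A)) : set T := [set o | past (size q) o = q].

Lemma past_event_cons y q : past_event (y :: q) =
  past_event q `&` St (size q) @^-1` [set y.1] `&` Ac (size q) @^-1` [set y.2].
Proof.
case: y => s a; apply/seteqP; split => o; rewrite /past_event /= pastS.
  by move=> [<- <- ->].
by move=> [[-> ->] ->].
Qed.

Lemma measurable_past_event q : measurable (past_event q).
Proof.
have [mS mA _ _] := traj.
elim: q => [|y q IH]; last first.
  by rewrite past_event_cons; apply: measurableI => //; apply: measurableI.
rewrite (_ : past_event [::] = setT) //.
by apply/seteqP; split.
Qed.

(** The trajectory axioms speak of functions of time while histories are lists with the newest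
    letter first; [seqS] and [seqA] read a list in chronological order. *)
Let seqS (q : seq (S * A)) i := (nth y0 q (size q - i.+1)).1.
Let seqA (q : seq (S * A)) i := (nth y0 q (size q - i.+1)).2.

Lemma past_event_history y q :
  history St Ac (size q) (seqS (y :: q)) (seqA (y :: q)) = past_event q.
Proof.
apply/seteqP; split => o /=.
  move=> H; apply: (@eq_from_nth _ y0); rewrite ?size_past // => i iq.
  rewrite nth_past //; have jq : (size q - i.+1 < size q)%N.
    by rewrite ltn_subrL (leq_ltn_trans _ iq).
  by have [-> ->] := H _ jq; rewrite /seqS /seqA /= subSS subKn //= -surjective_pairing.
move=> H i iq; rewrite /seqS /seqA /= subSS.
have e : (size q - i = (size q - i.+1).+1)%N by rewrite subnSK.
have jq : (size q - i.+1 < size q)%N by rewrite ltn_subrL (leq_ltn_trans _ iq).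
have := nth_past o jq; rewrite H -e subKn ?(ltnW iq) // => E.
by rewrite e /= E.
Qed.

(** The initial law is not prescribed, so it is read off from the trajectory and serves as the law
    of the next letter after the empty history. *)
Definition first_law (y : S * A) : R := fine (Pr (past_event [:: y])).

Lemma prob_past_event_cons y q :
  fine (Pr (past_event (y :: q))) =
  fine (Pr (past_event q)) * next_law P pib first_law q y.
Proof.
have [mS mA hA hS] := traj.
case: q => [|x q].
  rewrite (_ : past_event [::] = setT); last by apply/seteqP; split.
  by rewrite probability_setT mul1r.
have mq := measurable_past_event (x :: q).
have sy : seqS [:: y, x & q] (size (x :: q)) = y.1 by rewrite /seqS /= subSS subnn.
have ay : seqA [:: y, x & q] (size (x :: q)) = y.2 by rewrite /seqA /= subSS subnn.
have := hA (size (x :: q)) (seqS [:: y, x & q]) (seqA [:: y, x & q]).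
rewrite past_event_history sy ay -past_event_cons => ->.
have := hS (size q) (seqS [:: y, x & q]) (seqA [:: y, x & q]).
rewrite -[(size q).+1]/(size (x :: q)) past_event_history sy => ->.
have sx : seqS [:: y, x & q] (size q) = x.1 by rewrite /seqS /= subSS subSnn.
have ax : seqA [:: y, x & q] (size q) = x.2 by rewrite /seqA /= subSS subSnn.
rewrite sx ax /next_law /pair_kernel.
by rewrite -(fineK (fin_num_measure Pr _ mq)) -!EFinM /= mulrA.
Qed.

Lemma sum_tuple_cons (X : finType) k (F : seq X -> R) :
  \sum_(q : k.+1.-tuple X) F q = \sum_(q : k.-tuple X) \sum_y F (y :: q).
Proof.
rewrite exchange_big pair_big /=.
rewrite (reindex (fun yq : X * k.-tuple X => [tuple of yq.1 :: yq.2])) //=.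
exists (fun q : k.+1.-tuple X => (thead q, [tuple of behead q])) => [[y q] _|q _].
  by congr pair; apply/val_inj.
by rewrite /= -tuple_eta.
Qed.

Lemma cexp_past k (G : seq (S * A) -> R) :
  cexp (next_law P pib first_law) k G [::] =
  \sum_(q : k.-tuple (S * A)) G q * fine (Pr (past_event q)).
Proof.
elim: k G => [|k IH] G.
  rewrite (big_pred1 [tuple]) => [|q]; last by rewrite [q]tuple0; apply/esym/eqP.
  rewrite cexp0 (_ : past_event _ = setT) ?probability_setT ?mulr1 //.
  by apply/seteqP; split.
rewrite cexpSr IH (sum_tuple_cons k (fun q => G q * fine (Pr (past_event q)))).
apply: eq_bigr => q _; rewrite /cstep mulr_suml; apply: eq_bigr => y _.
by rewrite prob_past_event_cons; ring.
Qed.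

Lemma past_decomp (G : seq (S * A) -> R) k o :
  G (past k o) = \sum_(q : k.-tuple (S * A)) G q * \1_(past_event q) o.
Proof.
have sz : size (past k o) == k by rewrite size_past.
rewrite (bigD1 (Tuple sz)) //= big1 ?addr0 => [|q qn].
  by rewrite indicE mem_set ?mulr1 //= /past_event /= size_past.
rewrite indicE memNset ?mulr0 // => /= H; move/eqP: qn; apply.
by apply/val_inj; rewrite /= -H size_tuple.
Qed.

Lemma integral_past k (G : seq (S * A) -> R) : (forall h, 0 <= G h) ->
  (\int[Pr]_o (G (past k o))%:E =
   (\sum_(q : k.-tuple (S * A)) G q * fine (Pr (past_event q)))%:E)%E.
Proof.
move=> G0; under eq_integral do rewrite past_decomp -sumEFin.
rewrite ge0_integral_sum //=; last first.
  by move=> q o _; rewrite lee_fin mulr_ge0.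
  move=> q; apply/measurable_EFinP; apply: measurable_funM => //.
  by apply: measurable_indic; exact: measurable_past_event.
rewrite -sumEFin; apply: eq_bigr => q _.
have mq := measurable_past_event q.
under eq_integral do rewrite EFinM.
rewrite ge0_integralZl_EFin //=; last first.
  by apply/measurable_EFinP; apply: measurable_indic.
by rewrite integral_indic // setIT EFinM fineK // fin_num_measure.
Qed.

Lemma first_law_pmf : is_pmf first_law.
Proof.
split=> [y|]; first by rewrite fine_ge0.
have := integral_past 1 (fun _ => ler01).
rewrite integral_cst //= probability_setT mul1e => -[->].
rewrite (sum_tuple_cons 0 (fun q => 1 * fine (Pr (past_event q)))).
rewrite (big_pred1 [tuple]) => [|q]; last by rewrite [q]tuple0; apply/esym/eqP.
by apply: eq_bigr => y _; rewrite mul1r.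
Qed.

Lemma expectation_past k (G : seq (S * A) -> R) : (forall h, 0 <= G h) ->
  ('E_Pr[fun o => G (past k o)] = (cexp (next_law P pib first_law) k G [::])%:E)%E.
Proof. by move=> G0; rewrite unlock cexp_past -integral_past. Qed.

Lemma probability_past k (p : pred (seq (S * A))) :
  measurable [set o | p (past k o)] /\
  Pr [set o | p (past k o)] = (cexp (next_law P pib first_law) k (fun h => (p h)%:R) [::])%:E.
Proof.
have m : measurable [set o | p (past k o)].
  rewrite (_ : [set o | _] = \bigcup_(q in [set q : k.-tuple (S * A) | p q]) past_event q).
    by apply: fin_bigcup_measurable => // q _; exact: measurable_past_event.
  apply/seteqP; split => o /=.
    have sz : size (past k o) == k by rewrite size_past.
    by move=> po; exists (Tuple sz) => //=; rewrite /past_event /= size_past.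
  by move=> [q /= pq]; rewrite /past_event /= size_tuple => ->.
split=> //; rewrite cexp_past -(integral_past k (G := fun h => (p h)%:R)) //.
rewrite -[Pr _](_ : \int[Pr]_o (\1_[set o | p (past k o)] o)%:E = _)%E; last first.
  by rewrite integral_indic // setIT.
apply: eq_integral => o _; rewrite indicE; congr ((_ : bool)%:R)%:E.
by apply/idP/idP; rewrite inE.
Qed.

End TrajectoryLaw.

(** * Off-policy TD as a linear stochastic approximation *)

Section OffPolicyTD.
Variables (R : realType) (S A : finType) (P : A -> S -> S -> R) (r : S -> A -> R).
Variables (gamma : R) (d : nat) (phi : S * A -> 'cV[R]_d) (pib pi : S -> A -> R).
Variables (mub : S -> R) (gammac : R) (n : nat) (wpi w0 : 'cV[R]_d).
Variables (p : S * A -> R) (y0 : S * A).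
Hypothesis hP : forall a, is_stochastic (P a).
Hypothesis hr : forall s a, `|r s a| <= 1.
Hypothesis hgamma : 0 < gamma < 1.
Hypothesis hd : (0 < d)%N.
Hypothesis hphi_indep : row_free (feature_mx phi)^T.
Hypothesis hphi_norm : forall x, norm1 (phi x) <= 1.
Hypothesis hpib : is_stochastic pib.
Hypothesis hpib_pos : forall s a, 0 < pib s a.
Hypothesis hirr : irreducible (induced_kernel P pib).
Hypothesis hmub : stationary (induced_kernel P pib) mub.
Hypothesis hpi : is_stochastic pi.
Hypothesis hgammac : 0 < gammac < 1.
Hypothesis hn0 : (0 < n)%N.
Hypothesis hn : (2 * ln gammac + ln (kappa_min mub pib)) / (2 * ln gamma) <= n%:R.
Hypothesis hwpi : projected_bellman P r gamma pi pib mub phi n wpi.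
Hypothesis hp : is_pmf p.

Let X : finType := (S * A)%type.
Let Z : finType := {ffun 'I_n.+1 -> X}.
Let K := next_law P pib p.
Let win := window n y0.
Let kz : Z -> R := stat_window P pib mub p y0.

Let first (z : Z) : 'cV[R]_d := phi (z ord_max).
Let final (z : Z) : 'cV[R]_d := phi (z ord0).
(** Restores chronological order: time [0] is the oldest pair of the window. *)
Let path (z : Z) (i : nat) : X := z (inord (n - i)).
Let coef (z : Z) : R := trace_coef gamma pi pib (path z) n.
Let noise (z : Z) : R := nstep_td_error r gamma pi pib phi n (path z) wpi 0.
Let f : R := geom n (gamma * max_ratio pi pib).
Let B : R := norm2 wpi + 1.
Let err := lsa_err first final coef noise.
Let corr := lsa_corr first final coef noise.
Let lam := min_eigenvalue (gram_mx phi mub pib).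
Let k := kappa mub pib.

(** The first [n] letters trigger no update, since the window has [n.+1] entries. A history of
    length [n + j] therefore carries [w_j - wpi], which is why stepsizes are shifted by [n]. *)
Fixpoint history_iter (al : nat -> R) (h : seq X) : 'cV[R]_d :=
  if h is _ :: h' then
    if (size h' < n)%N then w0 - wpi else
      history_iter al h' +
      (al (size h' - n)%N * err (history_iter al h') (win h)) *: first (win h)
  else w0 - wpi.

Lemma history_iter_init al h : size h = n -> history_iter al h = w0 - wpi.
Proof. by case: h => //= y h hs; rewrite -hs ltnSn. Qed.

Lemma history_iter_step al y h : (n <= size h)%N ->
  history_iter al (y :: h) = history_iter al h +
   (al (size h - n)%N * err (history_iter al h) (win (y :: h))) *: first (win (y :: h)).
Proof. by move=> hs; rewrite /= ltnNge hs. Qed.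

Lemma path0 z : path z 0 = z ord_max.
Proof. by rewrite /path subn0; congr (z _); apply/val_inj; rewrite /= inordK. Qed.

Lemma pathn z : path z n = z ord0.
Proof. by rewrite /path subnn; congr (z _); apply/val_inj; rewrite /= inordK. Qed.

Lemma nstep_lsa_err z w :
  nstep_td_error r gamma pi pib phi n (path z) w 0 = err (w - wpi) z.
Proof.
rewrite /err /lsa_err /noise !nstep_td_error_telescope path0 pathn !dotpBr /coef.
rewrite /first /final; ring.
Qed.

Lemma history_iterE al (x : nat -> X) j h :
  size h = (n + j)%N -> (forall i, (i < n + j)%N -> nth y0 h i = x (n + j - i.+1)%N) ->
  history_iter al h = td_iter r gamma pi pib phi n al w0 x j - wpi.
Proof.
elim: j h => [|j IH] h; first by rewrite addn0 => /history_iter_init ->.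
case: h => [|y h]; first by rewrite addnS.
rewrite addnS => -[sh] Hx.
have Hh i : (i < n + j)%N -> nth y0 h i = x (n + j - i.+1)%N.
  by move=> ij; rewrite -(Hx i.+1) //= subSS.
rewrite history_iter_step ?sh ?leq_addr // addKn (IH h) //= -nstep_lsa_err.
set w := td_iter _ _ _ _ _ _ _ _ _ _.
have pE i : (i <= n)%N -> path (win (y :: h)) i = x (j + i)%N.
  move=> ni; rewrite /path /win ffunE inordK ?ltnS ?leq_subr //.
  rewrite Hx ?ltnS ?(leq_trans (leq_subr _ _)) ?leq_addr //.
  by rewrite subSS addnC -addnBA ?leq_subr // subKn.
rewrite (eq_nstep_td_error _ _ _ _ _ w pE) -nstep_td_error_shift.
by rewrite /first -path0 pE // addn0 addrAC.
Qed.

Let gam0 : 0 < gamma. Proof. by case/andP: hgamma. Qed.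
Let gam1 : gamma < 1. Proof. by case/andP: hgamma. Qed.
Let feature_norm x : norm2 (phi x) <= 1. Proof. exact: norm2_le1. Qed.

Let k_gt0 x : 0 < k x.
Proof.
by rewrite mulr_gt0 // (stationary_gt0 (induced_kernel_stoch hP hpib) hmub).
Qed.

Let k_pmf : is_pmf k. Proof. exact: kappa_pmf hpib hmub. Qed.

Let ratio_ge0 : 0 <= gamma * max_ratio pi pib.
Proof.
rewrite mulr_ge0 ?(ltW gam0) //.
by have /andP[h1 h2] := is_ratio_bnd y0 hpib_pos hpi; exact: le_trans h2.
Qed.

Let fE : f = \sum_(0 <= i < n) (gamma * max_ratio pi pib) ^+ i +
             (gamma * max_ratio pi pib) ^+ n.
Proof. by rewrite /f geomE big_nat_recr. Qed.

Let f_ge : 1 + (gamma * max_ratio pi pib) ^+ n <= f.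
Proof.
rewrite fE lerD2r; case: n hn0 => // n' _.
rewrite big_nat_recl // expr0 lerDl; apply: sumr_ge0 => i _; exact: exprn_ge0.
Qed.

Let coef_ge0 z : 0 <= coef z.
Proof. by case/andP: (trace_coef_bnd (path z) n (ltW gam0) hpib_pos hpi). Qed.

Let coef_le z : 1 + coef z <= f.
Proof.
apply: le_trans f_ge; rewrite lerD2l.
by case/andP: (trace_coef_bnd (path z) n (ltW gam0) hpib_pos hpi).
Qed.

Let B_ge1 : 1 <= B. Proof. by rewrite lerDr norm2_ge0. Qed.

Let noise_le z : `|noise z| <= f * B.
Proof.
rewrite /noise nstep_td_error_telescope.
apply: le_trans (ler_normD _ _) _; rewrite mulrDr mulr1 lerD //.
  apply: le_trans (ler_normB _ _) _; rewrite normrM (ger0_norm (coef_ge0 z)) path0 pathn.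
  have h1 := dotp_le_norm2 wpi (feature_norm (z ord0)).
  have h2 := dotp_le_norm2 wpi (feature_norm (z ord_max)).
  have := ler_wpM2l (coef_ge0 z) h1.
  have := ler_wpM2r (norm2_ge0 wpi) (coef_le z); rewrite /coef; lra.
apply: le_trans (ler_norm_sum _ _ _) _.
apply: le_trans (_ : \sum_(0 <= i < n) (gamma * max_ratio pi pib) ^+ i <= _).
  apply: ler_sum => i _; rewrite normrM.
  have /andP[c0 c1] := trace_coef_bnd (path z) i (ltW gam0) hpib_pos hpi.
  by rewrite (ger0_norm c0) -[leRHS]mulr1 ler_pM.
by rewrite fE lerDl exprn_ge0.
Qed.

Let kz_pmf : is_pmf kz. Proof. exact: stat_window_pmf. Qed.

Let quad x : R := \sum_y k y * dotp (phi y) x ^+ 2.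

Lemma seminorm2_first x : seminorm2 first kz x = quad x.
Proof. exact: (stat_window_last mub n y0 hP hpib hp (fun y => dotp (phi y) x ^+ 2)). Qed.

Lemma seminorm2_final x : \sum_z kz z * sqdot final x z = seminorm2 first kz x.
Proof.
rewrite seminorm2_first.
exact: (stat_window_head p n y0 hpib hmub (fun y => dotp (phi y) x ^+ 2)).
Qed.

(** The condition on [n], exponentiated; dividing by the negative number [ln gamma] had reversed the
    inequality. *)
Lemma gamma_contraction : gamma ^+ n ^+ 2 <= gammac ^+ 2 * kappa_min mub pib.
Proof.
have [gc0 gc1] : 0 < gammac /\ gammac < 1 by case/andP: hgammac.
have km0 : 0 < kappa_min mub pib.
  by apply: lt_bigmin => // x _; exact: k_gt0.
have lg : ln gamma < 0 by rewrite -ln1 ltr_ln ?posrE.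
have h : n%:R * (2 * ln gamma) <= 2 * ln gammac + ln (kappa_min mub pib).
  by move: hn; rewrite ler_ndivrMr //; lra.
rewrite -ler_ln ?posrE ?mulr_gt0 ?exprn_gt0 // lnM ?posrE ?exprn_gt0 //.
have -> : ln (gamma ^+ n ^+ 2) = n%:R * (2 * ln gamma).
  by rewrite !lnXn ?exprn_gt0 // -[_ *+ 2]mulr_natl -[ln gamma *+ n]mulr_natl mulrCA.
by rewrite (lnXn 2 gc0) -[ln gammac *+ 2]mulr_natl; exact: h.
Qed.

(** Subtracting the projected Bellman equation, tested against [dotp (phi y) x], leaves the
    difference of two n-fold Bellman images. It is bounded in sup norm, and AM-GM with weight
    [gammac] balances it against the quadratic form. *)
Lemma td_drift x : \sum_z kz z * corr x z <= - (1 - gammac) * seminorm2 first kz x.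
Proof.
have [gc0 gc1] : 0 < gammac /\ gammac < 1 by case/andP: hgammac.
rewrite seminorm2_first.
pose Q w := fun y : X => dotp (phi y) w.
pose TQ w := iter n (bellman P r gamma pi) (Q w).
have -> : \sum_z kz z * corr x z =
    \sum_y k y * (dotp (phi y) x * (TQ (wpi + x) y - dotp (phi y) (wpi + x))).
  rewrite /kz stat_window_sum; apply: eq_bigr => y _; congr (_ * _).
  rewrite -(cexp_nstep_td_error r gamma pi phi y0 n _ y [::] hp hpib hP hpib_pos) -cexpZ.
  apply: eq_cexp => q sq; rewrite /corr /lsa_corr /first window_last //; congr (_ * _).
  rewrite -/err -[x in err x _](addrK wpi) [x + wpi]addrC -nstep_lsa_err.
  apply: eq_nstep_td_error => i ni.
  by rewrite /path ffunE inordK // ltnS leq_subr.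
have proj := projection_orthogonal hphi_indep k_gt0 x hwpi.
have -> : \sum_y k y * (dotp (phi y) x * (TQ (wpi + x) y - dotp (phi y) (wpi + x))) =
    \sum_y k y * (dotp (phi y) x * (TQ (wpi + x) y - TQ wpi y)) - quad x.
  have proj' : \sum_y k y * dotp (phi y) x * (TQ wpi y - dotp (phi y) wpi) = 0.
    by move: proj; rewrite fun_of_vec_feature.
  transitivity (\sum_y k y * (dotp (phi y) x * (TQ (wpi + x) y - TQ wpi y)) - quad x +
      \sum_y k y * dotp (phi y) x * (TQ wpi y - dotp (phi y) wpi)).
    rewrite /quad -sumrB -big_split; apply: eq_bigr => y _ /=.
    by rewrite dotpDr; ring.
  by rewrite proj' addr0.
have [y1 Hy1] : exists y1, forall y, `|dotp (phi y) x| <= `|dotp (phi y1) x|.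
  by case: (@arg_maxP _ _ _ y0 xpredT (fun y => `|dotp (phi y) x|)) => // y1 _ H;
    exists y1 => y; exact: H.
set M := `|dotp (phi y1) x| in Hy1.
have M0 : 0 <= M by exact: normr_ge0.
have lip y : `|TQ (wpi + x) y - TQ wpi y| <= gamma ^+ n * M.
  apply: bellman_iter_lip => //; first exact: ltW.
  by move=> y'; rewrite /Q dotpDr addrAC subrr add0r.
have q0 : 0 <= quad x.
  by apply: sumr_ge0 => y _; rewrite mulr_ge0 ?sqr_ge0 ?(ltW (k_gt0 _)).
(* Passing from the sup norm to the weighted l2 norm costs a factor [1 / kappa_min], since the
   maximizer [y1] alone has that weight; the condition on [n] pays for it. *)
have gM : (gamma ^+ n * M) ^+ 2 <= gammac ^+ 2 * quad x.
  rewrite exprMn; apply: le_trans (ler_wpM2r (sqr_ge0 M) gamma_contraction) _.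
  rewrite -mulrA ler_wpM2l ?sqr_ge0 //.
  apply: le_trans (_ : k y1 * M ^+ 2 <= _).
    rewrite ler_wpM2r ?sqr_ge0 //.
    exact: (bigmin_le_cond _ (kappa mub pib) (j := y1)).
  rewrite /M real_normK ?num_real // /quad (bigD1 y1) //= lerDl.
  by apply: sumr_ge0 => y _; rewrite mulr_ge0 ?sqr_ge0 ?(ltW (k_gt0 _)).
have bound : \sum_y k y * (dotp (phi y) x * (TQ (wpi + x) y - TQ wpi y)) <=
    gammac / 2 * quad x + (gamma ^+ n * M) ^+ 2 / (2 * gammac).
  set C := _ / (2 * gammac).
  have -> : C = \sum_y k y * C by rewrite -mulr_suml (proj2 k_pmf) mul1r.
  rewrite mulr_sumr -big_split /C {C}.
  apply: ler_sum => y _ /=; have ky := ltW (k_gt0 y).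
  have -> : gammac / 2 * (k y * dotp (phi y) x ^+ 2) +
     k y * ((gamma ^+ n * M) ^+ 2 / (2 * gammac)) = k y * (gammac / 2 *
       dotp (phi y) x ^+ 2 + (gamma ^+ n * M) ^+ 2 / (2 * gammac)) by ring.
  apply: ler_wpM2l => //.
  set u := dotp (phi y) x; set v := _ - _; have hv : v ^+ 2 <= (gamma ^+ n * M) ^+ 2.
    rewrite -real_normK ?num_real // ler_sqr ?nnegrE ?mulr_ge0 ?exprn_ge0 ?(ltW gam0) //.
    exact: lip.
  have hu : u * v <= gammac / 2 * u ^+ 2 + v ^+ 2 / (2 * gammac).
    rewrite -subr_ge0.
    have -> : gammac / 2 * u ^+ 2 + v ^+ 2 / (2 * gammac) - u * v =
      (gammac * u - v) ^+ 2 / (2 * gammac) by field; rewrite gt_eqF.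
    by rewrite divr_ge0 ?sqr_ge0 //; lra.
    apply: le_trans hu _.
  by rewrite lerD2l ler_wpM2r // invr_ge0; lra.
have : (gamma ^+ n * M) ^+ 2 / (2 * gammac) <= gammac / 2 * quad x.
  rewrite ler_pdivrMr; last lra.
  have -> : gammac / 2 * quad x * (2 * gammac) = gammac ^+ 2 * quad x by field.
  exact: gM.
lra.
Qed.

Let lam_gt0 : 0 < lam. Proof. exact: min_eigenvalue_gram_gt0. Qed.

Let lam_le x : lam * norm2 x ^+ 2 <= seminorm2 first kz x.
Proof. by rewrite seminorm2_first; exact: min_eigenvalue_gram_le. Qed.

Let lam_le1 : lam <= 1.
Proof. exact: min_eigenvalue_gram_le1. Qed.

Section Mixing.
Variable t : nat.
Hypothesis ht : forall s, rowdist (induced_kernel P pib) mub t s <= 4^-1.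

Let tau := (t + n + 1)%N.
Let rho : R := 1 - (2 * tau%:R)^-1.
(** The distance shrinks by [1 / 4] per block of length [tau]; [om] is its square root, hence the
    [1 / 2]. *)
Let om (m : nat) : R := 2^-1 ^+ (m %/ tau).

Let tau_ge2 : (2 <= tau)%N. Proof. by rewrite /tau addn1 ltnS addn_gt0 hn0 orbT. Qed.

Let om_gt0 m : 0 < om m. Proof. by rewrite exprn_gt0. Qed.

Let om_le1 m : om m <= 1.
Proof. by rewrite exprn_ile1 // invf_le1 // ler1n. Qed.

Let rho_bnd : 0 <= rho < 1.
Proof.
have h : (2 : R) <= tau%:R by rewrite ler_nat.
have h1 : (2 * tau%:R)^-1 <= (1 : R) by rewrite invf_le1; lra.
have h2 : 0 < (2 * tau%:R : R)^-1 by rewrite invr_gt0; lra.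
by apply/andP; rewrite /rho; split; lra.
Qed.

Let om_rho m : om m <= 2 * rho ^+ m.
Proof.
have [r0 r1] : 0 <= rho /\ rho < 1 by case/andP: rho_bnd.
have tau0 : (0 < tau)%N by exact: leq_trans tau_ge2.
(* Bernoulli's inequality over one block. *)
have rt : 2^-1 <= rho ^+ tau.
  have bern j : 1 - j%:R * (2 * tau%:R)^-1 <= rho ^+ j.
    elim: j => [|j IH]; first by rewrite mul0r subr0 expr0.
    rewrite exprS; apply: le_trans (ler_wpM2l r0 IH).
    rewrite /rho; set u := (2 * tau%:R)^-1; rewrite -natr1.
    have : 0 <= j%:R * u * u :> R by rewrite !mulr_ge0 // invr_ge0 mulr_ge0.
    lra.
  apply: le_trans (bern tau); rewrite invfM mulrCA divff ?pnatr_eq0 -?lt0n // mulr1.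
  lra.
apply: le_trans (_ : 2 * rho ^+ ((m %/ tau).+1 * tau) <= _); last first.
  rewrite ler_wpM2l // ler_wiXn2l ?(ltW r1) // ltnW //; exact: ltn_ceil.
rewrite mulnC exprM; apply: le_trans (_ : 2 * 2^-1 ^+ (m %/ tau).+1 <= _).
  by rewrite /om exprS mulrA divff ?mul1r.
by rewrite ler_wpM2l // lerXn2r ?nnegrE ?invr_ge0 ?exprn_ge0.
Qed.

Let rowdist_om j l s : (j.+1 * t <= l)%N ->
  rowdist (induced_kernel P pib) mub l s <= 2 * (2^-1 ^+ j.+1) ^+ 2.
Proof.
move=> jl.
have q0 : 0 <= 4^-1 :> R by rewrite invr_ge0.
have := rowdist_exp (induced_kernel_stoch hP hpib) hmub q0 ht s jl.
have e : (2^-1 ^+ j.+1) ^+ 2 = 4^-1 ^+ j.+1 :> R.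
  by rewrite exprAC; congr (_ ^+ _); rewrite expr2; field.
move=> h; apply: le_trans h _; rewrite e.
have : 0 <= 4^-1 ^+ j.+1 :> R by rewrite exprn_ge0.
lra.
Qed.

(** [j.+1] blocks of length [tau] hold [j.+1] mixing periods and still leave the [n.+1] letters
    consumed by one window. *)
Let tau_split j : (j.+1 * t + n.+1 <= j.+1 * tau)%N.
Proof. by rewrite /tau -addnA mulnDr leq_add2l addn1 leq_pmull. Qed.

Let td_mixing h m : (0 < size h)%N -> (0 < m)%N ->
  \sum_z `|cprob K win m h z - kz z| <= 2 * om m ^+ 2.
Proof.
move=> sh m0; case E : (m %/ tau)%N => [|j].
  by rewrite /om E expr0 expr1n mulr1; exact: window_mixing2.
have jm : (j.+1 * tau <= m)%N by rewrite -E leq_divM.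
have jm' := leq_trans (tau_split j) jm.
have [l ml] : exists l, (m = n + l.+1)%N.
  by exists (m - n.+1)%N; rewrite addnS -addSn subnKC // (leq_trans (leq_addl _ _) jm').
rewrite /om E {1}ml; apply: window_mixing => // s; apply: rowdist_om.
by move: jm'; rewrite ml !addnS ltnS [(n + l)%N]addnC leq_add2r.
Qed.

Let td_mixing_init m :
  \sum_z `|cprob K win (n + m.+1) [::] z - kz z| <= 2 * om m ^+ 2.
Proof.
case E : (m %/ tau)%N => [|j].
  by rewrite /om E expr0 expr1n mulr1; exact: window_mixing2.
have jm : (j.+1 * tau <= m)%N by rewrite -E leq_divM.
have jm' := leq_trans (tau_split j) jm.
have [l ml] : exists l, (m = l.+1)%N.
  by exists m.-1; rewrite prednK // (leq_trans _ jm') // addnS.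
rewrite /om E {1}ml; apply: window_mixing_init => // s; apply: rowdist_om.
by move: jm'; rewrite ml addnS ltnS; apply: leq_trans; exact: leq_addr.
Qed.

Lemma td_mean_square (al : R) j : 0 < al ->
  al * tau%:R <= (1 - gammac) / (456 * f ^+ 2) ->
  cexp K (n + j) (fun h => norm2 (history_iter (fun=> al) h) ^+ 2) [::] <=
  (1 - (1 - gammac) * lam * al) ^+ j *
    (norm2 (w0 - wpi) ^+ 2 + 35 / 2 * (al * tau%:R * f) *
      (norm2 (w0 - wpi) * (norm2 (w0 - wpi) + B)))
  + 71 * f ^+ 2 * B ^+ 2 * (al * tau%:R / ((1 - gammac) * lam)).
Proof.
move=> al0 small.
apply: (@mean_square_bound R X Z K win d first final coef noise kz f B n al
  (w0 - wpi) (history_iter (fun=> al)) tau om gammac lam) => //.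
- exact: next_law_pmf.
- by move=> z; exact: feature_norm.
- by move=> z; exact: feature_norm.
- exact: seminorm2_final.
- by move=> h; exact: history_iter_init.
- by move=> y h hs; exact: history_iter_step.
- exact: td_drift.
Qed.

Lemma td_hits_eventually_rare (al sig : nat -> R) (e del : R) :
  (forall i, 0 < al i) ->
  (forall M : R, exists m, M <= \sum_(i < m) al i) ->
  (forall i m, \sum_(j < m) al (i + j)%N ^+ 2 <= sig i) ->
  (forall e, 0 < e -> exists M, forall m, (M <= m)%N -> sig m <= e) ->
  0 < e -> 0 < del ->
  exists m, forall l, cexp K (n + m + l) (fun h =>
    (hits (fun h => (n + m <= size h)%N && (e <= norm2 (history_iter al h) ^+ 2)) h)%:R)
    [::] <= del.
Proof.
move=> al0 aldiv alsq sig0 e0 del0.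
have [gc0 gc1] : 0 < gammac /\ gammac < 1 by case/andP: hgammac.
have Kpmf := next_law_pmf hP hpib hp.
have Hmix h m : (0 < size h)%N -> (0 < m)%N ->
    \sum_z `|cprob K win m h z - kz z| <= 4 * rho ^+ m.
  move=> sh m0; apply: le_trans (td_mixing sh m0) _.
  have := om_rho m; have o0 := om_gt0 m; have o1 := om_le1 m.
  have : om m ^+ 2 <= om m by rewrite expr2 ler_piMl // ltW.
  lra.
have c0 : 0 < (1 - gammac) * lam by rewrite mulr_gt0 // subr_gt0.
have Hdrift y : \sum_z kz z * corr y z <= - ((1 - gammac) * lam) * norm2 y ^+ 2.
  apply: le_trans (td_drift y) _.
  rewrite !mulNr lerN2 -mulrA; apply: ler_wpM2l; last exact: lam_le.
  by rewrite subr_ge0 ltW.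
have Hstep y h := @history_iter_step al y h.
exact: (hits_eventually_rare Kpmf (fun z => feature_norm _) (fun z => feature_norm _)
  coef_ge0 coef_le noise_le B_ge1 hn0 Hstep rho_bnd (ler0n R 4) Hmix c0 Hdrift
  al0 aldiv alsq sig0 e0 del0).
Qed.

End Mixing.

End OffPolicyTD.

Lemma mx_norm_le_norm2 (R : realType) d (v : 'cV[R]_d) : `|v| <= norm2 v.
Proof.
rewrite [`|v|]mx_normrE; apply: bigmax_le => [|[i j] _ /=]; first exact: norm2_ge0.
rewrite (ord1 j) -ler_sqr ?nnegrE ?norm2_ge0 // norm2_sqr real_normK ?num_real //.
rewrite /dotp (bigD1 i) //= expr2 lerDl; apply: sumr_ge0 => l _.
by rewrite -expr2 sqr_ge0.
Qed.

(** * From rare excursions to an almost sure limit *)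

Section AlmostSureLimit.
Variables (R : realType) (disp : measure_display) (T : measurableType disp).
Variables (Pr : probability T R).

(** Excursions are only seen up to finite horizons, so the cover is an increasing union; continuity
    from below carries the uniform bound to the union, and the covers for [del = 1 / i.+1] are
    intersected. *)
Lemma negligible_small_covers (N : set T) :
  (forall del : R, 0 < del -> exists U : nat -> set T,
     [/\ forall l, measurable (U l), nondecreasing_seq U,
         forall l, (Pr (U l) <= del%:E)%E & N `<=` \bigcup_l U l]) ->
  Pr.-negligible N.
Proof.
move=> H.
have H' (i : nat) : exists V, [/\ measurable V, (Pr V <= (i.+1%:R^-1)%:E)%E & N `<=` V].
  have [U [mU ndU PU NU]] := H (i.+1%:R^-1) (ltac:(by rewrite invr_gt0 ltr0n)).
  have mV : measurable (\bigcup_l U l) by exact: bigcup_measurable.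
  exists (\bigcup_l U l); split=> //.
  have cv := nondecreasing_cvg_mu (mu := Pr) mU mV ndU.
  rewrite -(cvg_lim _ cv) //; apply: lime_le; first by apply/cvg_ex; eexists; exact: cv.
  by apply: nearW => l /=.
have [V HV] := choice H'.
exists (\bigcap_i V i); split.
- by apply: bigcapT_measurable => i; case: (HV i).
- apply/eqP; rewrite eq_le measure_ge0 andbT; apply/lee_addgt0Pr => e e0.
  rewrite add0e; have [i ie] : exists i : nat, i.+1%:R^-1 <= e.
    have [i _ /(_ i (leqnn i)) hi] := near_infty_natSinv_lt (PosNum e0).
    by exists i; exact: ltW.
  have [mVi PVi _] := HV i.
  apply: le_trans (_ : (Pr (V i) <= _)%E); last first.
    by apply: le_trans PVi _; rewrite lee_fin.
  apply: le_measure; rewrite ?inE //.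
    by apply: bigcapT_measurable => j; case: (HV j).
  by move=> o; apply.
- by move=> o No i _; case: (HV i) => _ _; apply.
Qed.

(** Non-convergence forces infinitely many excursions above some level [1 / i.+1]. For each level
    they are covered by events of arbitrarily small probability, and the levels are countable. *)
Lemma ae_cvg_small_hits d (w : nat -> T -> 'cV[R]_d) (l : 'cV[R]_d) :
  (forall e del : R, 0 < e -> 0 < del -> exists m, exists U : nat -> set T,
     [/\ forall l, measurable (U l), nondecreasing_seq U,
         forall l, (Pr (U l) <= del%:E)%E &
         forall o k, (m <= k)%N -> e <= norm2 (w k o - l) ^+ 2 -> exists i, U i o]) ->
  {ae Pr, forall o, w k o @[k --> \oo] --> l}.
Proof.
move=> H.
pose e (i : nat) : R := i.+1%:R^-1.
have e0 i : 0 < e i by rewrite invr_gt0 ltr0n.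
pose N i := [set o | forall m, exists2 k, (m <= k)%N & e i <= norm2 (w k o - l) ^+ 2].
have negN : Pr.-negligible (\bigcup_i N i).
  apply: negligible_bigcup => i; apply: negligible_small_covers => del del0.
  have [m [U [mU ndU PU HU]]] := H _ _ (e0 i) del0.
  exists U; split=> // o /(_ m) [k mk ek].
  by have [j Uj] := HU o k mk ek; exists j.
apply: negligibleS negN => o /= ncv; apply: contrapT => nN; apply: ncv.
apply/cvgrPdist_le => eps eps0.
have [i ie] : exists i : nat, e i <= eps ^+ 2.
  have s0 : 0 < eps ^+ 2 by exact: exprn_gt0.
  have [i _ /(_ i (leqnn i)) hi] := near_infty_natSinv_lt (PosNum s0).
  by exists i; exact: ltW.
have [m Hm] : exists m, forall k, (m <= k)%N -> norm2 (w k o - l) ^+ 2 < e i.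
  apply: contrapT => nm; apply: nN; exists i => // m; apply: contrapT => nk.
  apply: nm; exists m => k mk; rewrite ltNge; apply/negP => ek; apply: nk.
  by exists k.
exists m => // k /= mk; rewrite distrC; apply: le_trans (mx_norm_le_norm2 _) _.
rewrite -(@ler_sqr _ _ eps) ?nnegrE ?norm2_ge0 ?(ltW eps0) //.
by apply: le_trans (ltW (Hm k mk)) ie.
Qed.

End AlmostSureLimit.

(** * Stepsize tails and the final constants *)

Lemma square_summable_tails (R : realType) (u : nat -> R) :
  cvgn (series (fun k => u k ^+ 2)) ->
  exists2 sig : nat -> R, forall i m, \sum_(j < m) u (i + j)%N ^+ 2 <= sig i &
    forall e, 0 < e -> exists M, forall m, (M <= m)%N -> sig m <= e.
Proof.
move=> cv; pose s := series (fun k => u k ^+ 2).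
have nd : nondecreasing_seq s.
  by apply: nondecreasing_series => i _ _; exact: sqr_ge0.
exists (fun i => limn s - s i) => [i m|e e0].
  rewrite lerBrDl; apply: le_trans (nondecreasing_cvgn_le nd cv (i + m)).
  by rewrite /s /series /= !big_mkord big_split_ord.
have /cvgrPdist_le /(_ _ e0) [M _ HM] := cv.
exists M => m Mm; apply: le_trans (ler_norm _) _; exact: HM.
Qed.

Lemma divergent_partial_sums (R : realType) (u : nat -> R) :
  series u k @[k --> \oo] --> +oo ->
  forall M : R, exists m, M <= \sum_(i < m) u i.
Proof.
move=> /cvgryPge H M; have [m _ /(_ m (leqnn m))] := H M.
by rewrite /= /series /= big_mkord => h; exists m.
Qed.

(** Used with [a = norm2 (w0 - wpi)], [h = norm2 w0 + 1], [b = norm2 wpi + 1]. The part of the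
    initial memory in [a] and [h] fits into [c1] because [s] is small; the part in [b] goes to [c2],
    where [43 = 114 - 71] is available. *)
Lemma initial_slack (R : realType) (a h b s : R) : 0 <= a -> 1 <= h -> 0 <= b ->
  a <= h + b -> 0 <= s -> s <= 456^-1 ->
  a ^+ 2 + 35 / 2 * s * (a * (a + b)) <= (a + h) ^+ 2 + 43 * s * b ^+ 2.
Proof.
move=> a0 h1 b0 ab s0 s1.
have h0 : 0 <= h by lra.
have i1 : a * (a + b) <= a * (h + 2 * b) by apply: ler_wpM2l => //; lra.
have i2 : a * (2 * b) <= (h + b) * (2 * b) by apply: ler_wpM2r => //; lra.
have i3 : 2 * h * b <= 4 * h ^+ 2 + b ^+ 2 / 4.
  by have := sqr_ge0 (2 * h - b / 2); lra.
have i4 : a * (a + b) <= a * h + 4 * h ^+ 2 + (9 / 4) * b ^+ 2 by lra.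
have i5 := ler_wpM2l s0 i4.
have i6 : s * (a * h) <= 456^-1 * (a * h) by rewrite ler_wpM2r ?mulr_ge0.
have i7 : s * h ^+ 2 <= 456^-1 * h ^+ 2 by rewrite ler_wpM2r ?sqr_ge0.
have := mulr_ge0 a0 h0; have := sqr_ge0 h.
have : 0 <= s * b ^+ 2 by rewrite mulr_ge0 ?sqr_ge0.
lra.
Qed.

(** Here [at_] is the stepsize times [tau] and [c] is [(1 - gammac) * lmin]. As [c <= 1], the
    leftover in [b ^+ 2] is dominated by the noise term [at_ / c], and [1 - c * al] lies in the unit
    interval, so the exponent may be lowered. *)
Lemma finite_time_rate (R : realType) (a h b f at_ c al : R) (j tau : nat) :
  0 <= a -> 1 <= h -> 0 <= b -> a <= h + b -> 1 <= f -> 0 <= al -> al <= at_ ->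
  at_ * f ^+ 2 <= 456^-1 -> 0 < c -> c <= 1 ->
  (1 - c * al) ^+ j * (a ^+ 2 + 35 / 2 * (at_ * f) * (a * (a + b))) +
    71 * f ^+ 2 * b ^+ 2 * (at_ / c) <=
  (a + h) ^+ 2 * (1 - c * al) ^+ (j - tau) + 114 * f ^+ 2 * b ^+ 2 * (at_ / c).
Proof.
move=> a0 h1 b0 ab f1 al0 alat small c0 c1.
have f0 : 0 <= f by exact: le_trans f1.
have at0 : 0 <= at_ by exact: le_trans alat.
have ff : f <= f ^+ 2 by rewrite expr2 ler_peMl.
have atf : at_ * f <= at_ * f ^+ 2 by rewrite ler_wpM2l.
have at1 : at_ * 1 <= at_ * f by rewrite ler_wpM2l.
set q := 1 - c * al.
have q0 : 0 <= q.
  have : c * al <= 1 * 1 by apply: ler_pM => //; [exact: ltW|lra].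
  by rewrite /q; lra.
have q1 : q <= 1 by rewrite /q gerBl mulr_ge0 // ltW.
have V := initial_slack a0 h1 b0 ab (mulr_ge0 at0 f0) (le_trans atf small).
set W := a ^+ 2 + _ in V *.
have W0 : 0 <= W.
  apply: addr_ge0; first exact: sqr_ge0.
  by rewrite !mulr_ge0 // addr_ge0.
have p0 : 0 <= q ^+ (j - tau) by exact: exprn_ge0.
have p1 : q ^+ (j - tau) <= 1 by exact: exprn_ile1.
have qW : q ^+ j * W <= q ^+ (j - tau) * W.
  by rewrite ler_wpM2r // ler_wiXn2l // leq_subr.
have qV := ler_wpM2l p0 V.
set u := at_ / c.
have au : at_ <= u by rewrite /u ler_pdivlMr // ler_piMr.
have fB : at_ * f * b ^+ 2 <= f ^+ 2 * b ^+ 2 * u.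
  have -> : f ^+ 2 * b ^+ 2 * u = (u * f ^+ 2) * b ^+ 2 by ring.
  by rewrite ler_wpM2r ?sqr_ge0 // ler_pM.
have fB0 : 0 <= at_ * f * b ^+ 2 by exact: mulr_ge0 (mulr_ge0 at0 f0) (sqr_ge0 b).
have qB : q ^+ (j - tau) * (at_ * f * b ^+ 2) <= 1 * (at_ * f * b ^+ 2).
  by rewrite ler_wpM2r.
lra.
Qed.

Theorem theorem2p1 (R : realType) (S A : finType)
  (P : A -> S -> S -> R) (r : S -> A -> R) (gamma : R)
  (hP : forall a, is_stochastic (P a))
  (hr : forall s a, `|r s a| <= 1)
  (hgamma : 0 < gamma < 1)
  (d : nat) (hd : (0 < d)%N) (phi : S * A -> 'cV[R]_d)
  (hphi_indep : row_free (feature_mx phi)^T)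
  (hphi_norm : forall x, norm1 (phi x) <= 1)
  (pib : S -> A -> R) (hpib : is_stochastic pib)
  (hpib_pos : forall s a, 0 < pib s a)
  (hirr : irreducible (induced_kernel P pib))
  (haper : aperiodic (induced_kernel P pib))
  (mub : S -> R) (hmub : stationary (induced_kernel P pib) mub)
  (disp : measure_display) (T : measurableType disp) (Pr : probability T R)
  (St : nat -> T -> S) (Ac : nat -> T -> A)
  (htraj : is_trajectory P pib Pr St Ac)
  (pi : S -> A -> R) (hpi : is_stochastic pi)
  (gammac : R) (hgammac : 0 < gammac < 1)
  (n : nat) (hn0 : (0 < n)%N)
  (hn : (2 * ln gammac + ln (kappa_min mub pib)) / (2 * ln gamma) <= n%:R)
  (wpi : 'cV[R]_d)
  (hwpi : projected_bellman P r gamma pi pib mub phi n wpi)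
  (w0 : 'cV[R]_d) :
  let w (alpha : nat -> R) (k : nat) (o : T) : 'cV[R]_d :=
    td_iter r gamma pi pib phi n alpha w0 (fun i => (St i o, Ac i o)) k in
  let lmin := min_eigenvalue (gram_mx phi mub pib) in
  let f := geom n (gamma * max_ratio pi pib) in
  let c1 := (norm2 w0 + norm2 (w0 - wpi) + 1) ^+ 2 in
  let c2 := 114 * f ^+ 2 * (norm2 wpi + 1) ^+ 2 in
  (forall alpha : R, 0 < alpha ->
     let tau := (mixing_time (induced_kernel P pib) mub alpha + n + 1)%N in
     alpha * tau%:R <= (1 - gammac) / (456 * f ^+ 2) ->
     forall k : nat, (tau <= k)%N ->
       ('E_Pr[(fun o => norm2 (w (fun=> alpha) k o - wpi) ^+ 2)%R]
        <= (c1 * (1 - (1 - gammac) * lmin * alpha) ^+ (k - tau)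
            + c2 * (alpha * tau%:R / ((1 - gammac) * lmin)))%:E)%E)
  /\
  (forall alpha : nat -> R, (forall k, 0 < alpha k) ->
     series alpha k @[k --> \oo] --> +oo ->
     cvgn (series (fun k => alpha k ^+ 2)) ->
     {ae Pr, forall o, w alpha k o @[k --> \oo] --> wpi}).
Proof.
move=> w lmin f c1 c2.
have Pb_st := induced_kernel_stoch hP hpib.
(* [S * A] is inhabited because [kappa] sums to one; [y0] will serve as the default letter of
   [nth]. *)
have [y0 _] : exists y0 : S * A, True.
  apply: contrapT => nex; have [_ h] := kappa_pmf hpib hmub.
  move: h; rewrite big1 => [/esym/eqP|x]; first by rewrite oner_eq0.
  by case: nex; exists x.
have p_pmf := first_law_pmf htraj.
set p := first_law Pr St Ac in p_pmf.
pose x (al : nat -> R) := history_iter r gamma phi pib pi n wpi w0 y0 al.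
have xE al j o : x al (past St Ac (n + j) o) = w al j o - wpi.
  apply: history_iterE; first by rewrite size_past.
  by move=> i ij; rewrite nth_past.
have [gc0 gc1] : 0 < gammac /\ gammac < 1 by case/andP: hgammac.
split.
  move=> al al0 tau small j tauj.
  pose t := mixing_time (induced_kernel P pib) mub al.
  have f1 : 1 <= f.
    have /andP[z0 z1] := is_ratio_bnd y0 hpib_pos hpi.
    have g0 : 0 <= gamma by case/andP: hgamma => /ltW.
    rewrite /f geomE big_nat_recl // expr0 lerDl; apply: sumr_ge0 => i _.
    by rewrite exprn_ge0 // mulr_ge0 // (le_trans z0).
  have f0 : 0 <= f by exact: le_trans f1.
  have al0' := ltW al0.
  have tau2 : (2 : R) <= tau%:R.
    by rewrite ler_nat /tau addn1 ltnS addn_gt0 hn0 orbT.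
  have s456 : al * tau%:R * f ^+ 2 <= 456^-1.
    have f20 : 0 < f ^+ 2 by rewrite exprn_gt0 // (lt_le_trans _ f1).
    have : al * tau%:R * f ^+ 2 <= (1 - gammac) / 456.
      by rewrite -ler_pdivlMr // -mulrA -invfM.
    lra.
  have at0 : 0 <= al * tau%:R by rewrite mulr_ge0.
  have ff : f <= f ^+ 2 by rewrite expr2 ler_peMl.
  have atf : al * tau%:R * f <= al * tau%:R * f ^+ 2 by rewrite ler_wpM2l.
  have at1 : al * tau%:R * 1 <= al * tau%:R * f by rewrite ler_wpM2l.
  have al2 : al * 2 <= al * tau%:R by rewrite ler_wpM2l.
  (* At the mixing time of level [al] the l1 distance is at most [2 * al], and the stepsize
     condition bounds this by [456^-1], well below [1 / 4]. *)
  have ht s : rowdist (induced_kernel P pib) mub t s <= 4^-1.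
    apply: le_trans (mixing_timeP Pb_st hmub hirr haper al0 s) _; lra.
  have E := expectation_past y0 htraj (n + j)
    (G := fun h => norm2 (x (fun=> al) h) ^+ 2) (fun h => sqr_ge0 _).
  rewrite [X in 'E_Pr[X]%E](_ : _ = fun o => norm2 (x (fun=> al) (past St Ac (n + j) o)) ^+ 2);
    last by apply/funext => o; rewrite xE.
  rewrite E.
  rewrite lee_fin; apply: le_trans (td_mean_square w0 y0 hP hr hgamma hd hphi_indep
    hphi_norm hpib hpib_pos hirr hmub hpi hgammac hn0 hn hwpi p_pmf ht j al0 small) _.
  rewrite -/lmin -/f -/tau.
  have k_gt0 z : 0 < kappa mub pib z.
    by rewrite mulr_gt0 // (stationary_gt0 Pb_st hmub).
  have lmin0 : 0 < lmin := min_eigenvalue_gram_gt0 hd hphi_indep k_gt0.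
  have lmin1 : lmin <= 1 := min_eigenvalue_gram_le1 hd hphi_indep k_gt0
    (kappa_pmf hpib hmub) (fun z => norm2_le1 (hphi_norm z)).
  have gc' : 0 <= 1 - gammac by rewrite subr_ge0 ltW.
  have gc'' : 1 - gammac <= 1 by rewrite gerBl ltW.
  have -> : c1 = (norm2 (w0 - wpi) + (norm2 w0 + 1)) ^+ 2.
    by rewrite /c1 addrAC addrC addrA.
  apply: finite_time_rate => //.
  - exact: norm2_ge0.
  - by rewrite lerDr norm2_ge0.
  - by rewrite addr_ge0 ?norm2_ge0.
  - apply: le_trans (norm2D _ _) _.
    by rewrite norm2N addrACA lerDl addr_ge0.
  - by rewrite ler_peMr // (le_trans _ tau2) // ler1n.
  - by rewrite mulr_gt0 // subr_gt0.
  - by rewrite -[leRHS]mulr1 ler_pM // ltW.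
move=> al al0 aldiv alsq.
(* With varying stepsizes any fixed level works; total variation [1 / 8] is l1 distance [1 / 4]. *)
have [t Ht] := @max_tv_cvg0 R S _ Pb_st _ hmub hirr haper 8^-1 (ltac:(by [])).
have ht s : rowdist (induced_kernel P pib) mub t s <= 4^-1.
  by apply: le_trans (rowdist_le_max _ _ _ _) _; lra.
have [sig sig_le sig0] := square_summable_tails alsq.
apply: ae_cvg_small_hits => e del e0 del0.
have [m Hm] := td_hits_eventually_rare w0 y0 hP hr hgamma hd hphi_indep hphi_norm
  hpib hpib_pos hirr hmub hpi hgammac hn0 hn hwpi p_pmf ht al0
  (divergent_partial_sums aldiv) sig_le sig0 e0 del0.
pose bad := fun h : seq (S * A) => (n + m <= size h)%N && (e <= norm2 (x al h) ^+ 2).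
exists m, (fun l => [set o | hits bad (past St Ac (n + m + l) o)]).
have prob l := probability_past y0 htraj (n + m + l) (hits bad).
split.
- by move=> l; case: (prob l).
- apply/nondecreasing_seqP => l; apply/subsetPset => o /= ho.
  by rewrite addnS pastS /= ho orbT.
- by move=> l; case: (prob l) => _ ->; rewrite lee_fin; exact: Hm.
(* The iterate of time [k] is read from a history of length [n + k], that is from horizon
   [k - m]. *)
move=> o k mk ek; exists (k - m)%N => /=.
rewrite -addnA subnKC //; apply: hits_here.
by rewrite /bad size_past leq_add2l mk xE.
Qed.
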